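(* Let $G$ be the simply connected simple complex algebraic group of type $F_4$ and let $H\subset G$ be the subsystem subgroup of type $B_4$. Then the varieties $G/P_i$, $i=1,\ldots,4$, are spherical $H$-varieties.
   Context: The ground field is $\mathbb{C}$. Fix a maximal torus $T$ and a Borel subgroup $B\supset T$ of $G$, with simple roots $\alpha_1,\ldots,\alpha_4$ and fundamental weights $\omega_1,\ldots,\omega_4$ in Bourbaki numbering ($\alpha_1,\alpha_2$ long). $P_i\supset B$ is the maximal parabolic subgroup associated to $\omega_i$ (the stabilizer of the highest weight line in the irreducible $G$-module of highest weight $\omega_i$). The subgroup $H$ contains $T$ and has simple roots $\beta_1=\alpha_2+2\alpha_3+2\alpha_4$, $\beta_2=\alpha_1$, $\beta_3=\alpha_2$, $\beta_4=\alpha_3$. $H$ acts on $G/P_i$ by left multiplication. $G/P_i$ is a spherical $H$-variety if a Borel subgroup of $H$ has an open orbit in it. *)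

(* Defs.v *)
(* MathComp: matrices, multivariate polynomials, classical sets; the ground
   field of the theorem is R[i] for R : realType. *)
From HB Require Import structures.
From mathcomp Require Import all_boot all_order all_algebra.
From mathcomp Require Import classical_sets reals.
From mathcomp Require Import mpoly complex.

Set Implicit Arguments.
Unset Strict Implicit.
Unset Printing Implicit Defensive.

Import GRing.Theory.

Local Open Scope classical_set_scope.
Local Open Scope ring_scope.

Definition mx_eval (F : fieldType) (n : nat) (p : {mpoly F[n * n]})
    (A : 'M[F]_n) : F :=
  p.@[fun k => mxvec A 0 k].

(* Every regular function on GL_n is a polynomial divided by a power of det,
   so polynomials cut out all the closed sets. *)
Definition zclosed (F : fieldType) (n : nat) (Z : set 'M[F]_n) : Prop :=
  exists S : set {mpoly F[n * n]},
    Z = [set A | A \in unitmx /\ forall p, S p -> mx_eval p A = 0].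

Definition zopen_in (F : fieldType) (n : nat) (X U : set 'M[F]_n) : Prop :=
  exists2 Z, zclosed Z & U = X `\` Z.

Definition zconnected (F : fieldType) (n : nat) (X : set 'M[F]_n) : Prop :=
  forall Z1 Z2, zclosed Z1 -> zclosed Z2 ->
    X `<=` Z1 `|` Z2 -> X `&` Z1 `&` Z2 = set0 -> X `<=` Z1 \/ X `<=` Z2.

(* Regular functions on a closed subset X of GL_n. *)
Definition regular_on (F : fieldType) (n : nat) (X : set 'M[F]_n)
    (f : 'M[F]_n -> F) : Prop :=
  exists (k : nat) (p : {mpoly F[n * n]}),
    forall A, X A -> f A = mx_eval p A / \det A ^+ k.

Definition is_group (F : fieldType) (n : nat) (K : set 'M[F]_n) : Prop :=
  [/\ K `<=` [set A | A \in unitmx], K 1%:M,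
      forall A B, K A -> K B -> K (A *m B) &
      forall A, K A -> K (invmx A)].

Definition algebraic_group (F : fieldType) (n : nat) (K : set 'M[F]_n) :=
  is_group K /\ zclosed K.

Definition connected_algebraic_group (F : fieldType) (n : nat)
    (K : set 'M[F]_n) :=
  algebraic_group K /\ zconnected K.

Definition group_generated (F : fieldType) (n : nat) (S : set 'M[F]_n) :
    set 'M[F]_n :=
  [set A | forall K, is_group K -> S `<=` K -> K A].

Definition derived_group (F : fieldType) (n : nat) (K : set 'M[F]_n) :=
  group_generated
    [set C | exists A B, [/\ K A, K B & C = A *m B *m invmx A *m invmx B]].

Definition is_solvable (F : fieldType) (n : nat) (K : set 'M[F]_n) : Prop :=
  exists k : nat, iter k (@derived_group F n) K `<=` [set 1%:M].

Definition normal_in (F : fieldType) (n : nat) (G N : set 'M[F]_n) : Prop :=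
  N `<=` G /\ forall g A, G g -> N A -> N (g *m A *m invmx g).

(* Simple in the sense of algebraic groups: finite centre is allowed. *)
Definition simple_algebraic_group (F : fieldType) (n : nat)
    (G : set 'M[F]_n) : Prop :=
  [/\ connected_algebraic_group G,
      exists A B, [/\ G A, G B & A *m B <> B *m A] &
      forall N, connected_algebraic_group N -> normal_in G N ->
        N = [set 1%:M] \/ N = G].

Definition is_torus (F : fieldType) (n : nat) (T : set 'M[F]_n) : Prop :=
  connected_algebraic_group T /\
  exists2 Q : 'M[F]_n, Q \in unitmx &
    forall t, T t -> is_diag_mx (Q *m t *m invmx Q).

Definition maximal_torus (F : fieldType) (n : nat) (G T : set 'M[F]_n) :=
  [/\ is_torus T, T `<=` G &
      forall T', is_torus T' -> T' `<=` G -> T `<=` T' -> T' = T].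

Definition borel_subgroup (F : fieldType) (n : nat) (G B : set 'M[F]_n) :=
  [/\ connected_algebraic_group B, is_solvable B, B `<=` G &
      forall B', connected_algebraic_group B' -> is_solvable B' ->
        B' `<=` G -> B `<=` B' -> B' = B].

(* Characters and cocharacters are total functions; only their values on T,
   resp. on nonzero scalars, are meaningful. *)
Definition character (F : fieldType) (n : nat) (T : set 'M[F]_n)
    (chi : 'M[F]_n -> F) : Prop :=
  [/\ regular_on T chi, forall t, T t -> chi t != 0 &
      forall s t, T s -> T t -> chi (s *m t) = chi s * chi t].

(* Regular functions on the multiplicative group are Laurent polynomials. *)
Definition cocharacter (F : fieldType) (n : nat) (T : set 'M[F]_n)
    (lam : F -> 'M[F]_n) : Prop :=
  [/\ exists (k : nat) (p : 'M[{poly F}]_n), forall s, s != 0 ->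
        lam s = \matrix_(i, j) ((p i j).[s] / s ^+ k),
      forall s, s != 0 -> T (lam s) &
      forall s t, s != 0 -> t != 0 -> lam (s * t) = lam s *m lam t].

(* Tangent space at the identity: the vectors killed by the differential at 1
   of every polynomial vanishing on K. *)
Definition lie (F : fieldType) (n : nat) (K : set 'M[F]_n) : set 'M[F]_n :=
  [set X | forall p : {mpoly F[n * n]}, (forall A, K A -> mx_eval p A = 0) ->
     \sum_(k < n * n) mx_eval (mderiv k p) 1%:M * mxvec X 0 k = 0].

Definition bracket (F : fieldType) (n : nat) (X Y : 'M[F]_n) : 'M[F]_n :=
  X *m Y - Y *m X.

Definition weight_vector (F : fieldType) (n : nat) (T : set 'M[F]_n)
    (chi : 'M[F]_n -> F) (X : 'M[F]_n) : Prop :=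
  forall t, T t -> t *m X *m invmx t = chi t *: X.

Definition is_root (F : fieldType) (n : nat) (K T : set 'M[F]_n)
    (chi : 'M[F]_n -> F) : Prop :=
  [/\ character T chi, exists2 t, T t & chi t != 1 &
      exists X, [/\ X != 0, lie K X & weight_vector T chi X]].

(* The character group is written multiplicatively:
   \sum_j c_j b_j is the function t |-> \prod_j b_j(t)^(c_j). *)
Definition char_comb (F : fieldType) (n r : nat) (b : 'I_r -> 'M[F]_n -> F)
    (c : 'I_r -> int) (t : 'M[F]_n) : F :=
  \prod_j b j t ^ c j.

(* The roots of K with respect to T form a symmetric set with base b. *)
Definition root_base (F : fieldType) (n r : nat) (K T : set 'M[F]_n)
    (b : 'I_r -> 'M[F]_n -> F) : Prop :=
  [/\ forall chi, is_root K T chi -> is_root K T (fun t => (chi t)^-1),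
      forall j, is_root K T (b j),
      forall c, (forall t, T t -> char_comb b c t = 1) -> c =1 (fun=> 0) &
      forall chi, is_root K T chi -> exists c : 'I_r -> nat,
        (forall t, T t -> chi t = char_comb b (fun j => Posz (c j)) t) \/
        (forall t, T t -> chi t = char_comb b (fun j => - Posz (c j)) t)].

Definition simple_roots (F : fieldType) (n r : nat) (G T B : set 'M[F]_n)
    (a : 'I_r -> 'M[F]_n -> F) : Prop :=
  root_base G T a /\ forall j, is_root B T (a j).

(* Chevalley generators: root vectors e_j, f_j for the simple roots a_j and
   their opposites, h_j = [e_j, f_j] in the Cartan subalgebra, generating
   lie G and subject to Serre's relations for the Cartan matrix
   A i j = <a_i, a_j^vee>. *)
Record chevalley_generators (F : fieldType) (n r : nat)
    (A : 'I_r -> 'I_r -> int) (G T B : set 'M[F]_n)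
    (a : 'I_r -> 'M[F]_n -> F) (e f h : 'I_r -> 'M[F]_n) : Prop := {
  chev_e : forall j, lie B (e j) /\ weight_vector T (a j) (e j);
  chev_f : forall j, lie G (f j) /\
             weight_vector T (fun t => (a j t)^-1) (f j);
  chev_h : forall j, lie T (h j);
  chev_hh : forall i j, bracket (h i) (h j) = 0;
  chev_ef : forall i j, bracket (e i) (f j) = if i == j then h j else 0;
  chev_he : forall i j, bracket (h j) (e i) = e i *~ A i j;
  chev_hf : forall i j, bracket (h j) (f i) = f i *~ (- A i j);
  chev_serre_e : forall i j, i != j ->
    iter `|1 - A i j|%N (bracket (e j)) (e i) = 0;
  chev_serre_f : forall i j, i != j ->
    iter `|1 - A i j|%N (bracket (f j)) (f i) = 0;
  chev_gen : forall U : {vspace 'M[F]_n},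
    (forall j, (e j \in U) /\ (f j \in U)) ->
    (forall X Y, X \in U -> Y \in U -> bracket X Y \in U) ->
    forall X, lie G X -> X \in U }.

(* G has the Cartan matrix A with respect to T, B and the numbering a of the
   simple roots.  By Serre's theorem lie G is then the semisimple Lie algebra
   presented by A. *)
Definition has_cartan_matrix (F : fieldType) (n r : nat)
    (A : 'I_r -> 'I_r -> int) (G T B : set 'M[F]_n)
    (a : 'I_r -> 'M[F]_n -> F) : Prop :=
  simple_roots G T B a /\
  exists e f h, chevalley_generators A G T B a e f h.

(* Coroots as cocharacters of T.  The simple roots of a semisimple group have
   finite index in the character group of T, so their pairings with a
   cocharacter determine it. *)
Definition simple_coroots (F : fieldType) (n r : nat)
    (A : 'I_r -> 'I_r -> int) (T : set 'M[F]_n) (a : 'I_r -> 'M[F]_n -> F)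
    (av : 'I_r -> F -> 'M[F]_n) : Prop :=
  forall j, cocharacter T (av j) /\
    forall i s, s != 0 -> a i (av j s) = s ^ A i j.

(* The coroots span the cocharacter lattice. *)
Definition simply_connected (F : fieldType) (n r : nat) (T : set 'M[F]_n)
    (av : 'I_r -> F -> 'M[F]_n) : Prop :=
  forall lam, cocharacter T lam -> exists c : 'I_r -> int,
    forall s, s != 0 -> lam s = \big[mulmx/1%:M]_j av j (s ^ c j).

Definition representation (F : fieldType) (n m : nat) (G : set 'M[F]_n)
    (rho : 'M[F]_n -> 'M[F]_m) : Prop :=
  [/\ forall i j, regular_on G (fun g => rho g i j), rho 1%:M = 1%:M &
      forall g g', G g -> G g' -> rho (g *m g') = rho g *m rho g'].

Definition irreducible_representation (F : fieldType) (n m : nat)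
    (G : set 'M[F]_n) (rho : 'M[F]_n -> 'M[F]_m) : Prop :=
  [/\ representation G rho, (0 < m)%N &
      forall U : {vspace 'cV[F]_m},
        (forall g, G g -> forall v, v \in U -> rho g *m v \in U) ->
        U = 0%VS \/ U = fullv].

Definition highest_weight_vector (F : fieldType) (n m : nat)
    (T B : set 'M[F]_n) (omega : 'M[F]_n -> F) (rho : 'M[F]_n -> 'M[F]_m)
    (v : 'cV[F]_m) : Prop :=
  [/\ v != 0, forall b, B b -> exists c, rho b *m v = c *: v &
      forall t, T t -> rho t *m v = omega t *: v].

Definition fundamental_weight (F : fieldType) (n r : nat) (T : set 'M[F]_n)
    (av : 'I_r -> F -> 'M[F]_n) (i : 'I_r) (omega : 'M[F]_n -> F) : Prop :=
  character T omega /\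
  forall j s, s != 0 -> omega (av j s) = if i == j then s else 1.

Definition line_stabilizer (F : fieldType) (n m : nat) (G : set 'M[F]_n)
    (rho : 'M[F]_n -> 'M[F]_m) (v : 'cV[F]_m) : set 'M[F]_n :=
  [set g | G g /\ exists c, rho g *m v = c *: v].

Definition fundamental_parabolic (F : fieldType) (n r : nat)
    (G T B : set 'M[F]_n) (av : 'I_r -> F -> 'M[F]_n) (i : 'I_r)
    (P : set 'M[F]_n) : Prop :=
  exists (m : nat) (rho : 'M[F]_n -> 'M[F]_m) (v : 'cV[F]_m)
      (omega : 'M[F]_n -> F),
    [/\ irreducible_representation G rho, fundamental_weight T av i omega,
        highest_weight_vector T B omega rho v &
        P = line_stabilizer G rho v].

Definition left_translate (F : fieldType) (n : nat) (g : 'M[F]_n)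
    (X : set 'M[F]_n) : set 'M[F]_n :=
  [set g *m x | x in X].

Definition coset_space (F : fieldType) (n : nat) (G P : set 'M[F]_n) :
    set (set 'M[F]_n) :=
  [set left_translate g P | g in G].

(* The Zariski topology of G/P is the quotient topology of that of G. *)
Definition open_in_coset_space (F : fieldType) (n : nat)
    (G P : set 'M[F]_n) (U : set (set 'M[F]_n)) : Prop :=
  U `<=` coset_space G P /\
  zopen_in G [set g | G g /\ U (left_translate g P)].

Definition left_orbit (F : fieldType) (n : nat) (K : set 'M[F]_n)
    (x : set 'M[F]_n) : set (set 'M[F]_n) :=
  [set left_translate k x | k in K].

Definition spherical (F : fieldType) (n : nat) (G H P : set 'M[F]_n) : Prop :=
  exists (BH : set 'M[F]_n) (x : set 'M[F]_n),
    [/\ borel_subgroup H BH, coset_space G P x &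
        open_in_coset_space G P (left_orbit BH x)].

(* Bourbaki numbering, a_1 and a_2 long; indices are shifted to 0..3. *)
Definition cartan_F4 (i j : 'I_4) : int :=
  nth 0 (nth [::] [:: [::  2; -1;  0;  0];
                      [:: -1;  2; -2;  0];
                      [::  0; -1;  2; -1];
                      [::  0;  0; -1;  2] ] i) j.

(* Rows: b_1 = a_2 + 2 a_3 + 2 a_4, b_2 = a_1, b_3 = a_2, b_4 = a_3. *)
Definition B4_coef (j k : 'I_4) : int :=
  nth 0 (nth [::] [:: [:: 0; 1; 2; 2];
                      [:: 1; 0; 0; 0];
                      [:: 0; 1; 0; 0];
                      [:: 0; 0; 1; 0] ] j) k.

Definition B4_simple_roots (F : fieldType) (n : nat)
    (a : 'I_4 -> 'M[F]_n -> F) (j : 'I_4) : 'M[F]_n -> F :=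
  char_comb a (B4_coef j).

(* The connected closed subgroup of G containing T whose root system has
   base b.  It is determined by b: for B4_simple_roots, the F_4 roots in the
   integer span of b are exactly the 32 roots of a system of type B_4. *)
Definition subsystem_subgroup (F : fieldType) (n r : nat)
    (G T H : set 'M[F]_n) (b : 'I_r -> 'M[F]_n -> F) : Prop :=
  [/\ connected_algebraic_group H, T `<=` H, H `<=` G & root_base H T b].

(* Main.v *)
(* Let b_H be the Lie algebra of a Borel subgroup B_H of H and p_i that of P_i.
   If b_H + Ad(x) p_i = lie G for some x in G, then B_H x P_i is open in G: it is
   dense near 1 by a Krull intersection argument, constructible by quantifier
   elimination, and homogeneous.  The table of brackets of lie G in a Chevalley
   basis follows from the relations between the Chevalley generators, because a
   lowest weight vector of positive weight in a finite-dimensional sl_2-module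
   is 0.  A highest weight vector of weight omega_i is killed by e_j and h_j, hence
   by f_j, for j <> i, so that p_i contains the expected root spaces.  When x is
   a suitable product of elements exp f_j, the equality becomes a rank
   computation with integer matrices. *)

(* The Lie algebra condition has no slack. A Borel subalgebra of type B_4 has dimension 16 + 4 = 20,
   which is also the dimension of G/P_2 and G/P_3; for these two the sum [b_H + Ad(x) p_i] must be
   direct, so x has to be in general position. Two obstacles shape the rest. First, groups are
   connected in the sense of closed sets, with no irreducibility at hand. Density near 1 is
   therefore expressed by one polynomial h with h(1) = 1 such that h f vanishes on G whenever f
   vanishes on the product, and an irreducible open piece of G is extracted by the ascending chain
   condition. Second, no Borel subgroup of H is given. One is grown from the group generated by T
   and the exponentials of the positive root vectors of B_4: this group lies in B, so it inherits
   solvability. Fundamental weights are defined through coroots as cocharacters, whereas sl_2 theory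
   speaks of the h_j; the derivative of each coroot at 1 has to be identified with h_j before the
   parabolics can be studied. Characteristic 0 enters through exponentials and through division by k
   + 1 when leading forms are compared. *)
Require Import Defs.
From HB Require Import structures.
From Stdlib Require Import ZArith.
From mathcomp Require Import all_boot all_order all_algebra.
From mathcomp Require Import closed_field.
From mathcomp Require Import boolp classical_sets reals.
From mathcomp Require Import mpoly complex ring ssrZ zify.

Set Implicit Arguments.
Unset Strict Implicit.
Unset Printing Implicit Defensive.

Import Order.TTheory GRing.Theory Num.Theory.

Local Open Scope classical_set_scope.
Local Open Scope ring_scope.

Delimit Scope Z_scope with coqZ.

(** * Noetherian polynomial rings *)

Section Ideals.
Variable A : comNzRingType.
Implicit Types (I J : A -> Prop) (s : seq A).

Definition is_ideal I :=
  [/\ I 0, forall f g, I f -> I g -> I (f + g) & forall a f, I f -> I (a * f)].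

(** The intersection of all ideals containing [S]. Choosing the ideal [J] turns membership into an
    induction principle; [ideal_genP] recovers coefficients for a finite list. *)
Definition ideal_gen (S : A -> Prop) (f : A) :=
  forall J, is_ideal J -> (forall x, S x -> J x) -> J f.

Lemma ideal_gen_ideal S : is_ideal (ideal_gen S).
Proof.
split=> [J [] //|f g If Ig J idJ SJ|a f If J idJ SJ].
  by case: (idJ) => _ D _; apply: D; [apply: If | apply: Ig].
by case: (idJ) => _ _ M; apply: M; apply: If.
Qed.

Lemma ideal_gen_sub (S : A -> Prop) x : S x -> ideal_gen S x.
Proof. by move=> Sx J _; apply. Qed.

Lemma ideal_sum I (T : Type) (r : seq T) (P : pred T) (E : T -> A) :
  is_ideal I -> (forall i, P i -> I (E i)) -> I (\sum_(i <- r | P i) E i).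
Proof. by case=> I0 ID _ IE; elim/big_ind: _. Qed.

Lemma ideal_opp I f : is_ideal I -> I f -> I (- f).
Proof. by case=> _ _ IM If; rewrite -mulN1r; apply: IM. Qed.

Lemma ideal_genP s f : ideal_gen (fun x => x \in s) f ->
  exists c : 'I_(size s) -> A, f = \sum_i c i * s`_i.
Proof.
pose K f := exists c : 'I_(size s) -> A, f = \sum_i c i * s`_i.
move/(_ K); apply.
  split=> [|_ _ [c ->] [d ->]|a _ [c ->]].
  - by exists (fun=> 0); rewrite big1 // => i _; rewrite mul0r.
  - exists (fun i => c i + d i); rewrite -big_split /=.
    by apply: eq_bigr => i _; rewrite mulrDl.
  - exists (fun i => a * c i); rewrite big_distrr /=.
    by apply: eq_bigr => i _; rewrite mulrA.
move=> x xs; have lt_xs : (index x s < size s)%N by rewrite index_mem.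
exists (fun i => (i == Ordinal lt_xs)%:R).
rewrite (bigD1 (Ordinal lt_xs)) //= eqxx mul1r nth_index // big1 ?addr0 //.
by move=> i /negPf->; rewrite mul0r.
Qed.

Definition noetherian := forall I, is_ideal I ->
  exists s : seq A, (forall x, x \in s -> I x) /\
    forall f, I f -> ideal_gen (fun x => x \in s) f.

(** Without a maximal element, choice produces a strictly increasing chain in [E]. Its union is an
    ideal whose finitely many generators already lie in one term of the chain. *)
Lemma noetherian_max (N : noetherian) (E : (A -> Prop) -> Prop) I0 :
  E I0 -> (forall I, E I -> is_ideal I) ->
  exists I, E I /\ forall J, E J -> (forall f, I f -> J f) ->
    forall f, J f -> I f.
Proof.
move=> EI0 idE; apply: contrapT => nomax.
have next (P : {I | E I}) : exists Q : {I | E I},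
    (forall f, sval P f -> sval Q f) /\ exists f, sval Q f /\ ~ sval P f.
  case: P => I EI /=; apply: contrapT => nonext; apply: nomax.
  exists I; split=> // J EJ sIJ f Jf; apply: contrapT => nIf.
  by apply: nonext; exists (exist _ J EJ); split=> //; exists f.
have [nx nxP] := choice next.
pose C k : A -> Prop := sval (iter k nx (exist _ I0 EI0)).
have CS k f : C k f -> C k.+1 f by case: (nxP (iter k nx (exist _ I0 EI0))) => + _; apply.
have Cmono k l f : (k <= l)%N -> C k f -> C l f.
  elim: l => [|l IH]; first by rewrite leqn0 => /eqP->.
  by rewrite leq_eqVlt => /orP[/eqP<- //|/IH{}IH /IH]; apply: CS.
have idC k : is_ideal (C k) by apply: idE; exact: svalP (iter k nx _).
pose U f := exists k, C k f.
have idU : is_ideal U.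
  split=> [|f g [k Ck] [l Cl]|a f [k Ck]].
  - by exists 0%N; case: (idC 0%N).
  - exists (maxn k l); case: (idC (maxn k l)) => _ D _.
    by apply: D; [apply: Cmono Ck; rewrite leq_maxl | apply: Cmono Cl; rewrite leq_maxr].
  - by exists k; case: (idC k) => _ _; apply.
have [s [sU Us]] := N U idU.
have [k sC] : exists k, forall x, x \in s -> C k x.
  elim: s sU {Us} => [|y s IHs] sU; first by exists 0%N.
  have [k kP] : exists k, forall x, x \in s -> C k x.
    by apply: IHs => x xs; apply: sU; rewrite inE xs orbT.
  have [l lP] := sU y (mem_head _ _).
  exists (maxn k l) => x; rewrite inE => /predU1P[->|/kP].
    by apply: Cmono lP; rewrite leq_maxr.
  by apply: Cmono; rewrite leq_maxl.
have [_ [f [Cf nCf]]] := nxP (iter k nx (exist _ I0 EI0)).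
by apply: nCf; exact: (Us f (ex_intro _ k.+1 Cf) (C k) (idC k) sC).
Qed.

(** Nakayama's lemma by Cayley-Hamilton: the relations say that (1 - M) s is 0 modulo [I], with
    [phi] killing M. Multiplying by the adjugate puts det(1 - M) s in [I], and [phi] maps det(1 - M)
    to 1. *)
Lemma determinant_trick (F : comNzRingType) (phi : {rmorphism A -> F}) I s :
  is_ideal I ->
  (forall x, x \in s -> exists (a : 'I_(size s) -> A) y,
     [/\ forall l, phi (a l) = 0, I y & x = \sum_l a l * s`_l + y]) ->
  exists d, phi d = 1 /\ forall x, x \in s -> I (d * x).
Proof.
move=> idI sP.
have /choice[a aP] (k : 'I_(size s)) : exists a : 'I_(size s) -> A,
    (forall l, phi (a l) = 0) /\ I (s`_k - \sum_l a l * s`_l).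
  have [a [y [a0 Iy E]]] := sP s`_k (mem_nth 0 (ltn_ord k)).
  by exists a; split=> //; rewrite {1}E addrAC subrr add0r.
pose M : 'M[A]_(size s) := \matrix_(k, l) a k l.
exists (\det (1%:M - M)); split.
  rewrite -det_map_mx map_mxB map_mx1 (_ : map_mx phi M = 0) ?subr0 ?det1 //.
  by apply/matrixP => k l; rewrite !mxE; case: (aP k).
move=> x xs; have lt_xs : (index x s < size s)%N by rewrite index_mem.
pose v : 'cV[A]_(size s) := \col_k s`_k.
have Iv k : I (((1%:M - M) *m v) k 0).
  rewrite mulmxBl mul1mx mxE [X in I (_ + X)]mxE [X in I (X - _)]mxE.
  case: (aP k) => _; congr (I (_ - _)).
  by rewrite mxE; apply: eq_bigr => l _; rewrite !mxE.
have -> : \det (1%:M - M) * x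
    = (\adj (1%:M - M) *m ((1%:M - M) *m v)) (Ordinal lt_xs) 0.
  by rewrite mulmxA mul_adj_mx mul_scalar_mx !mxE /= nth_index.
rewrite mxE; apply: ideal_sum => // l _; case: idI => _ _; exact.
Qed.

End Ideals.

(** * Dickson's lemma and Hilbert's basis theorem *)

Section Dickson.

(** [m a] is a position, from [a] on, where the tail of [u] attains its minimum; restarting each
    time just after the previous choice gives the subsequence. *)
Lemma nondecreasing_subseq (u : nat -> nat) : exists g : nat -> nat,
  {homo g : i j / (i < j)%N} /\ {homo u \o g : i j / (i <= j)%N}.
Proof.
have /choice[m mP] (a : nat) : exists b, (a <= b)%N /\
    forall c, (a <= c)%N -> (u b <= u c)%N.
  have exv : exists v, `[< exists b, (a <= b)%N /\ u b = v >].
    by exists (u a); apply/asboolP; exists a.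
  case: (ex_minnP exv) => v /asboolP[b [le_ab <-]] vmin.
  by exists b; split=> // c le_ac; apply: vmin; apply/asboolP; exists c.
pose g := fix g k := if k is k'.+1 then m (g k').+1 else m 0%N.
exists g; split.
  by apply: homo_ltn => [|i] /=; [exact: ltn_trans | case: (mP (g i).+1)].
apply: homo_leq => [//||i] /=; first exact: leq_trans.
have [le_i _] := mP (g i).+1.
case: i le_i => [|i] le_i /=; first by case: (mP 0%N) => _; apply.
case: (mP (g i).+1) => _; apply; apply: ltnW; apply: leq_trans le_i.
by rewrite ltnS; case: (mP (g i).+1).
Qed.

Lemma dickson n (m : nat -> 'X_{1..n}) :
  exists i j, (i < j)%N /\ (m i <= m j)%MM.
Proof.
suff /(_ n)[g [g_lt gP]] : forall k, exists g : nat -> nat, {homo g : i j / (i < j)%N} /\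
    forall l : 'I_n, (l < k)%N -> {homo (fun i => m (g i) l) : i j / (i <= j)%N}.
  exists (g 0%N), (g 1%N); split; first exact: g_lt.
  by apply/mnm_lepP => l; apply: (gP l (ltn_ord l)).
elim=> [|k [g [g_lt gP]]]; first by exists id; split=> // i j.
case: (ltnP k n) => [lt_kn|le_nk]; last first.
  by exists g; split=> // l _; apply: gP; apply: leq_trans le_nk.
have [h [h_lt hP]] := nondecreasing_subseq (fun i => m (g i) (Ordinal lt_kn)).
exists (g \o h); split=> [i j /h_lt /g_lt //|l].
rewrite ltnS leq_eqVlt => /orP[/eqP El|lt_lk] i j le_ij.
  by rewrite (_ : l = Ordinal lt_kn); [exact: hP | exact: val_inj].
by apply: gP => //; move: le_ij; rewrite leq_eqVlt => /orP[/eqP->|/h_lt/ltnW].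
Qed.

End Dickson.

Section HilbertBasis.
Variables (F : fieldType) (n : nat).
Local Notation A := {mpoly F[n]}.

(** If [I] is not finitely generated, elements can be chosen forever, each with minimal leading
    monomial among those of [I] outside the ideal of the earlier ones. By Dickson's lemma some
    leading monomial divides a later one; cancelling the later leading term contradicts its
    minimality. *)
Theorem hilbert_basis : noetherian A.
Proof.
move=> I idI; apply: contrapT => nfg.
pose inI (s : seq A) := forall x, x \in s -> I x.
pose gen (s : seq A) := ideal_gen (fun x => x \in s).
have /choice[st stP] (s : seq A) : exists f, inI s ->
    [/\ I f, ~ gen s f & forall g, I g -> ~ gen s g -> ~ (mlead g < mlead f)%O].
  have [sI|] := pselect (inI s); last by exists 0.
  have [f0 [If0 nf0]] : exists f, I f /\ ~ gen s f.
    apply: contrapT => no; apply: nfg; exists s; split=> // f If.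
    by apply: contrapT => nf; apply: no; exists f.
  move: {2}(mlead f0) (erefl (mlead f0)) => m; elim/(well_founded_ind (@ltom_wf n)): m f0 If0 nf0.
  move=> m IH f If nf Em.
  have [[g [Ig ng lt_g]]|no] := pselect (exists g, [/\ I g, ~ gen s g & (mlead g < m)%O]).
    exact: IH lt_g g Ig ng erefl.
  exists f => _; split=> // g Ig ng; rewrite Em => lt_g; apply: no; by exists g.
pose ss := fix ss k := if k is k'.+1 then st (ss k') :: ss k' else [::].
have ssI k : inI (ss k).
  elim: k => //= k IH x; rewrite inE => /predU1P[->|]; last exact: IH.
  by case: (stP _ IH).
have ss_mem i j : (i < j)%N -> st (ss i) \in ss j.
  elim: j => //= j IH; rewrite ltnS leq_eqVlt inE => /orP[/eqP->|/IH->].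
    by rewrite eqxx.
  by rewrite orbT.
have [i [j [lt_ij le_ij]]] := dickson (fun k => mlead (st (ss k))).
have [Ij nj minj] := stP _ (ssI j).
have gi : gen (ss j) (st (ss i)) by apply: ideal_gen_sub; exact: ss_mem.
move: nj minj gi (stP _ (ssI i)) Ij le_ij; set fi := st (ss i); set fj := st (ss j).
move=> nj minj gi [Ii ni _] Ij le_ij.
have [idg0 idgD idgM] := ideal_gen_ideal (fun x : A => x \in ss j).
have fi0 : fi != 0.
  by apply/eqP => fi0; apply: ni; rewrite fi0; case: (ideal_gen_ideal (fun x : A => x \in ss i)).
have fj0 : fj != 0 by apply/eqP => fj0; apply: nj; rewrite fj0.
have lci : fi@_(mlead fi) != 0 by rewrite mleadc_eq0.
pose c := fj@_(mlead fj) / fi@_(mlead fi).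
have c0 : c != 0 by rewrite mulf_neq0 ?invr_eq0 // mleadc_eq0.
pose q : A := c *: 'X_[mlead fj - mlead fi].
have q0 : q != 0 by rewrite mscalerI negb_or c0 -msize_poly_eq0 msizeX.
have lq : mlead (q * fi) = mlead fj.
  rewrite mleadM //.
  by rewrite mleadZ // mleadXm submK.
pose g := fj - q * fi.
have ng : ~ gen (ss j) g.
  move=> gg; apply: nj; rewrite -(subrK (q * fi) fj); apply: idgD => //.
  exact: idgM.
have Ig : I g.
  case: (idI) => _ D M; apply: D => //; apply: ideal_opp => //; exact: M.
apply: (minj g Ig ng).
have g0 : g != 0 by apply/eqP => g0; apply: ng; rewrite g0.
have lcg : g@_(mlead fj) = 0.
  rewrite mcoeffB -{2}lq (mleadM q0 fi0) mleadcM /q mleadcZE.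
  by rewrite mleadXm mcoeffX eqxx mulr1 divfK // subrr.
rewrite lt_neqAle; apply/andP; split.
  by apply/eqP => E; move: g0; rewrite -mleadc_eq0 E lcg eqxx.
by apply: le_trans (mleadB_le _ _) _; rewrite lq joinxx.
Qed.

End HilbertBasis.

(** * Krull's intersection theorem at the origin *)

Section Krull.
Variables (F : fieldType) (n : nat).
Local Notation A := {mpoly F[n]}.
Implicit Types (f g p q : A) (I : A -> Prop).

(* [ordge k f]: [f] lies in the k-th power of the maximal ideal at 0. *)
Definition ordge (k : nat) f := forall m, (mdeg m < k)%N -> f@_m = 0.

Lemma ordgeD k f g : ordge k f -> ordge k g -> ordge k (f + g).
Proof. by move=> kf kg m lt_m; rewrite mcoeffD kf // kg // addr0. Qed.

Lemma ordgeM k l f g : ordge k f -> ordge l g -> ordge (k + l) (f * g).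
Proof.
move=> kf lg m lt_m; rewrite mcoeffM big1 // => -[m1 m2] /= /eqP Em.
case: (ltnP (mdeg m1) k) => [/kf->|le1]; first by rewrite mul0r.
case: (ltnP (mdeg m2) l) => [/lg->|le2]; first by rewrite mulr0.
have le_m : (k + l <= mdeg m)%N by rewrite {1}Em mdegD leq_add.
by rewrite ltnNge le_m in lt_m.
Qed.

Lemma ordge_ideal k : is_ideal (ordge k).
Proof.
split=> [m _|f g|a f kf]; [exact: mcoeff0 | exact: ordgeD|].
by rewrite -(add0n k); apply: ordgeM.
Qed.

Lemma ordgeX m : ordge (mdeg m) 'X_[m].
Proof. by move=> m'; rewrite mcoeffX; case: eqVneq => // ->; rewrite ltnn. Qed.

(** Let m be the maximal ideal at 0 and J the intersection of all I + m^k. The core is J = I + m J,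
    after which [determinant_trick], with evaluation at 0 as [phi], yields d in 1 + m with d J
    inside I. *)
Theorem krull_intersection I : is_ideal I ->
  exists d : A, d@_0%MM = 1 /\ forall f,
    (forall k, exists p q, [/\ I p, ordge k q & f = p + q]) -> I (d * f).
Proof.
move=> idI; case: (idI) => I0 ID IM.
pose J f := forall k, exists p q, [/\ I p, ordge k q & f = p + q].
have idJ : is_ideal J.
  split=> [k|f g Jf Jg k|a f Jf k].
  - by exists 0, 0; split; rewrite ?addr0 //; case: (ordge_ideal k).
  - have [p [q [Ip kq ->]]] := Jf k; have [p' [q' [Ip' kq' ->]]] := Jg k.
    by exists (p + p'), (q + q'); rewrite addrACA; split; [apply: (ID) | apply: ordgeD |].
  - have [p [q [Ip kq ->]]] := Jf k; exists (a * p), (a * q); rewrite mulrDr.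
    by split=> //; [apply: (IM) | case: (ordge_ideal k) => _ _; apply].
have IJ f : I f -> J f.
  by move=> If k; exists f, 0; rewrite addr0; split=> //; case: (ordge_ideal k).
pose gens f := I f \/ exists a j, [/\ a@_0%MM = 0, J j & f = a * j].
pose K := ideal_gen gens.
have idK : is_ideal K := ideal_gen_ideal gens.
(* Here K = I + m J. A maximal Q containing K with Q meeting J only in K will turn out to contain a
   power of m; then J lies in I + m^N, hence in Q, hence in K. *)
pose E Q := [/\ is_ideal Q, forall f, K f -> Q f & forall f, Q f -> J f -> K f].
have EK : E K by split.
have noethA : noetherian A := @hilbert_basis F n.
have [Q [[idQ sKQ QJ] Qmax]] := noetherian_max noethA EK (fun Q h => let: And3 x _ _ := h in x).
case: (idQ) => Q0 QD QM.
(* Take r where the colon ideals (Q : X_i^r) become stationary. Since X_i J lies in K, adjoining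
   X_i^r to Q does not enlarge the intersection with J, so maximality forces X_i^r into Q. *)
have /choice[r rP] (i : 'I_n) : exists r, Q ('X_i ^+ r).
  pose colon r f := Q (f * 'X_i ^+ r).
  pose E' C := exists r, C = colon r.
  have idcolon r : is_ideal (colon r).
    split; rewrite /colon; first by rewrite mul0r.
      by move=> f g Qf Qg; rewrite mulrDl; apply: (QD).
    by move=> a f Qf; rewrite -mulrA; apply: (QM).
  have E'0 : E' (colon 0%N) by exists 0%N.
  have [C [[r Cr] Cmax]] :=
    noetherian_max noethA E'0 (fun C h => let: ex_intro r e := h in
      eq_ind_r (fun C => is_ideal C) (idcolon r) e).
  exists r; pose Q' f := exists q b, Q q /\ f = q + b * 'X_i ^+ r.
  have idQ' : is_ideal Q'.
    split=> [|_ _ [q [b [Qq ->]]] [q' [b' [Qq' ->]]]|a _ [q [b [Qq ->]]]].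
    - by exists 0, 0; rewrite mul0r addr0.
    - exists (q + q'), (b + b'); split; first exact: QD.
      by rewrite mulrDl addrACA.
    - exists (a * q), (a * b); split; first exact: QM.
      by rewrite mulrDr mulrA.
  have sQQ' f : Q f -> Q' f by move=> Qf; exists f, 0; rewrite mul0r addr0.
  apply: (Qmax Q') => //; last by exists 0, 1; rewrite mul1r add0r.
  split=> // [f Kf|_ [q [b [Qq ->]]] Jf]; first by apply: (sQQ'); apply: (sKQ).
  apply: (QJ) => //; apply: (QD) => //.
  have : colon r.+1 b.
    rewrite /colon exprS mulrCA -(addKr q (b * 'X_i ^+ r)) mulrDr.
    apply: (QD); first by rewrite mulrN; apply: ideal_opp => //; apply: (QM).
    apply: (sKQ); apply: ideal_gen_sub; right.
    by exists 'X_i, (q + b * 'X_i ^+ r); rewrite mcoeffX mnm1_eq0.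
  have sub f : C f -> colon r.+1 f.
    by rewrite Cr /colon exprS => Cf; rewrite mulrCA; apply: (QM).
  by move/(Cmax _ (ex_intro _ r.+1 erefl) sub); rewrite Cr.
have JK f : J f -> K f.
  move=> Jf; apply: (QJ) => //.
  (* A monomial of degree above the sum of the r_i is divisible by some X_i^(r_i). *)
  have [p [q [Ip kq ->]]] := Jf (\sum_i r i).+1.
  apply: (QD); first by apply: (sKQ); apply: ideal_gen_sub; left.
  rewrite (mpolyE q) big_seq; apply: ideal_sum => // m.
  rewrite mcoeff_msupp -mul_mpolyC => qm; apply: (QM).
  have lt_m : (\sum_i r i < mdeg m)%N.
    by rewrite ltnNge; apply: contra qm => le_m; apply/eqP/kq.
  have [i lt_i] : exists i, (r i < m i)%N.
    apply: contrapT => no; move: lt_m; rewrite ltnNge mdegE leq_sum // => i _.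
    by rewrite leqNgt; apply/negP => lt_i; apply: no; exists i.
  rewrite -(submK (m := U_(i) *+ r i) (m' := m)%MM); last first.
    apply/mnm_lepP => l; rewrite mulmnE mnm1E; case: eqVneq => [<-|] //.
    by rewrite mul1n ltnW.
  by rewrite mpolyXD -mpolyXn; apply: (QM).
have [s [sJ Js]] := noethA J idJ.
have [] := @determinant_trick A F (mcoeff 0%MM) I s idI.
  move=> x xs.
  pose K' f := exists (a : 'I_(size s) -> A) y,
     [/\ forall l, (a l)@_0%MM = 0, I y & f = \sum_l a l * s`_l + y].
  apply: (JK x (sJ x xs) K').
    split=> [|_ _ [a [y [a0 Iy ->]]] [b [z [b0 Iz ->]]]|u _ [a [y [a0 Iy ->]]]].
    - exists (fun=> 0), 0; split=> // [l|]; first exact: mcoeff0.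
      by rewrite big1 ?addr0 // => l _; rewrite mul0r.
    - exists (fun l => a l + b l), (y + z); split=> [l||]; last 1 first.
      + rewrite addrACA -big_split /=; congr (_ + _).
        by apply: eq_bigr => l _; rewrite mulrDl.
      + by rewrite mcoeffD a0 b0 addr0.
      + exact: ID.
    - exists (fun l => u * a l), (u * y); split=> [l||]; last 1 first.
      + rewrite mulrDr big_distrr /=; congr (_ + _).
        by apply: eq_bigr => l _; rewrite mulrA.
      + by rewrite (rmorphM (mcoeff 0%MM)) /= a0 mulr0.
      + exact: IM.
  move=> f [If|[u [j [u0 Jj ->]]]].
    exists (fun=> 0), f; split=> // [l|]; first exact: mcoeff0.
    by rewrite big1 ?add0r // => l _; rewrite mul0r.
  have [c ->] := ideal_genP (Js j Jj).
  exists (fun l => u * c l), 0; split=> // [l|].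
    by rewrite (rmorphM (mcoeff 0%MM)) /= u0 mul0r.
  by rewrite addr0 big_distrr /=; apply: eq_bigr => l _; rewrite mulrA.
move=> d [d0 dP]; exists d; split=> // f Jf.
have [c ->] := ideal_genP (Js f Jf).
rewrite big_distrr /=; apply: ideal_sum => // l _.
by rewrite mulrCA; apply: (IM); apply: dP; exact: mem_nth.
Qed.

End Krull.

(** * Polynomial functions on matrices *)

Section Subspace.
Variable (F : fieldType).

(** Take [M] of maximal rank among the matrices whose row space lies in [P]; adjoining a vector of
    [P] cannot raise its rank. *)
Lemma subspace_mx N (P : 'rV[F]_N -> Prop) :
  P 0 -> (forall a u v, P u -> P v -> P (a *: u + v)) ->
  exists M : 'M[F]_N, forall v, (v <= M)%MS <-> P v.
Proof.
move=> P0 PD.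
pose Q (M : 'M[F]_N) := forall v : 'rV_N, (v <= M)%MS -> P v.
have exr : exists r, `[< exists M, Q M /\ \rank M = r >].
  exists 0%N; apply/asboolP; exists 0; rewrite mxrank0; split=> // v.
  by rewrite submx0 => /eqP->.
have bound r : `[< exists M, Q M /\ \rank M = r >] -> (r <= N)%N.
  by move=> /asboolP[M [_ <-]]; exact: rank_leq_col.
case: (ex_maxnP exr bound) => r /asboolP[M [QM rM]] Mmax.
exists M => v; split=> [|Pv]; first exact: QM.
have QMv : Q (<<col_mx M v>>)%MS.
  move=> w; rewrite genmxE -addsmxE => /sub_addsmxP[[a b] /= ->].
  have [c ->] : exists c, b *m v = c *: v.
    by exists (b 0 0); rewrite {1}[b]mx11_scalar mul_scalar_mx.
  by rewrite addrC; apply: PD => //; apply: QM; exact: submxMl.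
have le_r : (\rank (col_mx M v) <= r)%N.
  apply: Mmax; apply/asboolP; exists (<<col_mx M v>>)%MS; split=> //.
  by rewrite genmxE.
have sMv : (M <= col_mx M v)%MS by rewrite -addsmxE addsmxSl.
have : (M == col_mx M v)%MS by rewrite -(geq_leqif (mxrank_leqif_eq sMv)) rM.
by move/eqmxP=> ->; rewrite -addsmxE addsmxSr.
Qed.

End Subspace.

Section PolyZero.
Variable F : numFieldType.

Lemma poly_cofin_eq0 (p q : {poly F}) : q != 0 ->
  (forall s, q.[s] != 0 -> p.[s] = 0) -> p = 0.
Proof.
move=> q0 pq; suff: p * q == 0 by rewrite mulf_eq0 (negbTE q0) orbF => /eqP.
apply/negPn/negP => pq0.
pose rs := [seq k%:R : F | k <- iota 0 (size (p * q))].
have := max_poly_roots pq0 (rs := rs); rewrite size_map size_iota ltnn => H.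
suff: false by [].
apply: H.
  apply/allP => _ /mapP[k _ ->]; rewrite rootE hornerM mulf_eq0.
  by case: (eqVneq q.[k%:R] 0) => [|/pq->]; rewrite ?orbT ?eqxx.
rewrite map_inj_uniq ?iota_uniq // => i j /eqP.
by rewrite eqr_nat => /eqP.
Qed.

Lemma poly_fun_eq0 (p : {poly F}) : (forall s, p.[s] = 0) -> p = 0.
Proof. by move=> p0; apply: (poly_cofin_eq0 (oner_neq0 _)). Qed.

End PolyZero.

Section MatrixPolynomials.
Variables (F : numFieldType) (n : nat).
Local Notation N := (n * n)%N.
Local Notation A := {mpoly F[N]}.
Implicit Types (p q : A) (X Y Z : 'M[F]_n).

(** The restriction of [p] to a polynomial curve of matrices. Differential statements about [p] are
    reduced to one variable through it. *)
Definition pev p (c : 'M[{poly F}]_n) : {poly F} :=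
  mmap (@polyC F) (fun k => mxvec c 0 k) p.

Definition mcomp p (Q : 'M[A]_n) : A := mmap (@mpolyC N F) (fun k => mxvec Q 0 k) p.

Local Notation ev X := (fun q : A => mx_eval q X).

Definition xmx : 'M[A]_n := vec_mx (\row_k 'X_k).
Definition cmx (X : 'M[F]_n) : 'M[A]_n := map_mx (@mpolyC N F) X.

Lemma mmap_hom (S S' : comNzRingType) (f : {rmorphism F -> S})
    (g : {rmorphism S -> S'}) p (c : 'M[S]_n) (f' : F -> S') :
  g \o f =1 f' ->
  g (mmap f (fun k => mxvec c 0 k) p)
  = mmap f' (fun k => mxvec (map_mx g c) 0 k) p.
Proof.
move=> E; rewrite /mmap rmorph_sum; apply: eq_bigr => m _.
rewrite rmorphM -E; congr (_ * _); rewrite /mmap1 rmorph_prod.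
by apply: eq_bigr => i _; rewrite rmorphXn -map_mxvec mxE.
Qed.

Lemma mx_evalD p q X : mx_eval (p + q) X = mx_eval p X + mx_eval q X.
Proof. exact: mevalD. Qed.
Lemma mx_evalB p q X : mx_eval (p - q) X = mx_eval p X - mx_eval q X.
Proof. exact: mevalB. Qed.
Lemma mx_evalN p X : mx_eval (- p) X = - mx_eval p X.
Proof. exact: mevalN. Qed.
Lemma mx_evalM p q X : mx_eval (p * q) X = mx_eval p X * mx_eval q X.
Proof. exact: mevalM. Qed.
Lemma mx_evalC a X : mx_eval a%:MP X = a.
Proof. exact: mevalC. Qed.
Lemma mx_eval1 X : mx_eval 1 X = 1.
Proof. exact: meval1. Qed.
Lemma mx_eval0 X : mx_eval 0 X = 0.
Proof. exact: meval0. Qed.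
Lemma mx_evalX i X : mx_eval 'X_i X = mxvec X 0 i.
Proof. exact: mevalXU. Qed.
Lemma mx_eval_sum (I : Type) (r : seq I) (P : pred I) (E : I -> A) X :
  mx_eval (\sum_(i <- r | P i) E i) X = \sum_(i <- r | P i) mx_eval (E i) X.
Proof. exact: (raddf_sum (meval _)). Qed.

Lemma mx_eval_origin p : mx_eval p 0 = p@_0%MM.
Proof.
elim/mpolyind: p => [|a m p _ _ IH]; first by rewrite mx_eval0 mcoeff0.
rewrite mx_evalD mcoeffD IH; congr (_ + _).
rewrite mcoeffZ mcoeffX /mx_eval mevalZ mevalX; congr (_ * _).
have [->|m0] := eqVneq m 0%MM; first by rewrite big1 // => i _; rewrite mnm0E.
have [i mi] : exists i, m i != 0%N.
  apply: contrapT => no; case/negP: m0; apply/eqP/mnmP => i; rewrite mnm0E.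
  by apply/eqP; apply: contrapT => /negP mi; apply: no; exists i.
by rewrite (bigD1 i) //= linear0 mxE expr0n (negbTE mi) mul0r.
Qed.

Lemma horner_pev p c s : (pev p c).[s] = mx_eval p (map_mx (horner_eval s) c).
Proof.
rewrite /pev -[LHS]/(horner_eval s _) (@mmap_hom _ _ _ _ _ _ idfun) //.
by move=> a; rewrite /= /horner_eval hornerC.
Qed.

Lemma mx_eval_mcomp p Q X :
  mx_eval (mcomp p Q) X = mx_eval p (map_mx (ev X) Q).
Proof.
rewrite /mcomp -[LHS]/(meval _ _) (@mmap_hom _ _ _ _ _ _ idfun) //.
by move=> a; rewrite /= mevalC.
Qed.

Lemma mx_eval_xmx X : map_mx (ev X) xmx = X.
Proof.
apply: (can_inj mxvecK); rewrite -[map_mx _ _]/(map_mx (meval (fun k => mxvec X 0 k)) _).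
rewrite -map_mxvec vec_mxK.
by apply/rowP => k; rewrite !mxE mevalXU.
Qed.

Lemma mx_eval_cmx X Y : map_mx (ev X) (cmx Y) = Y.
Proof. by apply/matrixP => i j; rewrite !mxE mx_evalC. Qed.

Lemma mx_eval_mulmx X m1 m2 m3 (P : 'M[A]_(m1, m2)) (Q : 'M[A]_(m2, m3)) :
  map_mx (ev X) (P *m Q) = map_mx (ev X) P *m map_mx (ev X) Q.
Proof. exact: (map_mxM (meval _)). Qed.

Lemma mx_eval_addmx X m1 m2 (P Q : 'M[A]_(m1, m2)) :
  map_mx (ev X) (P + Q) = map_mx (ev X) P + map_mx (ev X) Q.
Proof. exact: (map_mxD (meval _)). Qed.

Lemma mpoly_ring_ind (P : A -> Prop) :
  (forall a, P a%:MP) -> (forall i, P 'X_i) ->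
  (forall p q, P p -> P q -> P (p + q)) ->
  (forall p q, P p -> P q -> P (p * q)) -> forall p, P p.
Proof.
move=> PC PX PD PM; elim/mpolyind => [|a m p _ _ Pp]; first by rewrite -mpolyC0.
apply: PD => //; rewrite -mul_mpolyC; apply: (PM) => //; rewrite mpolyXE_id.
elim/big_ind: _ => [|x y|i _]; [by rewrite -mpolyC1 | exact: PM |].
by elim: (m i) => [|k IH]; rewrite ?expr0 -?mpolyC1 // exprS; exact: PM.
Qed.

Lemma pevD p q c : pev (p + q) c = pev p c + pev q c.
Proof. exact: mmapD. Qed.
Lemma pevM p q c : pev (p * q) c = pev p c * pev q c.
Proof. exact: (rmorphM (mmap _ _)). Qed.
Lemma pevC a c : pev a%:MP c = a%:P.
Proof. exact: mmapC. Qed.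
Lemma pevX i c : pev 'X_i c = mxvec c 0 i.
Proof. by rewrite /pev mmapX mmap1U. Qed.
Lemma pev_sum (I : Type) (r : seq I) (P : pred I) (E : I -> A) c :
  pev (\sum_(i <- r | P i) E i) c = \sum_(i <- r | P i) pev (E i) c.
Proof. exact: (raddf_sum (mmap _ _)). Qed.

Lemma deriv_pev p c :
  (pev p c)^`() = \sum_k pev (p^`M(k)) c * (mxvec c 0 k)^`().
Proof.
elim/mpoly_ring_ind: p => [a|i|p q IHp IHq|p q IHp IHq].
- by rewrite pevC derivC big1 // => k _; rewrite mderivC -mpolyC0 pevC mul0r.
- rewrite pevX (bigD1 i) //= mderivX mnm1E eqxx scale1r.
  rewrite -{1}(add0m U_(i)%MM) addmK mpolyX0 -mpolyC1 pevC mul1r big1 ?addr0 // => k ne_ki.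
  by rewrite mderivX mnm1E eq_sym (negbTE ne_ki) scale0r -mpolyC0 pevC mul0r.
- rewrite pevD derivD IHp IHq -big_split /=; apply: eq_bigr => k _.
  by rewrite mderivD pevD mulrDl.
- rewrite pevM derivM IHp IHq big_distrl big_distrr -big_split /=.
  apply: eq_bigr => k _.
  by rewrite mderivM pevD !pevM mulrDl mulrAC [pev p c * _]mulrA.
Qed.

(** Partial derivatives of the zero function vanish, and in characteristic 0 a coefficient is
    recovered from one of a partial derivative of lower degree. *)
Lemma mpoly_fun_eq0 p : (forall X, mx_eval p X = 0) -> p = 0.
Proof.
suff H (d : nat) : forall p m, mdeg m = d -> (forall X, mx_eval p X = 0) -> p@_m = 0.
  by move=> p0; apply/mpolyP => m; rewrite mcoeff0 (H (mdeg m)).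
elim: d => [|d IH] {}p m dm p0.
  by move/eqP: dm; rewrite mdeg_eq0 => /eqP->; rewrite -mx_eval_origin.
have [i mi] : exists i, m i != 0%N.
  apply: contrapT => no; move/eqP: dm; rewrite mdegE big1 // => i _.
  by apply/eqP; apply: contrapT => /negP mi; apply: no; exists i.
have Em : m = (m - U_(i) + U_(i))%MM by rewrite submK // lep1mP.
have dm' : mdeg (m - U_(i))%MM = d.
  by move: dm; rewrite {1}Em mdegD mdeg1 addn1 => -[].
have dp0 X : mx_eval p^`M(i) X = 0.
  pose c : 'M[{poly F}]_n := map_mx polyC X + 'X *: map_mx polyC (vec_mx (delta_mx 0 i)).
  have c0 : pev p c = 0 by apply: poly_fun_eq0 => s; rewrite horner_pev.
  have := congr1 (fun f : {poly F} => f^`().[0]) c0.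
  rewrite deriv0 horner0 deriv_pev horner_sum (bigD1 i) //= big1 ?addr0.
    rewrite hornerM horner_pev => E; rewrite -[RHS]E {E}.
    have -> : map_mx (horner_eval 0) c = X.
      by apply/matrixP => k l; rewrite !mxE /horner_eval hornerD hornerM hornerX mul0r addr0 hornerC.
    rewrite linearD linearZ /= -!map_mxvec vec_mxK !mxE !eqxx /= derivD derivC add0r.
    by rewrite derivM derivX derivC mulr0 addr0 mul1r hornerC mulr1.
  move=> k ne_ki; rewrite hornerM linearD linearZ /= -!map_mxvec vec_mxK !mxE.
  by rewrite (negbTE ne_ki) andbF derivD derivC add0r mulr0 deriv0 horner0 mulr0.
have := IH p^`M(i) _ dm' dp0; rewrite mcoeff_deriv -Em => /eqP.
by rewrite mulrn_eq0 /= => /eqP.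
Qed.

End MatrixPolynomials.

(** * Tangent spaces *)

Section Tangent.
Variables (F : numFieldType) (n : nat).
Local Notation N := (n * n)%N.
Local Notation A := {mpoly F[N]}.
Implicit Types (p q : A) (X Y Z : 'M[F]_n) (K : set 'M[F]_n).

(** The differential of [p] at [X] in direction [Y]; at [X = 1%:M] it is convertible with the sum in
    the definition of [lie]. *)
Definition diffat p X Y : F := \sum_k mx_eval p^`M(k) X * mxvec Y 0 k.

Lemma diffatD p X Y Z : diffat p X (Y + Z) = diffat p X Y + diffat p X Z.
Proof.
by rewrite -big_split; apply: eq_bigr => k _; rewrite linearD mxE mulrDr.
Qed.

Lemma diffatZ p X a Y : diffat p X (a *: Y) = a * diffat p X Y.
Proof.
by rewrite big_distrr; apply: eq_bigr => k _; rewrite linearZ mxE mulrCA.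
Qed.

Lemma diffatB p X Y Z : diffat p X (Y - Z) = diffat p X Y - diffat p X Z.
Proof. by rewrite diffatD -scaleN1r diffatZ mulN1r. Qed.

Definition vanishes (S : 'M[F]_n -> Prop) p := forall X, S X -> mx_eval p X = 0.

Lemma lieP K X : lie K X <-> forall p, vanishes K p -> diffat p 1%:M X = 0.
Proof. by []. Qed.

Definition line X Y : 'M[{poly F}]_n := map_mx polyC X + 'X *: map_mx polyC Y.

Lemma horner_line X Y s : map_mx (horner_eval s) (line X Y) = X + s *: Y.
Proof.
apply/matrixP => i j.
by rewrite !mxE /horner_eval hornerD hornerM hornerX !hornerC.
Qed.

Lemma horner_deriv_pev p (c : 'M[{poly F}]_n) X Y s :
  map_mx (horner_eval s) c = X ->
  map_mx (horner_eval s) (map_mx (@deriv F) c) = Y ->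
  (pev p c)^`().[s] = diffat p X Y.
Proof.
move=> cX cY; rewrite deriv_pev horner_sum; apply: eq_bigr => k _.
rewrite hornerM horner_pev cX -cY -!map_mxvec; congr (_ * _).
by rewrite mxE mxE.
Qed.

Lemma deriv_line X Y : map_mx (@deriv F) (line X Y) = map_mx polyC Y.
Proof.
by apply/matrixP => i j; rewrite !mxE derivD derivM derivX !derivC mulr0 addr0 mul1r add0r.
Qed.

Lemma diffat_line p X Y : (pev p (line X Y))^`().[0] = diffat p X Y.
Proof.
apply: horner_deriv_pev; first by rewrite horner_line scale0r addr0.
by rewrite deriv_line; apply/matrixP => i j; rewrite !mxE /horner_eval hornerC.
Qed.

Lemma eq_pev p q (c d : 'M[{poly F}]_n) :
  (forall s, mx_eval p (map_mx (horner_eval s) c) = mx_eval q (map_mx (horner_eval s) d)) ->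
  pev p c = pev q d.
Proof.
move=> E; apply/eqP; rewrite -subr_eq0; apply/eqP/poly_fun_eq0 => s.
by rewrite hornerD hornerN !horner_pev E subrr.
Qed.

(* [sandwich L R C p] is the polynomial [X |-> p (L X R + C)]. *)
Definition sandwich (L R C : 'M[F]_n) p : A :=
  mcomp p (cmx L *m xmx F n *m cmx R + cmx C).

Lemma mx_eval_sandwich L R C p X :
  mx_eval (sandwich L R C p) X = mx_eval p (L *m X *m R + C).
Proof.
by rewrite mx_eval_mcomp mx_eval_addmx !mx_eval_mulmx !mx_eval_cmx mx_eval_xmx.
Qed.

Lemma diffat_sandwich L R C p X Y :
  diffat (sandwich L R C p) X Y = diffat p (L *m X *m R + C) (L *m Y *m R).
Proof.
rewrite -!diffat_line; congr (_^`().[0]); apply: eq_pev => s.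
rewrite mx_eval_sandwich !horner_line mulmxDr mulmxDl -scalemxAr -scalemxAl.
by rewrite addrAC.
Qed.

(* The derivation of the coordinate ring along the vector field
   [X |-> L (X + C) + (X + C) R]. *)
Definition flow (L R C : 'M[F]_n) p : A :=
  \sum_k p^`M(k) * mxvec (cmx L *m (xmx F n + cmx C) + (xmx F n + cmx C) *m cmx R) 0 k.

Lemma mx_eval_mxvec (Q : 'M[A]_n) k X :
  mx_eval (mxvec Q 0 k) X = mxvec (map_mx (fun q => mx_eval q X) Q) 0 k.
Proof. by rewrite -[map_mx _ Q]/(map_mx (meval _) Q) -map_mxvec mxE. Qed.

Lemma mx_eval_flow L R C p X :
  mx_eval (flow L R C p) X = diffat p X (L *m (X + C) + (X + C) *m R).
Proof.
rewrite mx_eval_sum; apply: eq_bigr => k _; rewrite mx_evalM; congr (_ * _).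
rewrite mx_eval_mxvec mx_eval_addmx !mx_eval_mulmx mx_eval_addmx.
by rewrite !mx_eval_cmx mx_eval_xmx.
Qed.

(** For fixed a and b, the functions c -> p(c a b) on K1 and c -> p(a b c) on K2 vanish, and Y1, Y2
    are tangent at 1. The two derivatives add up to the flow at a b. *)
Lemma flow_vanishes K1 K2 Y1 Y2 p : is_group K1 -> is_group K2 ->
  lie K1 Y1 -> lie K2 Y2 ->
  (forall a b, K1 a -> K2 b -> mx_eval p (a *m b) = 0) ->
  forall a b, K1 a -> K2 b -> mx_eval (flow Y1 Y2 0 p) (a *m b) = 0.
Proof.
move=> [_ _ K1M _] [_ _ K2M _] lY1 lY2 p0 a b K1a K2b.
rewrite mx_eval_flow addr0 diffatD.
have := lY1 (sandwich 1%:M (a *m b) 0 p).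
rewrite -/(diffat _ _ _) diffat_sandwich !mul1mx addr0 => ->; last first.
  by move=> c K1c; rewrite mx_eval_sandwich mul1mx addr0 mulmxA; apply: p0 => //; apply: K1M.
have := lY2 (sandwich (a *m b) 1%:M 0 p).
rewrite -/(diffat _ _ _) diffat_sandwich !mulmx1 addr0 => ->; first by rewrite addr0.
by move=> c K2c; rewrite mx_eval_sandwich mulmx1 addr0 -mulmxA; apply: p0 => //; apply: K2M.
Qed.

Lemma mxvec_ray Y i : mxvec (line 0 Y) 0 i = 'X * (mxvec Y 0 i)%:P.
Proof.
by rewrite /line linearD linearZ /= -!map_mxvec !mxE linear0 mxE polyC0 add0r.
Qed.

Definition homcomp k p : A := \sum_(m <- msupp p | mdeg m == k) p@_m *: 'X_[m].

Lemma coef_pev_ray p Y k : (pev p (line 0 Y))`_k = mx_eval (homcomp k p) Y.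
Proof.
rewrite {1}(mpolyE p) pev_sum coef_sum mx_eval_sum [RHS]big_mkcond.
apply: eq_bigr => m _; rewrite -mul_mpolyC pevM pevC coefCM.
have -> : pev 'X_[m] (line 0 Y) = 'X^(mdeg m) * (\prod_i mxvec Y 0 i ^+ m i)%:P.
  rewrite /pev mmapX /mmap1 mdegE -prodrXr rmorph_prod -big_split /=.
  apply: eq_bigr => i _; rewrite rmorphXn -exprMn; congr (_ ^+ _).
  exact: mxvec_ray.
rewrite coefMC coefXn eq_sym; case: eqP => _; last by rewrite mul0r mulr0.
by rewrite mul1r mx_evalM mx_evalC /mx_eval mevalX.
Qed.

Lemma homcomp_ordge k l p : ordge l p -> (k < l)%N -> homcomp k p = 0.
Proof.
move=> lp lt_kl; rewrite /homcomp big1_seq // => m /andP[/eqP dm _].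
by rewrite lp ?dm // scale0r.
Qed.

Lemma ordge_homcomp k p : ordge k p -> ordge k.+1 (p - homcomp k p).
Proof.
move=> kp m; rewrite ltnS mcoeffB leq_eqVlt => /orP[/eqP dm|lt_m]; last first.
  rewrite kp // sub0r /homcomp raddf_sum big1 ?oppr0 //= => m' /eqP dm'.
  rewrite mcoeffZ mcoeffX; case: eqP => [E|]; last by rewrite mulr0.
  by move: lt_m; rewrite -E dm' ltnn.
rewrite /homcomp raddf_sum /=.
have [pm|pm] := boolP (m \in msupp p).
  rewrite (big_rem m) //= dm eqxx mcoeffZ mcoeffX eqxx mulr1 big_seq_cond big1 ?addr0 ?subrr //.
  move=> m'; rewrite (mem_rem_uniq _ (msupp_uniq p)) inE => /andP[/andP[ne _] _].
  by rewrite mcoeffZ mcoeffX (negbTE ne) mulr0.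
rewrite (memN_msupp_eq0 pm) sub0r big_seq_cond big1 ?oppr0 // => m' /andP[pm' _].
rewrite mcoeffZ mcoeffX; case: eqP => [E|]; last by rewrite mulr0.
by rewrite -E pm' in pm.
Qed.

Lemma ordge_mderiv k p i : ordge k.+1 p -> ordge k (p^`M(i)).
Proof.
move=> kp m lt_m; rewrite mcoeff_deriv kp ?mul0rn //.
by rewrite mdegD mdeg1 addn1 ltnS.
Qed.

(* If [p] has order [k+1] at the origin, the k-th derivative of [p] along a
   flow with velocity [Y] at the origin is (k+1)! times the leading form at [Y]. *)
Lemma homcomp_flow Y1 Y2 p k : ordge k.+1 p ->
  mx_eval (homcomp k (flow Y1 Y2 1%:M p)) (Y1 + Y2)
  = mx_eval (homcomp k.+1 p) (Y1 + Y2) *+ k.+1.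
Proof.
move=> kp; set Y := Y1 + Y2; rewrite -!coef_pev_ray -coef_deriv.
rewrite deriv_pev /flow pev_sum !coef_sum; apply: eq_bigr => i _.
rewrite pevM.
(* Along the ray each partial derivative of [p] starts in degree k. In the coefficient of degree k
   only the constant term of the vector field survives, and that term is Y1 + Y2. *)
have [r Er] : exists r : {poly F}, pev (p^`M(i)) (line 0 Y) = 'X^k * r.
  set u := pev _ _; exists (\poly_(j < size u) u`_(j + k)).
  apply/polyP => j; rewrite coefXnM coef_poly; case: ltnP => [lt_jk|le_kj].
    rewrite /u coef_pev_ray (homcomp_ordge (l := k)) ?mx_eval0 //.
    exact: ordge_mderiv.
  rewrite subnK //; case: ltnP => // le_u; apply: nth_default.
  exact: leq_trans le_u (leq_subr _ _).
rewrite Er -!mulrA !coefXnM ltnn subnn !coef0M; congr (_ * _).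
set Q := _ + _ *m cmx Y2.
rewrite -!horner_coef0 horner_pev horner_line scale0r addr0 mx_eval_mxvec.
rewrite /Q mx_eval_addmx !mx_eval_mulmx mx_eval_addmx !mx_eval_cmx mx_eval_xmx.
rewrite add0r mulmx1 mul1mx mxvec_ray.
by rewrite derivM derivX derivC mulr0 addr0 mul1r hornerC.
Qed.


Lemma vanishes_ideal (S : 'M[F]_n -> Prop) : is_ideal (vanishes S).
Proof.
split=> [X _|p q p0 q0 X SX|p q q0 X SX]; first exact: mx_eval0.
  by rewrite mx_evalD p0 // q0 // addr0.
by rewrite mx_evalM q0 // mulr0.
Qed.

Lemma ideal_add_ordge (I : A -> Prop) k : is_ideal I ->
  is_ideal (fun f => exists p e, [/\ I p, ordge k e & f = p + e]).
Proof.
case=> I0 ID IM; have [o0 oD oM] := @ordge_ideal F N k.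
split=> [|_ _ [p [e [Ip ke ->]]] [p' [e' [Ip' ke' ->]]]|a _ [p [e [Ip ke ->]]]].
- by exists 0, 0; rewrite addr0.
- by exists (p + p'), (e + e'); rewrite addrACA; split; [apply: ID | apply: oD |].
- by exists (a * p), (a * e); rewrite mulrDr; split; [apply: IM | apply: oM |].
Qed.

Lemma mcomp_sum (I : Type) (r : seq I) (P : pred I) (E : I -> A) (Q : 'M[A]_n) :
  mcomp (\sum_(i <- r | P i) E i) Q = \sum_(i <- r | P i) mcomp (E i) Q.
Proof. exact: (raddf_sum (mmap _ _)). Qed.

Lemma mderiv_origin p k : mx_eval p^`M(k) 0 = p@_U_(k).
Proof. by rewrite mx_eval_origin mcoeff_deriv add0m mnm0E. Qed.

(* A form vanishing on the tangent space at the origin is, to first order,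
   in the ideal: [X - pi X] has linearizations of elements of the ideal as
   coordinates when [pi] is a projection onto the tangent space. *)
Lemma homcomp_tangent (S : 'M[F]_n -> Prop) q k : S 0 -> ordge k q ->
  (forall Y, (forall p, vanishes S p -> diffat p 0 Y = 0) ->
     mx_eval (homcomp k q) Y = 0) ->
  exists p e, [/\ vanishes S p, ordge k.+1 e & q = p + e].
Proof.
move=> S0 kq qT; have idS := vanishes_ideal S; case: (idS) => I0 ID IM.
pose grad p : 'rV[F]_N := \row_k mx_eval p^`M(k) 0.
have diffE p Y : diffat p 0 Y = (grad p *m (mxvec Y)^T) 0 0.
  by rewrite mxE; apply: eq_bigr => i _; rewrite !mxE.
have [M MP] : exists M : 'M[F]_N, forall v, (v <= M)%MS <->
    exists2 p, vanishes S p & v = grad p.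
  apply: subspace_mx => [|a _ _ [p Ip ->] [p' Ip' ->]].
    by exists 0 => //; apply/rowP => i; rewrite !mxE mderiv0 mx_eval0.
  exists (a%:MP * p + p'); first by apply: ID => //; apply: IM.
  apply/rowP => i; rewrite !mxE !mderiv_origin mcoeffD.
  by rewrite mcoeffCM.
(* [M *m U = M], so [1%:M - U] projects onto the kernel of [M], which is the tangent space; and each
   row of [U] is itself the gradient of an element of the ideal. *)
pose U := pinvmx M *m M.
have /choice[pp ppP] i : exists p, vanishes S p /\ row i U = grad p.
  by have /MP[p Ip E] : (row i U <= M)%MS; [rewrite row_mul submxMl | exists p].
pose Pi : 'M[A]_n := vec_mx (\row_i ('X_i - \sum_j U i j *: 'X_j)).
have PiE i : mxvec Pi 0 i = 'X_i - \sum_j U i j *: 'X_j by rewrite vec_mxK mxE.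
have sumE i m : (\sum_j U i j *: 'X_j : A)@_m = \sum_j U i j * (U_(j)%MM == m)%:R.
  by rewrite raddf_sum; apply: eq_bigr => j _ /=; rewrite mcoeffZ mcoeffX.
have sum0 i : (\sum_j U i j *: 'X_j : A)@_0%MM = 0.
  by rewrite sumE big1 // => j _; rewrite mnm1_eq0 mulr0.
have uP i : exists p e, [/\ vanishes S p, ordge 2 e & 'X_i - mxvec Pi 0 i = p + e].
  have [Ip gp] := ppP i.
  exists (pp i), ('X_i - mxvec Pi 0 i - pp i); split=> //; last by rewrite addrCA subrr addr0.
  rewrite PiE opprB addrCA subrr addr0 => m; rewrite ltnS leq_eqVlt ltnS leqn0 mcoeffB.
  case/orP=> [/mdeg1P[l /eqP->]|]; last first.
    by rewrite mdeg_eq0 => /eqP->; rewrite sum0 -mx_eval_origin Ip // subrr.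
  rewrite -(mderiv_origin (pp i)).
  have := congr1 (fun v : 'rV_N => v 0 l) gp; rewrite mxE [in RHS]mxE => <-.
  rewrite sumE (bigD1 l) //= eqxx mulr1 big1 ?addr0 ?subrr // => j ne_jl.
  by rewrite eq_mnm1 (negbTE ne_jl) mulr0.
have oPi i : ordge 1 (mxvec Pi 0 i).
  move=> m; rewrite ltnS leqn0 mdeg_eq0 => /eqP->.
  by rewrite PiE mcoeffB sum0 mcoeffX mnm1_eq0 subr0.
(* Replacing the variables of a monomial of degree d one at a time by those of [Pi] costs an element
   of the ideal plus terms of degree above d. *)
have CC d : forall m, mdeg m = d -> ordge d (mcomp 'X_[m] Pi) /\
    exists p e, [/\ vanishes S p, ordge d.+1 e & 'X_[m] - mcomp 'X_[m] Pi = p + e].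
  elim: d => [|d IH] m dm.
    move/eqP: dm; rewrite mdeg_eq0 => /eqP->.
    split=> //; exists 0, 0; split=> //; first by case: (@ordge_ideal F N 1).
    by rewrite mpolyX0 -mpolyC1 /mcomp mmapC subrr addr0.
  have [i mi] : exists i, m i != 0%N.
    apply: contrapT => no; move/eqP: dm; rewrite mdegE big1 // => i _.
    by apply/eqP; apply: contrapT => /negP mi; apply: no; exists i.
  have Em : m = (m - U_(i) + U_(i))%MM by rewrite submK // lep1mP.
  have dm' : mdeg (m - U_(i))%MM = d.
    by move: dm; rewrite {1}Em mdegD mdeg1 addn1 => -[].
  have [om' [p [e [Ip oe E]]]] := IH _ dm'.
  have [u [e' [Iu oe' E']]] := uP i.
  have XE : mcomp 'X_[m] Pi = mcomp 'X_[m - U_(i)] Pi * mxvec Pi 0 i.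
    rewrite {1}Em mpolyXD /mcomp rmorphM; congr (_ * _).
    by rewrite [LHS]mmapX mmap1U.
  split; first by rewrite XE -addn1; apply: ordgeM.
  exists ('X_[m - U_(i)] * u + p * mxvec Pi 0 i), ('X_[m - U_(i)] * e' + e * mxvec Pi 0 i).
  split.
  - by apply: ID; [apply: IM | rewrite mulrC; apply: IM].
  - apply: ordgeD; last by rewrite -addn1; apply: ordgeM.
    by rewrite -addn2 -dm'; apply: ordgeM => //; apply: ordgeX.
  rewrite addrACA -mulrDr -mulrDl -E -E' XE {1}Em mpolyXD.
  by rewrite mulrBr mulrBl addrA subrK.
pose L := homcomp k q.
have pL0 : mcomp L Pi = 0.
  apply: mpoly_fun_eq0 => X; rewrite mx_eval_mcomp; apply: qT => p Ip.
  rewrite diffE.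
  have -> : (mxvec (map_mx (fun q => mx_eval q X) Pi))^T = (1%:M - U) *m (mxvec X)^T.
    apply/colP => i; rewrite mxE -mx_eval_mxvec PiE mx_evalB mx_evalX mx_eval_sum.
    rewrite mulmxBl mul1mx mxE [in RHS]mxE [in RHS]mxE; congr (_ - _).
    rewrite [RHS]mxE; apply: eq_bigr => j _.
    by rewrite /mx_eval mevalZ mevalXU [X in _ = _ * X]mxE.
  have /MP/submxP[a ->] : exists2 p', vanishes S p' & grad p = grad p' by exists p.
  have MU0 : M *m (1%:M - U) = 0.
    by rewrite mulmxBr mulmx1 /U mulmxA mulmxKpV ?submx_refl // subrr.
  by rewrite -mulmxA [M *m _]mulmxA MU0 mul0mx mulmx0 mxE.
have := ideal_add_ordge k.+1 idS; set W := fun f => _ => idW; case: (idW) => W0 WD WM.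
suff: W q by [].
rewrite -(subrK L q); apply: (WD).
  by exists 0, (q - L); rewrite add0r; split=> //; apply: ordge_homcomp.
rewrite -[L]subr0 -pL0 /L /homcomp mcomp_sum -sumrB; apply: ideal_sum => // m /eqP dm.
rewrite /mcomp mmapZ -mul_mpolyC -mulrBr; apply: WM.
by have [_] := CC k m dm.
Qed.

End Tangent.

(** * Density near 1 of a product of two groups *)

Section Dominance.
Variables (F : numFieldType) (n : nat).
Local Notation N := (n * n)%N.
Local Notation A := {mpoly F[N]}.
Implicit Types (p q f h : A) (X Y Z : 'M[F]_n) (G K : set 'M[F]_n).

Lemma ordge_flow L R C p k : ordge k.+1 p -> ordge k (flow L R C p).
Proof.
move=> kp; apply: ideal_sum; first exact: ordge_ideal.
move=> i _; rewrite mulrC; have [_ _ M] := @ordge_ideal F N k.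
exact/M/ordge_mderiv.
Qed.

(* If [p] vanishes on K1 K2, so do its derivatives along the vector fields
   X |-> Y1 X + X Y2 with Yi in lie Ki, hence its leading form at 1 vanishes on
   lie G and [p] agrees with an element of the ideal of G to the next order.
   Krull's intersection theorem concludes. *)
Theorem product_closure_near1 G K1 K2 : is_group K1 -> is_group K2 ->
  (forall a b, K1 a -> K2 b -> G (a *m b)) ->
  (forall Y, lie G Y -> exists Y1 Y2, [/\ lie K1 Y1, lie K2 Y2 & Y = Y1 + Y2]) ->
  exists h, mx_eval h 1%:M = 1 /\
    forall f, (forall a b, K1 a -> K2 b -> mx_eval f (a *m b) = 0) ->
    forall X, G X -> mx_eval h X * mx_eval f X = 0.
Proof.
move=> gK1 gK2 sG spG; have [_ K1_1 _ _] := gK1; have [_ K2_1 _ _] := gK2.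
(* [S] is [G] translated so that 1 becomes the origin, where orders and leading forms are taken. *)
pose S X := G (X + 1%:M); have idS := vanishes_ideal S.
have S0 : S 0 by rewrite /S add0r -[1%:M]mulmx1; apply: sG.
have TS Y : (forall p, vanishes S p -> diffat p 0 Y = 0) -> lie G Y.
  move=> TY p pG; have := TY (sandwich 1%:M 1%:M 1%:M p).
  rewrite diffat_sandwich !mul1mx !mulmx1 add0r; apply => X SX.
  by rewrite mx_eval_sandwich mul1mx mulmx1; apply: pG.
have lead0 Y1 Y2 : lie K1 Y1 -> lie K2 Y2 -> forall k q,
    (forall a b, K1 a -> K2 b -> mx_eval q (a *m b - 1%:M) = 0) ->
    ordge k q -> mx_eval (homcomp k q) (Y1 + Y2) = 0.
  move=> lY1 lY2; elim=> [|k IH] q q0 kq.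
    rewrite -coef_pev_ray -horner_coef0 horner_pev horner_line scale0r addr0.
    by rewrite -[X in mx_eval q X](subrr (1%:M *m 1%:M)) {2}mulmx1; apply: q0.
  have E : mx_eval (homcomp k.+1 q) (Y1 + Y2) *+ k.+1 = 0.
    rewrite -homcomp_flow //; apply: IH => [a b K1a K2b|]; last exact: ordge_flow.
    pose q1 := sandwich 1%:M 1%:M (- 1%:M) q.
    have q10 a' b' : K1 a' -> K2 b' -> mx_eval q1 (a' *m b') = 0.
      by move=> K1a' K2b'; rewrite mx_eval_sandwich mul1mx mulmx1; apply: q0.
    have H := flow_vanishes gK1 gK2 lY1 lY2 q10 K1a K2b.
    rewrite mx_eval_flow diffat_sandwich !mul1mx !mulmx1 addr0 in H.
    by rewrite mx_eval_flow subrK; exact: H.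
  by move/eqP: E; rewrite mulrn_eq0 /= => /eqP.
have [d [d0 dP]] := krull_intersection idS.
exists (sandwich 1%:M 1%:M (- 1%:M) d); split.
  by rewrite mx_eval_sandwich !mul1mx subrr mx_eval_origin.
move=> f f0 X GX.
pose f1 := sandwich 1%:M 1%:M 1%:M f.
have f1_0 a b : K1 a -> K2 b -> mx_eval f1 (a *m b - 1%:M) = 0.
  by move=> K1a K2b; rewrite mx_eval_sandwich mul1mx mulmx1 subrK f0.
have /dP/(_ (X - 1%:M)) : forall k, exists p q, [/\ vanishes S p, ordge k q & f1 = p + q].
  elim=> [|k [p [q [Ip kq Ef]]]].
    by exists 0, f1; rewrite add0r; split=> //; case: idS.
  have [p' [q' [Ip' kq' Eq]]] : exists p e, [/\ vanishes S p, ordge k.+1 e & q = p + e].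
    apply: homcomp_tangent => // Y /TS/spG[Y1 [Y2 [lY1 lY2 ->]]].
    apply: lead0 => // a b K1a K2b.
    have /eqP := f1_0 a b K1a K2b; rewrite Ef mx_evalD Ip ?add0r; first by move/eqP.
    by rewrite /S subrK; apply: sG.
  exists (p + p'), q'; split=> //; last by rewrite Ef Eq addrA.
  by case: idS => _ + _; apply.
rewrite /S subrK => /(_ GX); rewrite mx_evalM /f1 !mx_eval_sandwich.
by rewrite !mul1mx !mulmx1 subrK.
Qed.

End Dominance.

(** * Lie algebras of linear groups; connected groups are determined by them *)

Section Lie.
Variables (F : numFieldType) (n : nat).
Local Notation N := (n * n)%N.
Local Notation A := {mpoly F[N]}.
Implicit Types (p q f h : A) (X Y Z : 'M[F]_n) (G K : set 'M[F]_n).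

Lemma zclosed_vanish K X : zclosed K -> X \in unitmx ->
  (forall p, vanishes K p -> mx_eval p X = 0) -> K X.
Proof.
by case=> S -> uX X0; split=> // p Sp; apply: X0 => Y [_]; apply.
Qed.

Lemma lie_subset K K' X : K `<=` K' -> lie K X -> lie K' X.
Proof. by move=> sK lX p p0; apply: lX => Y /sK; apply: p0. Qed.

Lemma lie0 K : lie K 0.
Proof. by move=> p _; rewrite big1 // => k _; rewrite linear0 mxE mulr0. Qed.

Lemma lieD K X Y : lie K X -> lie K Y -> lie K (X + Y).
Proof.
move=> lX lY p p0; have := lX p p0; have := lY p p0.
by rewrite -!/(diffat _ _ _) diffatD => -> ->; rewrite addr0.
Qed.

Lemma lieZ K a X : lie K X -> lie K (a *: X).
Proof. by move=> lX p /lX; rewrite -!/(diffat _ _ _) diffatZ => ->; rewrite mulr0. Qed.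

Lemma diffatM p q X Y :
  diffat (p * q) X Y = diffat p X Y * mx_eval q X + mx_eval p X * diffat q X Y.
Proof.
rewrite big_distrl big_distrr -big_split; apply: eq_bigr => k _ /=.
by rewrite mderivM mx_evalD !mx_evalM mulrDl mulrAC mulrA.
Qed.

Lemma diffat_sum (I : Type) (r : seq I) (P : pred I) (E : I -> A) X Y :
  diffat (\sum_(i <- r | P i) E i) X Y = \sum_(i <- r | P i) diffat (E i) X Y.
Proof.
rewrite exchange_big; apply: eq_bigr => k _.
by rewrite raddf_sum mx_eval_sum big_distrl.
Qed.

Lemma flow_vanishes1 K Y p : is_group K -> lie K Y -> vanishes K p ->
  vanishes K (flow 0 Y 0 p).
Proof.
move=> gK lY p0 X KX; have [_ K1 KM _] := gK.
rewrite -[X]mulmx1; apply: (flow_vanishes gK gK (@lie0 K) lY _ KX K1) => a b Ka Kb.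
exact/p0/KM.
Qed.

Lemma diffat_flow p Z W : diffat (flow 0 W 0 p) 1%:M Z
  = \sum_k \sum_l mx_eval p^`M(k)^`M(l) 1%:M * mxvec Z 0 l * mxvec W 0 k
    + diffat p 1%:M (Z *m W).
Proof.
rewrite diffat_sum -big_split; apply: eq_bigr => k _ /=.
rewrite diffatM; congr (_ + _).
  rewrite big_distrl; apply: eq_bigr => l _ /=; congr (_ * _).
  rewrite mx_eval_mxvec mx_eval_addmx !mx_eval_mulmx mx_eval_addmx !mx_eval_cmx.
  by rewrite mx_eval_xmx mul0mx add0r addr0 mul1mx.
congr (_ * _); rewrite -diffat_line.
rewrite (_ : pev _ _ = mxvec (line W (Z *m W)) 0 k).
  rewrite /line linearD linearZ /= -!map_mxvec !mxE derivD derivC add0r.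
  by rewrite derivM derivX derivC mulr0 addr0 mul1r hornerC.
apply/eqP; rewrite -subr_eq0; apply/eqP/poly_fun_eq0 => s.
rewrite hornerD hornerN horner_pev horner_line.
rewrite mx_eval_mxvec mx_eval_addmx !mx_eval_mulmx mx_eval_addmx !mx_eval_cmx.
rewrite mx_eval_xmx mul0mx add0r addr0 mulmxDl mul1mx -scalemxAl.
rewrite -[(mxvec _ 0 k).[s]]/(horner_eval s _).
have -> : horner_eval s (mxvec (line W (Z *m W)) 0 k)
    = mxvec (map_mx (horner_eval s) (line W (Z *m W))) 0 k by rewrite -map_mxvec mxE.
by rewrite horner_line subrr.
Qed.

(** Composing two left-invariant derivations gives the derivative along the matrix product plus a
    second-order term symmetric in the two directions, which cancels in the commutator. *)
Lemma diffat_bracket p X Y : diffat p 1%:M (bracket X Y)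
  = diffat (flow 0 Y 0 p) 1%:M X - diffat (flow 0 X 0 p) 1%:M Y.
Proof.
rewrite [X in _ = X - _]diffat_flow [X in _ = _ - X]diffat_flow [LHS]diffatB.
rewrite opprD addrACA.
set S1 := (\sum_k _ as X in X - _ + _); set S2 := (X in _ - X + _).
suff -> : S1 = S2 by rewrite subrr add0r.
rewrite /S1 exchange_big; apply: eq_bigr => k _; apply: eq_bigr => l _ /=.
by rewrite mderiv_comm mulrAC.
Qed.

Lemma lie_bracket K X Y : is_group K -> lie K X -> lie K Y -> lie K (bracket X Y).
Proof.
move=> gK lX lY p p0; rewrite -/(diffat _ _ _) diffat_bracket.
rewrite -[RHS](subrr 0); congr (_ - _).
  exact: (lX _ (flow_vanishes1 gK lY p0)).
exact: (lY _ (flow_vanishes1 gK lX p0)).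
Qed.

Definition conj_set (x : 'M[F]_n) K : set 'M[F]_n :=
  [set A | K (invmx x *m A *m x)].

Lemma conj_set_group x K : x \in unitmx -> is_group K -> is_group (conj_set x K).
Proof.
move=> ux [sK K1 KM KV]; have CK (B : 'M[F]_n) : x *m (invmx x *m B) = B by rewrite mulKVmx.
split=> [B /sK|||] //=.
- by rewrite /= !unitmx_mul unitmx_inv ux /= andbT.
- by rewrite /conj_set /= mulmx1 mulVmx.
- by move=> B C /KM h /h; rewrite /conj_set /= !mulmxA mulmxK.
- move=> B KB; rewrite /conj_set /=.
  have uB : B \in unitmx by move/sK: KB; rewrite /= !unitmx_mul unitmx_inv ux /= andbT.
  have uC : invmx x *m B *m x \in unitmx := sK _ KB.
  have CD : (invmx x *m B *m x) *m (invmx x *m invmx B *m x) = 1%:M.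
    by rewrite !mulmxA mulmxK // mulmxK // mulVmx.
  suff -> : invmx x *m invmx B *m x = invmx (invmx x *m B *m x) by exact: KV.
  by rewrite -[LHS](mulKmx uC) CD mulmx1.
Qed.

Lemma conj_set_closed x K : x \in unitmx -> zclosed K -> zclosed (conj_set x K).
Proof.
move=> ux [S ->]; exists [set sandwich (invmx x) x 0 p | p in S].
apply/seteqP; split=> B /=; rewrite /conj_set /= !unitmx_mul unitmx_inv ux /= andbT.
  by move=> [uB B0]; split=> // _ [p Sp <-]; rewrite mx_eval_sandwich addr0; apply: B0.
move=> [uB B0]; split=> // p Sp.
by have := B0 _ (imageP _ Sp); rewrite mx_eval_sandwich addr0.
Qed.

Lemma lie_conj x K Y : x \in unitmx -> lie K Y -> lie (conj_set x K) (x *m Y *m invmx x).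
Proof.
move=> ux lY p p0; have := lY (sandwich x (invmx x) 0 p).
rewrite -!/(diffat _ _ _) diffat_sandwich mulmx1 mulmxV // addr0; apply => B KB.
rewrite mx_eval_sandwich addr0; apply: p0.
by rewrite /conj_set /= !mulmxA mulVmx // mul1mx mulmxKV.
Qed.

(* K contains a neighbourhood of 1 in K', hence it is open as well as closed. *)
Theorem connected_lie_eq K K' : algebraic_group K -> connected_algebraic_group K' ->
  K `<=` K' -> (forall X, lie K' X -> lie K X) -> K' `<=` K.
Proof.
move=> [gK cK] [[gK' cK'] conK'] sK lK'.
have [uK K1 KM KV] := gK; have [uK' K'1 K'M K'V] := gK'.
have [h [h1 hP]] := product_closure_near1 (G := K') gK gK
  (fun a b Ka Kb => K'M _ _ (sK a Ka) (sK b Kb))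
  (fun Y lY => ex_intro _ Y (ex_intro _ 0 (And3 (lK' Y lY) (@lie0 K) (esym (addr0 Y))))).
(* The common zeros of the translates of [h] by [K]. Where some translate is nonzero, a point of
   [K'] satisfies all equations of [K] after translation, so it lies in [K]; and [Z2] misses [K]
   because h(1) = 1. *)
pose Z2 : set 'M[F]_n := [set B | B \in unitmx /\
  forall p, [set sandwich (invmx k) 1%:M 0 h | k in K] p -> mx_eval p B = 0].
have cZ2 : zclosed Z2 by exists [set sandwich (invmx k) 1%:M 0 h | k in K].
case: (conK' K Z2 cK cZ2) => //.
- move=> B K'B; have [KB|nKB] := pselect (K B); [by left|right].
  split=> [|_ [k Kk <-]]; first exact: uK'.
  rewrite mx_eval_sandwich mulmx1 addr0; apply: contrapT => /eqP hB.
  apply: nKB; rewrite -[B](mulKVmx (uK _ Kk)); apply: (KM) => //.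
  have K'kB : K' (invmx k *m B) by apply: K'M => //; apply/sK/KV.
  apply: zclosed_vanish => // [|p p0]; first exact: uK'.
  have /eqP : mx_eval h (invmx k *m B) * mx_eval p (invmx k *m B) = 0.
    by apply: hP => // a b Ka Kb; apply/p0/KM.
  by rewrite mulf_eq0 (negbTE hB) => /eqP.
- apply/seteqP; split=> // B [[_ KB] [_ /(_ _ (imageP _ KB))]].
  rewrite mx_eval_sandwich mulmx1 addr0 mulVmx ?uK // h1 => /eqP.
  by rewrite oner_eq0.
- move=> /(_ _ K'1)[_ /(_ _ (imageP _ K1))].
  rewrite mx_eval_sandwich !mulmx1 addr0 invmx1 h1 => /eqP.
  by rewrite oner_eq0.
Qed.

Lemma lie_vspace K : exists U : {vspace 'M[F]_n}, forall X, (X \in U) <-> lie K X.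
Proof.
have exd : exists d, `[< exists U : {vspace 'M[F]_n},
    (forall X, X \in U -> lie K X) /\ \dim U = d >].
  exists 0%N; apply/asboolP; exists 0%VS; rewrite dimv0; split=> // X.
  by rewrite memv0 => /eqP->; exact: lie0.
have bound d : `[< exists U : {vspace 'M[F]_n},
    (forall X, X \in U -> lie K X) /\ \dim U = d >] -> (d <= \dim {:'M[F]_n})%N.
  by move=> /asboolP[U [_ <-]]; apply: dimvS; exact: subvf.
case: (ex_maxnP exd bound) => d /asboolP[U [UK dU]] Umax.
exists U => X; split=> [|lX]; first exact: UK.
apply: contrapT => /negP nUX.
have : (\dim (U + <[X]>) <= d)%N.
  apply: Umax; apply/asboolP; exists (U + <[X]>)%VS; split=> // Y.
  case/memv_addP=> u Uu [w /vlineP[a ->] ->].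
  by apply: lieD; [apply: UK | apply: lieZ].
have := dimvS (addvSl U <[X]>); rewrite -dU => le1 le2.
have /eqP E : (U == (U + <[X]>))%VS by rewrite eqEdim addvSl.
by case/negP: nUX; rewrite E memvE addvSr.
Qed.

End Lie.

(** * Exponentials of nilpotent matrices *)

Section Bracket.
Variables (F : fieldType) (n : nat).
Implicit Types X Y Z : 'M[F]_n.

Lemma bracket_is_linear X : linear (@bracket F n X).
Proof.
move=> a Y Z; rewrite /bracket mulmxDr mulmxDl -scalemxAr -scalemxAl.
by rewrite scalerBr opprD addrACA.
Qed.

HB.instance Definition _ X :=
  GRing.isLinear.Build F 'M[F]_n 'M[F]_n _ (@bracket F n X) (bracket_is_linear X).

Lemma bracket_anti X Y : bracket X Y = - bracket Y X.
Proof. by rewrite /bracket opprB. Qed.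

Lemma bracketNl X Y : bracket (- X) Y = - bracket X Y.
Proof. by rewrite /bracket mulNmx mulmxN opprK opprB addrC. Qed.

Lemma bracketZl a X Y : bracket (a *: X) Y = a *: bracket X Y.
Proof. by rewrite /bracket -scalemxAr -scalemxAl scalerBr. Qed.

Lemma bracket_jacobi X Y Z :
  bracket X (bracket Y Z) = bracket (bracket X Y) Z + bracket Y (bracket X Z).
Proof.
rewrite /bracket !mulmxBr !mulmxBl !mulmxA !opprB.
move: (X *m Y *m Z) (X *m Z *m Y) (Y *m Z *m X) (Z *m Y *m X) (Y *m X *m Z) (Z *m X *m Y).
by move=> a b c d e f; apply/matrixP => i j; rewrite !mxE; ring.
Qed.

End Bracket.

Section Exponential.
Variables (F : numFieldType) (n : nat).
Implicit Types (X Y Z : 'M[F]_n) (K : set 'M[F]_n).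

Definition mxpow X k := iter k (mulmx X) 1%:M.

(* [sum_(k < N) (tX)^k / k!], the exponential of [tX] when [X^N = 0]. *)
Definition exppoly (N : nat) X : 'M[{poly F}]_n :=
  \sum_(k < N) ((k`!)%:R^-1 *: 'X^k) *: map_mx polyC (mxpow X k).

Definition expmx N X s : 'M[F]_n := map_mx (horner_eval s) (exppoly N X).

Lemma mxpowSr X k : mxpow X k.+1 = mxpow X k *m X.
Proof.
elim: k => [|k IH]; first by rewrite /mxpow /= mulmx1 mul1mx.
by rewrite -[LHS]/(X *m mxpow X k.+1) {1}IH mulmxA.
Qed.

Lemma mxpow_ge X N k : mxpow X N = 0 -> (N <= k)%N -> mxpow X k = 0.
Proof.
move=> XN; elim: k => [|k IH]; first by rewrite leqn0 => /eqP <-.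
by rewrite leq_eqVlt => /orP[/eqP<- //|/IH]; rewrite mxpowSr => ->; rewrite mul0mx.
Qed.

Lemma expmxE N X s : expmx N X s = \sum_(k < N) (s ^+ k / (k`!)%:R) *: mxpow X k.
Proof.
rewrite /expmx /exppoly raddf_sum; apply: eq_bigr => k _.
apply/matrixP => i j; rewrite !mxE /= /horner_eval hornerM hornerZ hornerXn hornerC.
by rewrite [_^-1 * _]mulrC.
Qed.

Lemma expmx0 N X : (0 < N)%N -> expmx N X 0 = 1%:M.
Proof.
case: N => // N _; rewrite expmxE big_ord_recl expr0 fact0 invr1 mulr1 scale1r.
by rewrite big1 ?addr0 // => k _; rewrite expr0n mul0r scale0r.
Qed.

Lemma map_deriv_mulmx m1 m2 m3 (P : 'M[{poly F}]_(m1, m2)) (Q : 'M_(m2, m3)) :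
  map_mx (@deriv F) (P *m Q) = map_mx (@deriv F) P *m Q + P *m map_mx (@deriv F) Q.
Proof.
apply/matrixP => i j; rewrite !mxE raddf_sum -big_split; apply: eq_bigr => k _ /=.
by rewrite derivM !mxE.
Qed.

Lemma deriv_exppoly N X : mxpow X N = 0 ->
  map_mx (@deriv F) (exppoly N X) = map_mx polyC X *m exppoly N X.
Proof.
case: N => [|N] XN.
  by rewrite /exppoly !big_ord0 mulmx0; apply/matrixP => i j; rewrite !mxE deriv0.
rewrite /exppoly [in RHS]big_ord_recr /= mulmxDr -scalemxAr -map_mxM.
rewrite -[X *m _]/(mxpow X N.+1) XN map_mx0 scaler0 addr0.
rewrite big_ord_recl mulmx_sumr.
have -> : map_mx (@deriv F) = (map_mx (deriv : {linear {poly F} -> {poly F}}) :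
  'M_n -> 'M_n) by [].
rewrite raddfD /= raddf_sum.
rewrite (_ : map_mx _ _ = 0) ?add0r; last first.
  by apply/matrixP => i j; rewrite !mxE expr0 derivM derivZ derivC -polyC1 derivC scaler0 mul0r mulr0 addr0.
apply: eq_bigr => k _; rewrite -scalemxAr -map_mxM.
apply/matrixP => i j; rewrite !mxE /= derivM derivC mulr0 addr0 derivZ derivXn.
congr (_ * _); rewrite /= /bump leq0n add1n -scaler_nat scalerA.
congr (_ *: _); rewrite factS natrM invfM mulrAC mulVf ?mul1r //.
by rewrite pnatr_eq0.
Qed.

(** Used to prove identities between exponentials by differentiating them instead of manipulating
    the sums. *)
Lemma polymx_deriv_inj m1 m2 (P Q : 'M[{poly F}]_(m1, m2)) :
  map_mx (@deriv F) P = map_mx (@deriv F) Q ->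
  map_mx (horner_eval 0) P = map_mx (horner_eval 0) Q -> P = Q.
Proof.
move=> dPQ PQ0; apply/matrixP => i j; apply/polyP => -[|k].
  by move/matrixP/(_ i j): PQ0; rewrite !mxE /horner_eval !horner_coef0.
move/matrixP/(_ i j): dPQ; rewrite !mxE => /(congr1 (fun p : {poly F} => p`_k)).
by rewrite !coef_deriv => /eqP; rewrite eqrMn2r /= => /eqP.
Qed.

Lemma exppoly_comm N X : map_mx polyC X *m exppoly N X = exppoly N X *m map_mx polyC X.
Proof.
rewrite mulmx_sumr mulmx_suml; apply: eq_bigr => k _.
by rewrite -scalemxAr -scalemxAl -!map_mxM -mxpowSr.
Qed.

Lemma mxpowN X k : mxpow (- X) k = (-1) ^+ k *: mxpow X k.
Proof.
elim: k => [|k IH]; first by rewrite expr0 scale1r.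
by rewrite /= IH mulNmx -scalemxAr exprS mulN1r scaleNr.
Qed.

Lemma expmx_invl N X s : (0 < N)%N -> mxpow X N = 0 -> expmx N X s *m expmx N (- X) s = 1%:M.
Proof.
move=> N0 XN; have XN' : mxpow (- X) N = 0 by rewrite mxpowN XN scaler0.
suff E : exppoly N X *m exppoly N (- X) = 1%:M.
  by rewrite /expmx -map_mxM E map_mx1.
apply: polymx_deriv_inj.
  rewrite map_deriv_mulmx !deriv_exppoly // exppoly_comm -mulmxA -mulmxDr.
  rewrite -mulmxDl -map_mxD subrr map_mx0 mul0mx mulmx0.
  by apply/matrixP => i j; rewrite !mxE; case: eqP => _; rewrite ?derivC ?deriv0 // -polyC1 derivC.
by rewrite map_mxM -!/(expmx _ _ 0) !expmx0 // mulmx1 map_mx1.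
Qed.

Lemma expmx_unit N X s : (0 < N)%N -> mxpow X N = 0 -> expmx N X s \in unitmx.
Proof. by move=> N0 XN; case/mulmx1_unit: (expmx_invl s N0 XN). Qed.

Lemma invmx_expmx N X s : (0 < N)%N -> mxpow X N = 0 ->
  invmx (expmx N X s) = expmx N (- X) s.
Proof.
move=> N0 XN; have uE := expmx_unit s N0 XN.
by rewrite -[RHS](mulKmx uE) expmx_invl // mulmx1.
Qed.

Lemma deriv_pev_exppoly N X p : mxpow X N = 0 ->
  (pev p (exppoly N X))^`() = pev (flow 0 X 0 p) (exppoly N X).
Proof.
move=> XN; apply/eqP; rewrite -subr_eq0; apply/eqP/poly_fun_eq0 => s.
rewrite hornerD hornerN (horner_deriv_pev _ (X := expmx N X s) (Y := expmx N X s *m X)) //.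
  by rewrite horner_pev mx_eval_flow mul0mx add0r addr0 subrr.
rewrite deriv_exppoly // exppoly_comm map_mxM; congr (_ *m _).
by apply/matrixP => i j; rewrite !mxE /= /horner_eval hornerC.
Qed.

(** The derivative of p(exp tX) is q(exp tX), where q is the derivative of p along the
    left-invariant field of X and still vanishes on K. By induction every coefficient of p(exp tX)
    in t is 0. *)
Theorem expmx_in_group N K X s : algebraic_group K -> lie K X -> (0 < N)%N ->
  mxpow X N = 0 -> K (expmx N X s).
Proof.
move=> [gK cK] lX N0 XN; apply: zclosed_vanish => //; first exact: expmx_unit.
move=> p p0; rewrite -horner_pev.
suff -> : pev p (exppoly N X) = 0 by rewrite horner0.
apply/polyP => k; rewrite coef0; elim: k p p0 => [|k IH] p p0.
  rewrite -horner_coef0 horner_pev -/(expmx N X 0) expmx0 //.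
  by apply: p0; case: gK.
have := IH _ (flow_vanishes1 gK lX p0).
rewrite -deriv_pev_exppoly // coef_deriv => /eqP.
by rewrite mulrn_eq0 /= => /eqP.
Qed.

Lemma lie_expmx N K X : (1 < N)%N -> (forall s, K (expmx N X s)) -> lie K X.
Proof.
move=> N1 KX p p0.
have E : pev p (exppoly N X) = 0.
  by apply: poly_fun_eq0 => s; rewrite horner_pev; apply: p0; exact: KX.
rewrite -/(diffat p 1%:M X); suff <- : (pev p (exppoly N X))^`().[0] = diffat p 1%:M X by rewrite E deriv0 horner0.
apply: horner_deriv_pev; first by rewrite -/(expmx N X 0) expmx0 // ltnW.
apply/matrixP => i j; rewrite !mxE /= /horner_eval horner_coef0 coef_deriv mulr1n.
rewrite summxE coef_sum; case: N N1 {KX E} => [|[|N]] // _.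
rewrite !big_ord_recl big1 ?addr0.
  rewrite !mxE !expr0 !coefMC !coefZ fact0 -polyC1 coefC expr1 coefX /= mulr0 mul0r add0r.
  rewrite invr1 !mul1r -[RHS](congr1 (fun Y : 'M_n => Y i j) (mulmx1 X)).
  by rewrite [RHS]mxE.
by move=> k _; rewrite !mxE coefMC coefZ coefXn /= mulr0 mul0r.
Qed.

End Exponential.

(** * Nilpotency from eigenvalues, and lowest weight vectors of sl_2 *)

Section Nilpotent.
Variables (F : numFieldType).

Lemma eigenvector_seq0 m (g : 'M[F]_m) (c : nat -> F) (v : nat -> 'rV[F]_m) :
  injective c -> (forall k, v k *m g = c k *: v k) -> exists k, v k = 0.
Proof.
move=> inj_c vg; apply: contrapT => no.
have nv k : v k != 0 by apply/eqP => vk; apply: no; exists k.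
have pn0 : char_poly g != 0 by rewrite -size_poly_eq0 size_char_poly.
pose rs := [seq c k | k <- iota 0 m.+1].
have := max_poly_roots pn0 (rs := rs).
rewrite size_char_poly size_map size_iota ltnn => H; suff: false by [].
apply: H; last by rewrite map_inj_uniq ?iota_uniq.
apply/allP => _ /mapP[k _ ->]; rewrite -eigenvalue_root_char.
by apply/eigenvalueP; exists (v k).
Qed.

Lemma linear_eigenvector_seq0 a b (f : {linear 'M[F]_(a, b) -> 'M[F]_(a, b)})
    (c : nat -> F) (v : nat -> 'M[F]_(a, b)) :
  injective c -> (forall k, f (v k) = c k *: v k) -> exists k, v k = 0.
Proof.
move=> inj_c fv.
have [|k /eqP] := @eigenvector_seq0 _ (lin_mx f) c (fun k => mxvec (v k)) inj_c.
  by move=> k; rewrite mul_vec_lin fv linearZ.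
by rewrite mxvec_eq0 => /eqP vk; exists k.
Qed.

Lemma bracket_mulmx n (D X Y : 'M[F]_n) :
  bracket D (X *m Y) = bracket D X *m Y + X *m bracket D Y.
Proof. by rewrite /bracket mulmxBl mulmxBr !mulmxA addrA subrK. Qed.

(** Bracketing with D is a derivation, so X^k has eigenvalue k c; nonzero eigenvectors for
    infinitely many eigenvalues cannot exist. *)
Lemma bracket_eigen_nilpotent n (D X : 'M[F]_n) (c : F) : c != 0 ->
  bracket D X = c *: X -> exists2 N, (1 < N)%N & mxpow X N = 0.
Proof.
move=> c0 DX.
have DXk k : bracket D (mxpow X k) = (c *+ k) *: mxpow X k.
  elim: k => [|k IH]; first by rewrite /bracket mulmx1 mul1mx subrr mulr0n scale0r.
  rewrite -[mxpow X k.+1]/(X *m mxpow X k) bracket_mulmx DX IH -scalemxAl -scalemxAr.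
  by rewrite -scalerDl mulrS.
have inj_c : injective (fun k => c *+ k).
  by move=> i j /eqP; rewrite -[c *+ i]mulr_natr -[c *+ j]mulr_natr (inj_eq (mulfI c0)) eqr_nat => /eqP.
have [k Xk] := linear_eigenvector_seq0 inj_c DXk.
by exists k.+2 => //; apply: (mxpow_ge Xk); rewrite -addn2 leq_addr.
Qed.

(** The vectors E^k z have distinct weights, so one of them is 0; and F E^(k+1) z is a nonzero
    multiple of E^k z, which brings the vanishing down to z. Operators on rectangular matrices cover
    both the adjoint action and column vectors of a representation. *)
Lemma sl2_lowest_eq0 a b (E Fo H : {linear 'M[F]_(a, b) -> 'M[F]_(a, b)}) m z :
  (forall v, E (Fo v) - Fo (E v) = H v) ->
  (forall v, H (E v) - E (H v) = 2%:R *: E v) ->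
  Fo z = 0 -> H z = m.+1%:R *: z -> z = 0.
Proof.
move=> EF HE Fz Hz.
have Hk k : H (iter k E z) = (m.+1 + k * 2)%:R *: iter k E z.
  elim: k => [|k IH]; first by rewrite mul0n addn0.
  rewrite iterS; have /eqP := HE (iter k E z); rewrite subr_eq => /eqP->.
  by rewrite IH linearZ -scalerDl -natrD mulSn addnCA.
have Fk k : Fo (iter k.+1 E z) = - (k.+1 * (m.+1 + k))%:R *: iter k E z.
  elim: k => [|k IH].
    have /eqP := EF z; rewrite Fz linear0 sub0r eqr_oppLR => /eqP->.
    by rewrite Hz mul1n addn0 scaleNr.
  have -> : Fo (iter k.+2 E z) = E (Fo (iter k.+1 E z)) - H (iter k.+1 E z).
    by rewrite -EF opprB addrC subrK.
  rewrite IH linearZ -[E (iter k E z)]/(iter k.+1 E z).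
  rewrite Hk -scalerBl -opprD -natrD.
  by congr (- _%:R *: _); ring.
have inj_c : injective (fun k : nat => ((m.+1 + k * 2)%:R : F)).
  by move=> i j /eqP; rewrite eqr_nat eqn_add2l eqn_mul2r /= => /eqP.
have [k] := linear_eigenvector_seq0 inj_c Hk.
elim: k => // k IH Ek; apply: IH.
have := Fk k; rewrite Ek linear0 => /esym/eqP.
by rewrite scaler_eq0 oppr_eq0 pnatr_eq0 => /eqP.
Qed.

Variable n : nat.
Implicit Types X b : 'M[F]_n.

(** Differentiating exp(sX) b exp(-sX) replaces b by [X, b]. The curve of [b2] is constant, and two
    integrations lead back to b. *)
Lemma expmx_conj2 N X b (b1 := bracket X b) (b2 := bracket X b1) s :
  (0 < N)%N -> mxpow X N = 0 -> bracket X b2 = 0 ->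
  expmx N X s *m b *m expmx N (- X) s = b + s *: b1 + (s ^+ 2 / 2%:R) *: b2.
Proof.
move=> N0 XN b3; have XN' : mxpow (- X) N = 0 by rewrite mxpowN XN scaler0.
pose Q c : 'M[{poly F}]_n := exppoly N X *m map_mx polyC c *m exppoly N (- X).
have dQ c : map_mx (@deriv F) (Q c) = Q (bracket X c).
  have dC : map_mx (@deriv F) (map_mx polyC c) = 0.
    by apply/matrixP => i j; rewrite !mxE derivC.
  rewrite /Q !map_deriv_mulmx dC mulmx0 addr0 !deriv_exppoly //.
  rewrite (exppoly_comm N X) /bracket map_mxB !map_mxM map_mxN.
  by rewrite mulNmx mulmxN mulmxBr mulmxBl !mulmxA.
have Q0 c : map_mx (horner_eval 0) (Q c) = c.
  rewrite /Q !map_mxM -!/(expmx _ _ 0) !expmx0 // mul1mx mulmx1.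
  by apply/matrixP => i j; rewrite !mxE /= /horner_eval hornerC.
have h0 m1 m2 (c : 'M[F]_(m1, m2)) t : map_mx (horner_eval t) (map_mx polyC c) = c.
  by apply/matrixP => i j; rewrite !mxE /= /horner_eval hornerC.
have Q2 : Q b2 = map_mx polyC b2.
  apply: polymx_deriv_inj; last by rewrite Q0 h0.
  rewrite dQ b3 /Q map_mx0 mulmx0 mul0mx.
  by apply/matrixP => i j; rewrite !mxE derivC.
have Q1 : Q b1 = line b1 b2.
  apply: polymx_deriv_inj; last by rewrite Q0 horner_line scale0r addr0.
  by rewrite dQ -/b2 Q2 deriv_line.
have QE : Q b = line b b1 + (2%:R^-1 *: 'X^2) *: map_mx polyC b2.
  apply: polymx_deriv_inj.
    rewrite dQ -/b1 Q1; apply/matrixP => i j; rewrite !mxE /=.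
    rewrite !derivD !derivM !derivC derivX derivZ derivXn !mulr0 !addr0 mul1r add0r.
    rewrite expr1 -scaler_nat scalerA mulVf ?scale1r //.
    by rewrite pnatr_eq0.
  rewrite Q0 map_mxD horner_line scale0r addr0; apply/matrixP => i j; rewrite !mxE /=.
  by rewrite /horner_eval hornerM hornerZ hornerXn expr0n mulr0 mul0r addr0.
have := congr1 (map_mx (horner_eval s)) QE.
rewrite /Q !map_mxM -!/(expmx _ _ s) h0 => ->; rewrite map_mxD horner_line.
congr (_ + _); apply/matrixP => i j; rewrite !mxE /=.
by rewrite /horner_eval hornerM hornerZ hornerXn hornerC [_^-1 * _]mulrC.
Qed.

End Nilpotent.

(** * Openness of double cosets *)

Section Definable.
Variables (F : numClosedFieldType) (n : nat).
Local Notation N := (n * n)%N.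
Local Notation A := {mpoly F[N]}.
Implicit Types (p q f g h : A) (X Y Z : 'M[F]_n) (G K S : set 'M[F]_n).

(** The offset lets one environment hold several matrices: a product at 0 and its factors at [N] and
    [N + N], the last two blocks being quantified in [product_definable]. *)
Definition env_mx (o : nat) (e : seq F) : 'M[F]_n := vec_mx (\row_k e`_(o + k)).
Definition mx_env X : seq F := mkseq (fun k => if insub k is Some i then mxvec X 0 i else 0) N.

Lemma mx_envK X : env_mx 0 (mx_env X) = X.
Proof.
apply: (can_inj mxvecK); rewrite vec_mxK; apply/rowP => k.
by rewrite mxE add0n nth_mkseq // valK.
Qed.

Definition poly_term (o : nat) p : GRing.term F :=
  \big[GRing.Add/GRing.Const 0]_(m <- msupp p)
    GRing.Mul (GRing.Const p@_m)
      (\big[GRing.Mul/GRing.Const 1]_(k < N) GRing.Exp (GRing.Var F (o + k)) (m k)).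

Lemma eval_poly_term o p e : GRing.eval e (poly_term o p) = mx_eval p (env_mx o e).
Proof.
rewrite /poly_term (big_morph (GRing.eval e) (fun _ _ => erefl) erefl).
rewrite /mx_eval mevalE; apply: eq_bigr => m _ /=; congr (_ * _).
rewrite (big_morph (GRing.eval e) (fun _ _ => erefl) erefl).
by apply: eq_bigr => k _ /=; rewrite vec_mxK mxE.
Qed.

Definition conjf (T : Type) (s : seq T) (phi : T -> GRing.formula F) :=
  foldr (fun x c => GRing.And (phi x) c) (GRing.Bool true) s.

Lemma holds_conjf (T : eqType) (s : seq T) (phi : T -> GRing.formula F) e :
  GRing.holds e (conjf s phi) <-> forall x, x \in s -> GRing.holds e (phi x).
Proof.
elim: s => [|y s IH]; first by split.
split=> [[hy /IH hs] x|h]; first by rewrite inE => /predU1P[->|/hs].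
split; first by apply: h; rewrite mem_head.
by apply/IH => x xs; apply: h; rewrite inE xs orbT.
Qed.

(** A first-order formula can only contain finitely many equations; Hilbert's basis theorem provides
    them. *)
Lemma zclosed_fin K : zclosed K -> exists s : seq A, forall X, X \in unitmx ->
  (K X <-> forall p, p \in s -> mx_eval p X = 0).
Proof.
move=> cK; have [s [sK Ks]] := hilbert_basis (vanishes_ideal K).
exists s => X uX; split=> [KX p /sK|X0]; first exact.
apply: zclosed_vanish => // p p0.
apply: (Ks p p0 (fun q => mx_eval q X = 0)) => //; split=> [|f g f0 g0|f g g0].
- exact: mx_eval0.
- by rewrite mx_evalD f0 g0 addr0.
- by rewrite mx_evalM g0 mulr0.
Qed.

Definition det_mpoly : A := \det (xmx F n).

Lemma mx_eval_det X : mx_eval det_mpoly X = \det X.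
Proof.
rewrite -{2}(mx_eval_xmx X) -[map_mx _ _]/(map_mx (meval _) _).
by rewrite det_map_mx.
Qed.

Definition closed_formula o (s : seq A) : GRing.formula F :=
  GRing.And (GRing.Not (GRing.Equal (poly_term o det_mpoly) (GRing.Const 0)))
    (conjf s (fun p => GRing.Equal (poly_term o p) (GRing.Const 0))).

Lemma closed_definable K o : zclosed K -> K `<=` [set X | X \in unitmx] ->
  exists phi, forall e, GRing.holds e phi <-> K (env_mx o e).
Proof.
move=> cK sK; have [s sP] := zclosed_fin cK; exists (closed_formula o s) => e.
have E p : GRing.holds e (GRing.Equal (poly_term o p) (GRing.Const 0)) <->
    mx_eval p (env_mx o e) = 0 by rewrite /= eval_poly_term.
have U : (env_mx o e \in unitmx) <-> mx_eval det_mpoly (env_mx o e) <> 0.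
  by rewrite mx_eval_det unitmxE unitfE; split=> [/eqP|/eqP].
split=> [[nd /holds_conjf sE]|Ke].
  have u : env_mx o e \in unitmx by apply/U => /E.
  by apply/sP => // p /sE/E.
have u := sK _ Ke; split; first by move/E; apply/U.
by apply/holds_conjf => p ps; apply/E; apply: (proj1 (sP _ u)).
Qed.


Lemma product_definable K1 K2 : zclosed K1 -> K1 `<=` [set X | X \in unitmx] ->
  zclosed K2 -> K2 `<=` [set X | X \in unitmx] ->
  exists phi, forall e, GRing.holds e phi <->
    exists a b, [/\ K1 a, K2 b & env_mx 0 e = a *m b].
Proof.
move=> c1 s1 c2 s2.
have [phi1 phi1P] := closed_definable N c1 s1.
have [phi2 phi2P] := closed_definable (N + N) c2 s2.
pose entry o (i j : 'I_n) := GRing.Var F (o + mxvec_index i j).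
pose prod_eq := conjf (enum {: 'I_n * 'I_n}) (fun ij => GRing.Equal (entry 0%N ij.1 ij.2)
   (\big[GRing.Add/GRing.Const 0]_(k < n) GRing.Mul (entry N ij.1 k) (entry (N + N)%N k ij.2))).
have entryE o e i j : GRing.eval e (entry o i j) = env_mx o e i j.
  by rewrite /= /env_mx [RHS]mxE mxE.
have prodP e : GRing.holds e prod_eq <->
    env_mx 0 e = env_mx N e *m env_mx (N + N) e.
  rewrite holds_conjf; split=> [h|h [i j] _].
    apply/matrixP => i j; have := h (i, j); rewrite mem_enum => /(_ isT).
    rewrite /GRing.holds entryE => ->.
    rewrite (big_morph (GRing.eval e) (fun _ _ => erefl) erefl) [RHS]mxE.
    by apply: eq_bigr => k _; rewrite -!entryE.
  rewrite /GRing.holds entryE h /= (big_morph (GRing.eval e) (fun _ _ => erefl) erefl) [LHS]mxE.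
  by apply: eq_bigr => k _; rewrite -!entryE.
exists (foldr GRing.Exists (GRing.And phi1 (GRing.And phi2 prod_eq)) (iota N (N + N))) => e.
rewrite -GRing.foldExistsP; split=> [[e' ee' [/phi1P h1 [/phi2P h2 /prodP h3]]]|[a [b [K1a K2b E]]]].
  exists (env_mx N e'), (env_mx (N + N) e'); split=> //; rewrite -h3.
  apply: (can_inj mxvecK); rewrite !vec_mxK; apply/rowP => k; rewrite !mxE.
  by rewrite ee' // inE mem_iota add0n negb_and -ltnNge ltn_ord.
pose v k := if (k < N)%N then e`_k else if (k < N + N)%N then (mx_env a)`_(k - N)
  else if (k < N + (N + N))%N then (mx_env b)`_(k - (N + N)) else e`_k.
pose e' := mkseq v (maxn (size e) (N + (N + N))).
have e'E k : e'`_k = v k.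
  case: (ltnP k (maxn (size e) (N + (N + N)))) => [lt_k|]; first by rewrite nth_mkseq.
  rewrite geq_max => /andP[le_e le_N]; rewrite nth_default ?size_mkseq ?geq_max ?le_e //.
  have le_NN : (N + N <= k)%N by apply: leq_trans le_N; rewrite addnA leq_addr.
  rewrite /v ltnNge (leq_trans _ le_NN) ?leq_addr //=.
  by rewrite ltnNge le_NN /= ltnNge le_N /= nth_default.
have E0 : env_mx 0 e' = env_mx 0 e.
  congr vec_mx; apply/rowP => k; rewrite !mxE add0n e'E /v.
  by rewrite (ltn_ord k).
have E1 : env_mx N e' = a.
  rewrite -[RHS]mx_envK; congr vec_mx; apply/rowP => k; rewrite !mxE add0n e'E /v.
  by rewrite ltn_add2l ltn_ord ltnNge leq_addr /= addKn.
have E2 : env_mx (N + N) e' = b.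
  rewrite -[RHS]mx_envK; congr vec_mx; apply/rowP => k; rewrite !mxE add0n e'E /v.
  rewrite -addnA ltnNge leq_addr /= ltn_add2l ltnNge leq_addr /= !ltn_add2l ltn_ord.
  by rewrite addnA addKn.
exists e'; last first.
  by split; [apply/phi1P; rewrite E1 | split; [apply/phi2P; rewrite E2 | apply/prodP; rewrite E0 E1 E2]].
move=> k; rewrite !inE mem_iota negb_and -ltnNge -leqNgt => /orP[lt_k|le_k].
  by rewrite e'E /v lt_k.
have le_NN : (N + N <= k)%N by apply: leq_trans le_k; rewrite addnA leq_addr.
rewrite e'E /v ltnNge (leq_trans _ le_NN) ?leq_addr //=.
by rewrite ltnNge le_NN /= ltnNge le_k.
Qed.

(** Primality of the vanishing ideal; its properness is required separately, as [~ vanishes S 1]. *)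
Definition irreducible_set (S : 'M[F]_n -> Prop) :=
  forall p q, vanishes S (p * q) -> vanishes S p \/ vanishes S q.

Lemma eval_rterm_mpoly t : GRing.rterm t ->
  exists p, forall X, GRing.eval (mx_env X) t = mx_eval p X.
Proof.
elim: t => //= [k _|a _|k _|t IHt u IHu /andP[/IHt[p pE] /IHu[q qE]]|t IHt /IHt[p pE]
  |t IHt k /IHt[p pE]|t IHt u IHu /andP[/IHt[p pE] /IHu[q qE]]|t IHt k /IHt[p pE]].
- case: (ltnP k N) => [lt_k|le_k].
    exists 'X_(Ordinal lt_k) => X; rewrite mx_evalX nth_mkseq //.
    by rewrite insubT.
  by exists 0 => X; rewrite mx_eval0 nth_default // size_mkseq.
- by exists a%:MP => X; rewrite mx_evalC.
- by exists (k%:R)%:MP => X; rewrite mx_evalC.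
- by exists (p + q) => X; rewrite mx_evalD pE qE.
- by exists (- p) => X; rewrite mx_evalN pE.
- by exists (p *+ k) => X; rewrite pE /mx_eval mevalMn.
- by exists (p * q) => X; rewrite mx_evalM pE qE.
- by exists (p ^+ k) => X; rewrite pE /mx_eval rmorphXn.
Qed.

(** An equation either holds on all of [S] or fails wherever the difference of its two sides is
    nonzero. Irreducibility allows the finitely many conditions of nonvanishing to be multiplied
    together. *)
Lemma qf_generic (S : 'M[F]_n -> Prop) (c : GRing.formula F) : irreducible_set S -> ~ vanishes S 1 ->
  GRing.qf_form c && GRing.rformula c ->
  exists g b, ~ vanishes S g /\
    forall X, S X -> mx_eval g X != 0 -> GRing.qf_eval (mx_env X) c = b.
Proof.
move=> irrS S1; have irr g g' : ~ vanishes S g -> ~ vanishes S g' -> ~ vanishes S (g * g').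
  by move=> ng ng' /irrS[].
have comb g g' X : mx_eval (g * g') X != 0 -> mx_eval g X != 0 /\ mx_eval g' X != 0.
  by rewrite mx_evalM mulf_eq0 negb_or => /andP.
elim: c => //=.
- by move=> b _; exists 1, b.
- move=> t u /andP[/eval_rterm_mpoly[p pE] /eval_rterm_mpoly[q qE]].
  have [pq|npq] := pselect (vanishes S (p - q)).
    exists 1, true; split=> // X SX _; rewrite pE qE.
    by rewrite -subr_eq0 -mx_evalB pq ?eqxx.
  exists (p - q), false; split=> // X SX; rewrite mx_evalB subr_eq0 pE qE.
  exact: negbTE.
- move=> f IHf f' IHf'; rewrite andbACA => /andP[/IHf[g [b [ng gP]]] /IHf'[g' [b' [ng' gP']]]].
  exists (g * g'), (b && b'); split=> [|X SX /comb[hg hg']]; first exact: irr.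
  by rewrite gP // gP'.
- move=> f IHf f' IHf'; rewrite andbACA => /andP[/IHf[g [b [ng gP]]] /IHf'[g' [b' [ng' gP']]]].
  exists (g * g'), (b || b'); split=> [|X SX /comb[hg hg']]; first exact: irr.
  by rewrite gP // gP'.
- move=> f IHf f' IHf'; rewrite andbACA => /andP[/IHf[g [b [ng gP]]] /IHf'[g' [b' [ng' gP']]]].
  exists (g * g'), (b ==> b'); split=> [|X SX /comb[hg hg']]; first exact: irr.
  by rewrite gP // gP'.
- move=> f IHf /IHf[g [b [ng gP]]]; exists g, (~~ b); split=> // X SX hg.
  by rewrite gP.
Qed.


(* By quantifier elimination a definable set is constructible. *)
Lemma definable_generic (S : 'M[F]_n -> Prop) (c : GRing.formula F) (P : set 'M[F]_n) :
  irreducible_set S -> ~ vanishes S 1 ->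
  (forall e, GRing.holds e c <-> P (env_mx 0 e)) ->
  exists g, ~ vanishes S g /\
    ((forall X, S X -> mx_eval g X != 0 -> P X) \/
     (forall X, S X -> mx_eval g X != 0 -> ~ P X)).
Proof.
move=> irrS S1 cP.
have wf := @ClosedFieldQE.wf_ex_elim F.
have ok := ClosedFieldQE.holds_ex_elim (@solve_monicpoly F).
pose c1 := GRing.to_rform c; have rc1 : GRing.rformula c1 := GRing.to_rform_rformula c.
have qfc := GRing.quantifier_elim_wf wf rc1.
have [g [b [ng gP]]] := qf_generic irrS S1 qfc.
have E X : P X <-> GRing.qf_eval (mx_env X) (GRing.quantifier_elim (@ClosedFieldQE.ex_elim F) c1).
  have fP := GRing.quantifier_elim_rformP wf ok (mx_env X) rc1.
  rewrite -{1}[X]mx_envK -cP -GRing.to_rformP; split=> [h|/fP //].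
  exact/fP.
exists g; split=> //; case: b gP => gP; [left|right] => X SX gX.
  by apply/E; rewrite gP.
by move/E; rewrite gP.
Qed.

(* The double coset K1 K2 is open: near 1 it is dense, it is constructible by
   quantifier elimination, and it is homogeneous under K1 x K2. *)
Theorem product_open G K1 K2 : is_group G -> algebraic_group K1 -> algebraic_group K2 ->
  K1 `<=` G -> K2 `<=` G ->
  (forall Y, lie G Y -> exists Y1 Y2, [/\ lie K1 Y1, lie K2 Y2 & Y = Y1 + Y2]) ->
  zopen_in G [set X | exists a b, [/\ K1 a, K2 b & X = a *m b]].
Proof.
move=> [uG G1 GM GV] [gK1 cK1] [gK2 cK2] s1 s2 spG.
have [u1 K1_1 K1M K1V] := gK1; have [u2 K2_1 K2M K2V] := gK2.
set P := [set X | _].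
have PG : P `<=` G by move=> _ [a [b [/s1 Ga /s2 Gb ->]]]; apply: GM.
have [h [h1 hP]] := product_closure_near1 gK1 gK2
  (fun a b Ka Kb => GM _ _ (s1 a Ka) (s2 b Kb)) spG.
(* [G] may be reducible. Among its nonempty open subsets [D u], one with maximal vanishing ideal is
   irreducible, since shrinking it further cannot enlarge the ideal. *)
pose D u X := G X /\ mx_eval (h * u) X != 0.
pose E I := exists u, (exists X, D u X) /\ I = vanishes (D u).
have E1 : E (vanishes (D 1)).
  exists 1; split=> //; exists 1%:M; split=> //.
  by rewrite mx_evalM h1 mx_eval1 mulr1 oner_eq0.
have [_ [[u [[X0 DX0] ->]] Imax]] := noetherian_max (@hilbert_basis F N) E1
  (fun I EI => let: ex_intro _ (conj _ e) := EI in
     eq_ind_r (fun I => is_ideal I) (vanishes_ideal _) e).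
have irrD : irreducible_set (D u).
  move=> p q pq; have [|np] := pselect (vanishes (D u) p); [by left|right].
  have [X [DX pX]] : exists X, D u X /\ mx_eval p X != 0.
    apply: contrapT => no; apply: np => X DX; apply: contrapT => /eqP pX.
    by apply: no; exists X.
  have subD Y : D (u * p) Y -> D u Y /\ mx_eval p Y != 0.
    by case=> GY; rewrite mulrA mx_evalM mulf_eq0 negb_or => /andP[].
  apply: (Imax (vanishes (D (u * p)))).
  - exists (u * p); split=> //; exists X; case: DX => GX huX; split=> //.
    by rewrite mulrA mx_evalM mulf_neq0.
  - by move=> f f0 Y /subD[/f0].
  - move=> Y /subD[DY pY]; apply/eqP; move/eqP: (pq Y DY).
    by rewrite mx_evalM mulf_eq0 (negbTE pY).
have D1 : ~ vanishes (D u) 1.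
  by move=> /(_ _ DX0)/eqP; rewrite mx_eval1 oner_eq0.
have [c cP] := product_definable cK1 u1 cK2 u2.
have [g [ng gP]] := definable_generic irrD D1 (P := P) cP.
have [X1 [DX1 gX1]] : exists X, D u X /\ mx_eval g X != 0.
  apply: contrapT => no; apply: ng => X DX; apply: contrapT => /eqP pX.
  by apply: no; exists X.
(* If generic points avoided [P], then [h * u * g] would vanish on the product, so [h] times it
   would vanish on [G], in particular at [X1]. *)
case: gP => gP; last first.
  have : mx_eval h X1 * mx_eval (h * u * g) X1 = 0.
    case: DX1 => GX1 _; apply: hP => // a b Ka Kb.
    have GX : G (a *m b) by apply: GM; [apply: s1 | apply: s2].
    apply/eqP; rewrite mx_evalM mulf_eq0; apply/orP.
    have [|hu] := eqVneq (mx_eval (h * u) (a *m b)) 0; [by left|right].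
    have DX : D u (a *m b) by [].
    apply: contrapT => /negP ga; apply: (gP _ DX ga); by exists a, b.
  case: DX1 => _ hu; move/eqP; rewrite mulf_eq0 mx_evalM mulf_eq0 (negbTE gX1).
  rewrite (negbTE hu) !orbF => /eqP hX; move: hu.
  by rewrite mx_evalM hX mul0r eqxx.
pose w := h * u * g.
have wP X : G X -> mx_eval w X != 0 -> P X.
  move=> GX; rewrite mx_evalM mulf_eq0 negb_or => /andP[hu gX].
  exact: gP.
have [a0 [b0 [Ka0 Kb0 EX1]]] : P X1 by apply: gP.
(* [P] is the union of the translates by K1 x K2 of the open set where [w] is nonzero, so its
   complement is cut out by the translates of [w]. *)
pose T : set A := [set p | exists a b, [/\ K1 a, K2 b & p = sandwich a b 0 w]].
exists [set X | X \in unitmx /\ forall p, T p -> mx_eval p X = 0]; first by exists T.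
apply/seteqP; split=> [_ [a [b [Ka Kb ->]]]|X [GX nX]].
  split; first by apply: PG; exists a, b.
  have Kaa : K1 (a0 *m invmx a) by apply: K1M => //; apply: K1V.
  have Kbb : K2 (invmx b *m b0) by apply: K2M => //; apply: K2V.
  move=> [_ /(_ (sandwich (a0 *m invmx a) (invmx b *m b0) 0 w))].
  rewrite mx_eval_sandwich addr0 !mulmxA mulmxKV ?u1 // mulmxK ?u2 // -EX1.
  move=> H; have : mx_eval w X1 = 0.
    by apply: H; exists (a0 *m invmx a), (invmx b *m b0).
  move/eqP; case: DX1 => _ hu; rewrite mx_evalM mulf_eq0 (negbTE hu) (negbTE gX1) //.
have [a [b [Ka Kb wX]]] : exists a b, [/\ K1 a, K2 b & mx_eval w (a *m X *m b) != 0].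
  apply: contrapT => no; apply: nX; split; first exact: uG.
  move=> _ [a [b [Ka Kb ->]]]; rewrite mx_eval_sandwich addr0.
  by apply: contrapT => /eqP wX; apply: no; exists a, b.
have [a' [b' [Ka' Kb' E']]] : P (a *m X *m b).
  by apply: wP => //; apply: (GM); [apply: (GM) => //; apply: s1 | apply: s2].
exists (invmx a *m a'), (b' *m invmx b); split.
- by apply: K1M => //; apply: K1V.
- by apply: K2M => //; apply: K2V.
rewrite -!mulmxA [a' *m _]mulmxA -E' mulmxK ?u2 // mulKmx //.
exact: u1.
Qed.

End Definable.

(** * Borel subgroups containing given one-parameter subgroups *)

Section Closure.
Variables (F : numClosedFieldType) (n : nat).
Local Notation N := (n * n)%N.
Local Notation A := {mpoly F[N]}.
Implicit Types (p q : A) (X Y Z : 'M[F]_n) (G K S T : set 'M[F]_n).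

Definition zclosure S : set 'M[F]_n :=
  [set X | X \in unitmx /\ forall p, vanishes S p -> mx_eval p X = 0].

Lemma zclosure_closed S : zclosed (zclosure S).
Proof. by exists (vanishes S). Qed.

Lemma sub_zclosure S : S `<=` [set X | X \in unitmx] -> S `<=` zclosure S.
Proof. by move=> uS X SX; split=> [|p p0]; [apply: uS | apply: p0]. Qed.

Lemma zclosure_min S K : zclosed K -> S `<=` K -> zclosure S `<=` K.
Proof.
move=> cK sK X [uX X0]; apply: zclosed_vanish => // p p0.
by apply: X0 => Y /sK; apply: p0.
Qed.

Lemma mx_evalXn p k X : mx_eval (p ^+ k) X = mx_eval p X ^+ k.
Proof. exact: (rmorphXn (meval _)). Qed.

(** The entries of the inverse are cofactors divided by det; a power of det clears the denominators.
    This is what makes a closure stable under inversion. *)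
Lemma mx_eval_inv p : exists d q, forall X, X \in unitmx ->
  mx_eval q X = \det X ^+ d * mx_eval p (invmx X).
Proof.
elim/mpoly_ring_ind: p => [a|k|p q [d [p' E]] [e [q' E']]|p q [d [p' E]] [e [q' E']]].
- by exists 0%N, a%:MP => X _; rewrite !mx_evalC expr0 mul1r.
- exists 1%N, (mxvec (\adj (xmx F n)) 0 k) => X uX.
  rewrite mx_eval_mxvec mx_evalX.
  have -> : map_mx (fun q => mx_eval q X) (\adj (xmx F n)) = \adj X.
    by rewrite -[LHS]/(map_mx (meval _) _) map_mx_adj -[map_mx _ _]/(map_mx _ _)
      [map_mx _ _](mx_eval_xmx X).
  rewrite /invmx uX linearZ mxE mulrA expr1 mulfV ?mul1r //.
  by move: uX; rewrite unitmxE unitfE.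
- exists (d + e)%N, (det_mpoly F n ^+ e * p' + det_mpoly F n ^+ d * q') => X uX.
  rewrite !mx_evalD !mx_evalM E // E' // !mx_evalXn mx_eval_det.
  by rewrite exprD mulrDr !mulrA; congr (_ + _); rewrite [_ ^+ e * _]mulrC.
- exists (d + e)%N, (p' * q') => X uX.
  by rewrite !mx_evalM E // E' // exprD mulrACA.
Qed.

Lemma zclosure_group K : is_group K -> is_group (zclosure K).
Proof.
move=> [uK K1 KM KV]; have sK := sub_zclosure uK.
have KcM a X : K a -> zclosure K X -> zclosure K (a *m X).
  move=> Ka [uX X0]; split=> [|p p0]; first by rewrite unitmx_mul uX (uK _ Ka).
  have := X0 (sandwich a 1%:M 0 p); rewrite mx_eval_sandwich mulmx1 addr0; apply.
  move=> b Kb; rewrite mx_eval_sandwich mulmx1 addr0; exact/p0/KM.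
split=> [X []||X Y [uX X0] KY|X [uX X0]] //; first exact: sK.
  have [uY _] := KY; split=> [|p p0]; first by rewrite unitmx_mul uX uY.
  have := X0 (sandwich 1%:M Y 0 p); rewrite mx_eval_sandwich mul1mx addr0; apply.
  move=> a Ka; rewrite mx_eval_sandwich mul1mx addr0.
  by have [_] := KcM a Y Ka KY; apply.
split=> [|p p0]; first by rewrite unitmx_inv.
have [d [q qE]] := mx_eval_inv p.
have := X0 q; rewrite qE // => /(_ _)/eqP; rewrite mulf_eq0 expf_eq0.
have -> : \det X == 0 = false by apply/negbTE; move: uX; rewrite unitmxE unitfE.
rewrite andbF => H; apply/eqP/H => a Ka; rewrite qE ?uK //.
by rewrite p0 ?mulr0 //; apply: KV.
Qed.

Lemma unitmx_group : is_group [set X : 'M[F]_n | X \in unitmx].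
Proof.
split=> //= [|X Y uX uY|X]; [exact: unitmx1 | by rewrite unitmx_mul uX | by rewrite unitmx_inv].
Qed.

Lemma group_generated_sub S : S `<=` group_generated S.
Proof. by move=> X SX K _; apply. Qed.

Lemma group_generated_group S : S `<=` [set X | X \in unitmx] ->
  is_group (group_generated S).
Proof.
move=> uS; split=> [X /(_ _ unitmx_group uS) //|K [] //|X Y gX gY K gK SK|X gX K gK SK].
  by case: (gK) => _ _ M _; apply: M; [apply: gX | apply: gY].
by case: (gK) => _ _ _; apply; apply: gX.
Qed.

Lemma zclosed_translate g K : g \in unitmx -> zclosed K -> zclosed [set X | K (g *m X)].
Proof.
move=> ug [S ->]; exists [set sandwich g 1%:M 0 p | p in S].
apply/seteqP; split=> X /=; rewrite unitmx_mul ug /= => -[uX X0]; split=> //.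
  by move=> _ [p Sp <-]; rewrite mx_eval_sandwich mulmx1 addr0; apply: X0.
by move=> p Sp; have := X0 _ (imageP _ Sp); rewrite mx_eval_sandwich mulmx1 addr0.
Qed.

(** Once [Z1] contains an element g of the generated group, it contains the whole connected set g C,
    because g C meets it in g. Thus [Z1] is stable under right multiplication by generators and
    their inverses. *)
Lemma generated_connected S :
  S `<=` [set X | X \in unitmx] ->
  (forall X, S X -> exists C : set 'M[F]_n, [/\ C `<=` S, zconnected C, C 1%:M, C X & C (invmx X)]) ->
  connected_algebraic_group (zclosure (group_generated S)).
Proof.
move=> uS SC; have gK := group_generated_group uS; have [uK K1 KM KV] := gK.
split; first by split; [exact: zclosure_group | exact: zclosure_closed].
have sK := sub_zclosure uK.
suff main (Z1 Z2 : set 'M[F]_n) : zclosed Z1 -> zclosed Z2 -> zclosure (group_generated S) `<=` Z1 `|` Z2 ->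
    zclosure (group_generated S) `&` Z1 `&` Z2 = set0 -> Z1 1%:M ->
    zclosure (group_generated S) `<=` Z1.
  move=> Z1 Z2 c1 c2 cov dis.
  case: (cov _ (sK _ K1)) => Z1_1; [left|right]; first exact: main dis Z1_1.
  by apply: (main Z2 Z1 c2 c1 _ _ Z1_1); [rewrite setUC | rewrite setIAC].
move=> c1 c2 cov dis Z11; apply: zclosure_min => //.
have step g X : group_generated S g -> Z1 g -> S X -> Z1 (g *m X) /\ Z1 (g *m invmx X).
  move=> Kg Zg /SC[C [CS conC C1 CX CV]].
  have ug : g \in unitmx := uK _ Kg.
  have CK Y : C Y -> zclosure (group_generated S) (g *m Y).
    by move=> /CS SY; apply: sK; apply: KM => //; exact: (@group_generated_sub S Y SY).
  have cov' : C `<=` [set X | Z1 (g *m X)] `|` [set X | Z2 (g *m X)] by move=> Y CY; exact: (cov _ (CK Y CY)).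
  have dis' : C `&` [set X | Z1 (g *m X)] `&` [set X | Z2 (g *m X)] = set0.
    apply/seteqP; split=> // Y [[CY Z1Y] Z2Y].
    suff : (set0 : set 'M[F]_n) (g *m Y) by [].
    by rewrite -dis; split=> //; split=> //; exact: CK.
  case: (conC _ _ (zclosed_translate ug c1) (zclosed_translate ug c2) cov' dis') => sC.
    by split; apply: sC.
  have : (set0 : set 'M[F]_n) g; last by [].
  by rewrite -dis; split; [split=> //; exact: sK | have := sC _ C1; rewrite /= mulmx1].
pose M : set 'M[F]_n := [set X | group_generated S X /\ forall g, group_generated S g ->
  Z1 g -> Z1 (g *m X) /\ Z1 (g *m invmx X)].
have gM : is_group M.
  split=> [X [/uK //]||X Y [KX MX] [KY MY]|X [KX MX]].
  - by split=> // g Kg Zg; rewrite invmx1 mulmx1.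
  - split=> [|g Kg Zg]; first exact: KM.
    have uX := uK _ KX; have uY := uK _ KY.
    have -> : invmx (X *m Y) = invmx Y *m invmx X.
      have uXY : X *m Y \in unitmx by rewrite unitmx_mul uX.
      by apply: (can_inj (mulKmx uXY)); rewrite mulmxV // mulmxA mulmxK // mulmxV.
    rewrite !mulmxA; have [Z1X _] := MX g Kg Zg; have [_ Z1Y] := MY g Kg Zg.
    have [] := MY (g *m X) (KM _ _ Kg KX) Z1X; have [] := MX (g *m invmx Y) _ Z1Y.
      by apply: KM => //; apply: KV.
    by [].
  - by split=> [|g Kg Zg]; [exact: KV | rewrite invmxK; have [] := MX g Kg Zg].
have SM : S `<=` M.
  by move=> X SX; split=> [|g Kg Zg]; [exact: (@group_generated_sub S X SX) | exact: step].
by move=> X /(_ M gM SM)[_ /(_ 1%:M K1 Z11)[]]; rewrite mul1mx.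
Qed.

Lemma expmxN_scale k X s : expmx k (- X) s = expmx k X (- s).
Proof.
rewrite !expmxE; apply: eq_bigr => i _; rewrite mxpowN scalerA; congr (_ *: _).
by rewrite mulrAC -exprMn mulrN1.
Qed.

(** The curve is even irreducible, being parametrised by the line: if q p vanishes along it, then so
    does q or p. *)
Lemma exp_curve_connected k X : (0 < k)%N -> mxpow X k = 0 ->
  zconnected [set expmx k X s | s in setT].
Proof.
move=> k0 Xk Z1 Z2 [S1 ->] [S2 ->] cov _.
have [|n1] := pselect ([set expmx k X s | s in setT] `<=` [set Y | Y \in unitmx /\ forall p, S1 p -> mx_eval p Y = 0]).
  by left.
right=> _ [s _ <-]; split=> [|p Sp]; first exact: expmx_unit.
have [t [q [Sq nq]]] : exists t q, S1 q /\ mx_eval q (expmx k X t) <> 0.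
  apply: contrapT => no; apply: n1 => _ [t _ <-]; split=> [|q Sq]; first exact: expmx_unit.
  by apply: contrapT => nq; apply: no; exists t, q.
have : pev q (exppoly k X) * pev p (exppoly k X) = 0.
  apply: poly_fun_eq0 => u; rewrite hornerM !horner_pev -!/(expmx k X u).
  by case: (cov (expmx k X u)) => [|[_ /(_ _ Sq)->]|[_ /(_ _ Sp)->]]; [exists u | rewrite mul0r | rewrite mulr0].
move/eqP; rewrite mulf_eq0 => /orP[/eqP E|/eqP E].
  by case: nq; rewrite -horner_pev E horner0.
by rewrite -horner_pev E horner0.
Qed.

Lemma derived_mono K K' : K `<=` K' -> derived_group K `<=` derived_group K'.
Proof.
move=> sK X gX M gM SM; apply: gX => // _ [a [b [Ka Kb ->]]].
by apply: SM; exists a, b; split=> //; apply: sK.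
Qed.

Lemma solvable_sub K K' : K `<=` K' -> is_solvable K' -> is_solvable K.
Proof.
move=> sK [k kP]; exists k; apply: subset_trans kP.
by elim: k => //= k IH; apply: derived_mono.
Qed.

(** It suffices to maximise the dimension of the Lie algebra: a larger connected solvable group then
    has the same Lie algebra, and [connected_lie_eq] applies. *)
Lemma borel_exists (H B0 : set 'M[F]_n) : connected_algebraic_group B0 -> is_solvable B0 ->
  B0 `<=` H -> exists2 B : set 'M[F]_n, borel_subgroup H B & B0 `<=` B.
Proof.
move=> c0 s0 sH.
pose P d := exists (B : set 'M[F]_n) (U : {vspace 'M[F]_n}), [/\ connected_algebraic_group B,
  is_solvable B, B `<=` H, B0 `<=` B & (forall X, X \in U <-> lie B X) /\ \dim U = d].
have exd : exists d, `[< P d >].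
  by have [U UP] := lie_vspace B0; exists (\dim U); apply/asboolP; exists B0, U; split=> // X.
have bound d : `[< P d >] -> (d <= \dim {:'M[F]_n})%N.
  by move=> /asboolP[B [U [_ _ _ _ [_ <-]]]]; apply: dimvS; exact: subvf.
case: (ex_maxnP exd bound) => d /asboolP[B [U [cB sB BH B0B [UP dU]]]] dmax.
exists B => //; split=> // B' cB' sB' B'H BB'; apply/seteqP; split=> //.
have [U' U'P] := lie_vspace B'.
have le_d : (\dim U' <= d)%N.
  by apply/dmax/asboolP; exists B', U'; split=> //; apply: subset_trans BB'.
have sUU : (U <= U')%VS.
  by apply/subvP => X /UP lX; apply/U'P; apply: lie_subset lX.
have /eqP E : U == U' by rewrite eqEdim sUU dU.
case: cB => aB _; apply: connected_lie_eq => // X /U'P.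
by rewrite -E => /UP.
Qed.

(** The closed group generated by T and the exponentials of L is connected by construction, lies in
    H, and is solvable because it lies in B. The Borel subgroup is any one containing it. *)
Theorem borel_containing (H B T L : set 'M[F]_n) :
  algebraic_group H -> algebraic_group B -> is_solvable B ->
  connected_algebraic_group T -> T `<=` H -> T `<=` B ->
  (forall X, L X -> [/\ lie H X, lie B X & exists2 k, (1 < k)%N & mxpow X k = 0]) ->
  exists2 BH, borel_subgroup H BH &
    (forall X, lie T X -> lie BH X) /\ (forall X, L X -> lie BH X).
Proof.
move=> aH aB sB [[gT cT] conT] TH TB LP; have [uT T1 _ TV] := gT.
pose S : set 'M[F]_n := [set Y | T Y \/ exists X k s,
  [/\ L X, (1 < k)%N, mxpow X k = 0 & Y = expmx k X s]].
have uS : S `<=` [set X | X \in unitmx].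
  by move=> Y [/uT //|[X [k [s [_ k1 Xk ->]]]]]; apply: expmx_unit => //; exact: ltnW.
have SM Y : S Y -> exists C : set 'M[F]_n, [/\ C `<=` S, zconnected C, C 1%:M, C Y & C (invmx Y)].
  case=> [TY|[X [k [s [LX k1 Xk ->]]]]].
    by exists T; split=> //; [move=> Z TZ; left | exact: TV].
  exists [set expmx k X s | s in setT]; split.
  - by move=> _ [t _ <-]; right; exists X, k, t.
  - by apply: exp_curve_connected => //; exact: ltnW.
  - by exists 0 => //; rewrite expmx0 // ltnW.
  - by exists s.
  - by exists (- s) => //; rewrite invmx_expmx ?(ltnW k1) // expmxN_scale.
have cB0 := generated_connected uS SM.
have [sBH sBB] : zclosure (group_generated S) `<=` H /\ zclosure (group_generated S) `<=` B.
  have inK K : algebraic_group K -> T `<=` K -> (forall X, L X -> lie K X) ->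
      zclosure (group_generated S) `<=` K.
    move=> aK TK LK; case: (aK) => gK cK; apply: zclosure_min => // X; apply=> //.
    move=> Y [/TK //|[Z [k [s [LZ k1 Zk ->]]]]].
    by apply: expmx_in_group => //; [exact: LK | exact: ltnW].
  by split; apply: inK => // X /LP[].
have [BH bBH sB0] := borel_exists cB0 (solvable_sub sBB sB) sBH.
have SB0 : S `<=` zclosure (group_generated S).
  apply: subset_trans (@group_generated_sub S) _; apply: sub_zclosure.
  by case: (group_generated_group uS).
exists BH => //; split=> X; first by apply: lie_subset => Y TY; apply/sB0/SB0; left.
move=> LX; have [_ _ [k k1 Xk]] := LP X LX.
apply: (lie_expmx k1) => s; apply/sB0/SB0; right.
by exists X, k, s.
Qed.

End Closure.

(** * The Lie algebra of type F_4 *)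

(* Positive roots of F_4 in the basis of simple roots, by increasing height. *)
Definition F4_roots : seq (seq Z) := map (map Z.of_nat)
  [:: [:: 1; 0; 0; 0]; [:: 0; 1; 0; 0]; [:: 0; 0; 1; 0]; [:: 0; 0; 0; 1];
      [:: 1; 1; 0; 0]; [:: 0; 1; 1; 0]; [:: 0; 0; 1; 1]; [:: 1; 1; 1; 0];
      [:: 0; 1; 2; 0]; [:: 0; 1; 1; 1]; [:: 1; 1; 2; 0]; [:: 1; 1; 1; 1];
      [:: 0; 1; 2; 1]; [:: 1; 2; 2; 0]; [:: 1; 1; 2; 1]; [:: 0; 1; 2; 2];
      [:: 1; 2; 2; 1]; [:: 1; 1; 2; 2]; [:: 1; 2; 3; 1]; [:: 1; 2; 2; 2];
      [:: 1; 2; 3; 2]; [:: 1; 2; 4; 2]; [:: 1; 3; 4; 2]; [:: 2; 3; 4; 2]]%N.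

Definition F4_cartan : seq (seq Z) :=
  [:: [:: 2; -1; 0; 0]; [:: -1; 2; -2; 0]; [:: 0; -1; 2; -1]; [:: 0; 0; -1; 2]]%coqZ.

(* An entry (j, p, c) at position k - 4 says that c e_k = [e_j, e_p]. *)
Definition F4_parents : seq (nat * nat * Z) :=
  [:: (0, 1, 1%coqZ); (1, 2, 1%coqZ); (2, 3, 1%coqZ); (0, 5, 1%coqZ); (2, 5, 2%coqZ); (1, 6, 1%coqZ);
      (0, 8, 1%coqZ); (0, 9, 1%coqZ); (2, 9, 1%coqZ); (1, 10, 1%coqZ); (0, 12, 1%coqZ); (3, 12, 2%coqZ);
      (1, 14, 1%coqZ); (0, 15, 1%coqZ); (2, 16, 1%coqZ); (1, 17, 1%coqZ); (2, 19, 1%coqZ);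
      (2, 20, 2%coqZ); (1, 21, 1%coqZ); (0, 22, 1%coqZ)]%N.

(* An entry (j, k, l, c) says that [e_j, e_k] = c e_l. *)
Definition F4_up : seq (nat * nat * nat * Z) :=
  [:: (1, 0, 4, (-1)%coqZ); (0, 1, 4, 1%coqZ); (2, 1, 5, (-1)%coqZ); (1, 2, 5, 1%coqZ);
      (3, 2, 6, (-1)%coqZ); (2, 3, 6, 1%coqZ); (2, 4, 7, (-1)%coqZ); (0, 5, 7, 1%coqZ);
      (2, 5, 8, 2%coqZ); (3, 5, 9, (-1)%coqZ); (1, 6, 9, 1%coqZ); (2, 7, 10, 2%coqZ);
      (3, 7, 11, (-1)%coqZ); (0, 8, 10, 1%coqZ); (3, 8, 12, (-1)%coqZ); (0, 9, 11, 1%coqZ);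
      (2, 9, 12, 1%coqZ); (1, 10, 13, 1%coqZ); (3, 10, 14, (-1)%coqZ); (2, 11, 14, 1%coqZ);
      (0, 12, 14, 1%coqZ); (3, 12, 15, 2%coqZ); (3, 13, 16, (-1)%coqZ); (1, 14, 16, 1%coqZ);
      (3, 14, 17, 2%coqZ); (0, 15, 17, 1%coqZ); (2, 16, 18, 1%coqZ); (3, 16, 19, 2%coqZ);
      (1, 17, 19, 1%coqZ); (3, 18, 20, 1%coqZ); (2, 19, 20, 1%coqZ); (2, 20, 21, 2%coqZ);
      (1, 21, 22, 1%coqZ); (0, 22, 23, 1%coqZ)]%N.

(* An entry (j, k, l, c) says that [f_j, e_k] = c e_l. *)
Definition F4_down : seq (nat * nat * nat * Z) :=
  [:: (0, 4, 1, 1%coqZ); (1, 4, 0, (-1)%coqZ); (1, 5, 2, 1%coqZ); (2, 5, 1, (-2)%coqZ);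
      (2, 6, 3, 1%coqZ); (3, 6, 2, (-1)%coqZ); (0, 7, 5, 1%coqZ); (2, 7, 4, (-2)%coqZ);
      (2, 8, 5, 1%coqZ); (1, 9, 6, 1%coqZ); (3, 9, 5, (-1)%coqZ); (0, 10, 8, 1%coqZ);
      (2, 10, 7, 1%coqZ); (0, 11, 9, 1%coqZ); (3, 11, 7, (-1)%coqZ); (2, 12, 9, 1%coqZ);
      (3, 12, 8, (-2)%coqZ); (1, 13, 10, 1%coqZ); (0, 14, 12, 1%coqZ); (2, 14, 11, 1%coqZ);
      (3, 14, 10, (-2)%coqZ); (3, 15, 12, 1%coqZ); (1, 16, 14, 1%coqZ); (3, 16, 13, (-2)%coqZ);
      (0, 17, 15, 1%coqZ); (3, 17, 14, 1%coqZ); (2, 18, 16, 1%coqZ); (1, 19, 17, 1%coqZ);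
      (3, 19, 16, 1%coqZ); (2, 20, 19, 2%coqZ); (3, 20, 18, 1%coqZ); (2, 21, 20, 1%coqZ);
      (1, 22, 21, 1%coqZ); (0, 23, 22, 1%coqZ)]%N.

(* Basis elements of the Lie algebra are numbered by 0..23 (positive roots),
   24..47 (negative roots) and 48..51 (simple coroots); a sparse vector is a
   list of pairs (index, coefficient). *)
Definition svec := seq (nat * Z).

Definition cartanZ (i j : nat) : Z := nth 0%coqZ (nth [::] F4_cartan i) j.
Definition rootc (k i : nat) : Z := nth 0%coqZ (nth [::] F4_roots k) i.
Definition rootht (k : nat) : nat := Z.to_nat (foldr Z.add 0%coqZ (nth [::] F4_roots k)).
(* <beta_k, alpha_j^vee> *)
Definition pairZ (k j : nat) : Z :=
  foldr Z.add 0%coqZ [seq Z.mul (rootc k i) (cartanZ i j) | i <- iota 0 4].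

Definition lookup (t : seq (nat * nat * nat * Z)) (j k : nat) : svec :=
  [seq (x.1.2, x.2) | x <- t & (x.1.1.1 == j) && (x.1.1.2 == k)].

Definition adEpos (j k : nat) : svec :=
  if (k < 24)%N then lookup F4_up j k
  else if (48 <= k)%N then [:: (j, Z.opp (cartanZ j (k - 48)))] else [::].
Definition adFpos (j k : nat) : svec :=
  if (k < 4)%N then (if k == j then [:: (48 + j, (-1)%coqZ)]%N else [::])
  else lookup F4_down j k.

Definition sapp (ad : nat -> svec) (s : svec) : svec :=
  flatten [seq [seq (y.1, Z.mul x.2 y.2) | y <- ad x.1] | x <- s].
Definition scoef (s : svec) (k : nat) : Z :=
  foldr (fun x c => if x.1 == k then Z.add x.2 c else c) 0%coqZ s.
Definition dense (m : nat) (s : svec) : seq Z := [seq scoef s k | k <- iota 0 m].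

Definition ef_comm (i j k : nat) : svec :=
  (if i == j then [:: (k, Z.opp (pairZ k j))] else [::]) ++ sapp (adEpos j) (adFpos i k).

(** What the induction on height needs: bracketing with e_j raises the height by one and with f_j
    lowers it; [f_i, [e_j, e_k]] computed by Jacobi agrees with the tables; and some simple coroot
    is positive on beta_k + alpha_j, whether or not this is a root. *)
Definition F4_check : bool :=
  all (fun j => all (fun k =>
    [&& has (fun i => Z.ltb 0%coqZ (Z.add (pairZ k i) (cartanZ j i))) (iota 0 4),
        all (fun x => [&& (x.1 < 24)%N, rootht x.1 == (rootht k).+1
            & all (fun i => Z.eqb (pairZ x.1 i) (Z.add (pairZ k i) (cartanZ j i))) (iota 0 4)])
          (adEpos j k),
        all (fun x => if (x.1 < 24)%N then (rootht x.1).+1 == rootht k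
             else (48 <= x.1 < 52)%N) (adFpos j k)
      & all (fun i => [&& dense 52 (ef_comm i j k) == dense 52 (sapp (adFpos i) (adEpos j k)),
           all (fun x => (x.1 < 52)%N) (ef_comm i j k)
         & all (fun x => (x.1 < 52)%N) (sapp (adFpos i) (adEpos j k))]) (iota 0 4)])
   (iota 0 24)) (iota 0 4).

Definition F4_check_parents : bool :=
  all (fun k => let: (j, p, c) := nth (0%N, 0%N, 0%coqZ) F4_parents (k - 4) in
     [&& (j < 4)%N, (p < k)%N, adEpos j p == [:: (k, c)], ~~ Z.eqb c 0
       & (rootht p).+1 == rootht k]) (iota 4 20).

Definition F4_check_simple : bool :=
  all (fun k => ((rootht k <= 1)%N ==> (k < 4)%N) && (0 < rootht k)%N) (iota 0 24) &&
  all (fun k => all (fun i => Z.eqb (pairZ k i) (cartanZ k i)) (iota 0 4)) (iota 0 4).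

Lemma F4_checkP : F4_check. Proof. by vm_compute. Qed.
Lemma F4_check_parentsP : F4_check_parents. Proof. by vm_compute. Qed.
Lemma F4_check_simpleP : F4_check_simple. Proof. by vm_compute. Qed.

Section IntegerCombinations.
Variables (F : numFieldType) (V : lmodType F).
Implicit Types (s : svec) (b : nat -> V).

Definition zF (z : Z) : F := (int_of_Z z)%:~R.

Lemma zFD x y : zF (Z.add x y) = zF x + zF y.
Proof. by rewrite /zF -[Z.add x y]/(x + y) rmorphD rmorphD. Qed.
Lemma zFM x y : zF (Z.mul x y) = zF x * zF y.
Proof. by rewrite /zF -[Z.mul x y]/(x * y) !rmorphM. Qed.
Lemma zFN x : zF (Z.opp x) = - zF x.
Proof. by rewrite /zF -[Z.opp x]/(- x) !rmorphN. Qed.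
Lemma zF0 : zF 0%coqZ = 0. Proof. by rewrite /zF rmorph0. Qed.
Lemma zF_eq0 z : (zF z == 0) = Z.eqb z 0%coqZ.
Proof.
rewrite /zF intr_eq0; apply/eqP/Z.eqb_spec => [E|-> //].
by rewrite -[z]int_of_ZK E.
Qed.

Definition lincomb b s : V := \sum_(x <- s) zF x.2 *: b x.1.

Lemma lincomb_nil b : lincomb b [::] = 0. Proof. exact: big_nil. Qed.
Lemma lincomb_cat b s s' : lincomb b (s ++ s') = lincomb b s + lincomb b s'.
Proof. exact: big_cat. Qed.
Lemma lincomb1 b k c : lincomb b [:: (k, c)] = zF c *: b k.
Proof. exact: big_seq1. Qed.

Lemma lincomb_dense m b s : all (fun x => (x.1 < m)%N) s ->
  lincomb b s = \sum_(k < m) zF (scoef s k) *: b k.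
Proof.
elim: s => [_|[k c] s IH /= /andP[lt_k /IH{IH}E]].
  by rewrite lincomb_nil big1 // => k _; rewrite zF0 scale0r.
rewrite /lincomb big_cons -/(lincomb b s) E (bigD1 (Ordinal lt_k)) //=.
rewrite [in RHS](bigD1 (Ordinal lt_k)) //= eqxx zFD scalerDl addrA; congr (_ + _).
apply: eq_bigr => i ne_ik; case: eqP => // E'.
by case/eqP: ne_ik; apply: val_inj.
Qed.

Lemma eq_lincomb m b s s' : dense m s == dense m s' ->
  all (fun x => (x.1 < m)%N) s -> all (fun x => (x.1 < m)%N) s' ->
  lincomb b s = lincomb b s'.
Proof.
move=> /eqP E ss ss'; rewrite (lincomb_dense _ ss) (lincomb_dense _ ss').
apply: eq_bigr => k _; congr (zF _ *: _).
have := congr1 (nth 0%coqZ ^~ k) E.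
by rewrite /= !(nth_map 0%N) ?size_iota // !nth_iota.
Qed.

Lemma lincomb_app (phi : {linear V -> V}) (ad : nat -> svec) b s :
  (forall x, x \in s -> phi (b x.1) = lincomb b (ad x.1)) ->
  phi (lincomb b s) = lincomb b (sapp ad s).
Proof.
elim: s => [_|[k c] s IH H]; first by rewrite !lincomb_nil linear0.
rewrite /sapp /= lincomb_cat -/(sapp ad s) -IH; last first.
  by move=> x xs; apply: H; rewrite inE xs orbT.
rewrite /lincomb big_cons -/(lincomb b s) linearD linearZ /= (H (k, c)) ?mem_head //.
congr (_ + _); rewrite /lincomb big_map scaler_sumr.
by apply: eq_bigr => y _; rewrite zFM scalerA.
Qed.

End IntegerCombinations.

Section RootVectors.
Variables (F : numFieldType) (n : nat).
Implicit Types (e f h : nat -> 'M[F]_n).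

(** Dividing by the constants of [F4_parents] normalises the root vectors as in a Chevalley basis,
    which keeps the tables integral. *)
Definition pos_roots e : seq 'M[F]_n :=
  foldl (fun s x => rcons s ((zF F x.2)^-1 *: bracket (e x.1.1) (nth 0 s x.1.2)))
    [:: e 0%N; e 1%N; e 2%N; e 3%N] F4_parents.

Definition F4_basis e f h (k : nat) : 'M[F]_n :=
  if (k < 24)%N then nth 0 (pos_roots e) k
  else if (k < 48)%N then nth 0 (pos_roots f) (k - 24) else h (k - 48)%N.

Lemma pos_roots_simple e k : (k < 4)%N -> nth 0 (pos_roots e) k = e k.
Proof. by case: k => [|[|[|[|]]]]. Qed.

Lemma pos_roots_parent e k : (4 <= k < 24)%N ->
  let: (j, p, c) := nth (0%N, 0%N, 0%coqZ) F4_parents (k - 4) in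
  nth 0 (pos_roots e) k = (zF F c)^-1 *: bracket (e j) (nth 0 (pos_roots e) p).
Proof.
case/andP=> le4 lt24; rewrite -(subnKC le4); move: lt24; rewrite -{1}(subnKC le4).
by move: (k - 4)%N => {le4}k; rewrite addKn; do 20?[case: k => [//|k]].
Qed.

Definition chevalley_relations e f h := [/\
  forall i j, (i < 4)%N -> (j < 4)%N -> bracket (e i) (f j) = if i == j then h j else 0,
  forall i j, (i < 4)%N -> (j < 4)%N -> bracket (h j) (e i) = zF F (cartanZ i j) *: e i &
  forall i j, (i < 4)%N -> (j < 4)%N -> bracket (h j) (f i) = - zF F (cartanZ i j) *: f i].

(** The Chevalley involution on generators: it transfers the tables from positive to negative
    roots. *)
Lemma chevalley_relations_opp e f h : chevalley_relations e f h ->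
  chevalley_relations f e (fun j => - h j).
Proof.
case=> ef he hf; split=> i j li lj; rewrite ?bracketNl ?he ?hf // ?scaleNr ?opprK //.
rewrite bracket_anti ef // eq_sym; case: eqP => [->//|_]; exact: oppr0.
Qed.

Section Half.
Variables e f h : nat -> 'M[F]_n.
Hypothesis rel : chevalley_relations e f h.
Let b := F4_basis e f h.

Let b_simple k : (k < 4)%N -> b k = e k.
Proof. by move=> lt_k; rewrite /b /F4_basis (leq_trans lt_k) // pos_roots_simple. Qed.

Let b_coroot j : b (48 + j) = h j.
Proof. exact: (congr1 h (addKn 48 j)). Qed.

Let wtP k := forall i, (i < 4)%N -> bracket (h i) (b k) = zF F (pairZ k i) *: b k.
Let dnP k := forall i, (i < 4)%N -> bracket (f i) (b k) = lincomb b (adFpos i k).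
Let upP k := forall j, (j < 4)%N -> bracket (e j) (b k) = lincomb b (adEpos j k).

Let chk j k : (j < 4)%N -> (k < 24)%N -> [/\
  exists2 i, (i < 4)%N & Z.ltb 0%coqZ (Z.add (pairZ k i) (cartanZ j i)),
  forall x, x \in adEpos j k -> [/\ (x.1 < 24)%N, rootht x.1 = (rootht k).+1 &
     forall i, (i < 4)%N -> pairZ x.1 i = Z.add (pairZ k i) (cartanZ j i)],
  forall x, x \in adFpos j k -> ((x.1 < 24)%N /\ (rootht x.1).+1 = rootht k) \/
     exists2 l, (l < 4)%N & x.1 = (48 + l)%N &
  forall i, (i < 4)%N -> lincomb b (ef_comm i j k) = lincomb b (sapp (adFpos i) (adEpos j k))].
Proof.
move=> lj lk; have := F4_checkP; rewrite /F4_check.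
have mi m i : (i < m)%N -> i \in iota 0 m by rewrite mem_iota.
move=> /allP/(_ j (mi 4 j lj))/allP/(_ k (mi 24 k lk))/and4P[/hasP[i0 i0P c1] /allP c2 /allP c3 /allP c4].
split.
- by exists i0 => //; move: i0P; rewrite mem_iota.
- move=> x /c2/and3P[lx /eqP hx /allP wx]; split=> // i /(mi 4)/wx.
  by move/Z.eqb_spec.
- move=> x /c3; case: ifP => [lx /eqP hx|_ /andP[l1 l2]]; first by left.
  by right; exists (x.1 - 48)%N; rewrite ?subnKC // ltn_subLR.
- by move=> i /(mi 4)/c4/and3P[E a1 a2]; exact: (eq_lincomb _ E).
Qed.

Let ef_commP i j k : (i < 4)%N -> (j < 4)%N -> (k < 24)%N -> wtP k -> dnP k ->
  (forall l, (l < 24)%N -> (rootht l).+1 = rootht k -> upP l) ->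
  bracket (f i) (bracket (e j) (b k)) = lincomb b (ef_comm i j k).
Proof.
move=> li lj lk wk dk ul; have [ef he hf] := rel.
rewrite bracket_jacobi dk // /ef_comm lincomb_cat.
congr (_ + _).
  have -> : bracket (f i) (e j) = - (if i == j then h j else 0).
    by rewrite bracket_anti ef // eq_sym; case: eqP => // ->.
  case: eqP => _; last by rewrite oppr0 lincomb_nil /bracket mul0mx mulmx0 subrr.
  by rewrite lincomb1 bracketNl wk // zFN scaleNr.
have [_ _ dkP _] := chk li lk.
apply: (lincomb_app (phi := bracket (e j))) => x /dkP[[lx hx]|[l ll ->]].
  exact: ul.
rewrite b_coroot [RHS](_ : _ = lincomb b [:: (j, Z.opp (cartanZ j l))]); last first.
  by rewrite -{2}(addKn 48 l).
by rewrite lincomb1 zFN scaleNr b_simple // -he // -bracket_anti.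
Qed.

(** The induction alternates: the f_i on height m + 1 are computed from the e_j on height m - 1, and
    then the e_j on height m from the f_i on height m + 1. *)
Let table_le m : (forall k, (k < 24)%N -> (rootht k <= m)%N -> wtP k /\ dnP k) /\
  (forall k, (k < 24)%N -> (rootht k < m)%N -> upP k).
Proof.
have [ef he hf] := rel.
elim: m => [|m [IHd IHu]].
  have pos k : (k < 24)%N -> (0 < rootht k)%N.
    move=> lk; have /andP[/allP/(_ k)] := F4_check_simpleP.
    by rewrite mem_iota lk => /(_ isT)/andP[].
  by split=> k /pos; rewrite ?ltn0 // leqn0 => /lt0n_neq0/negPf->.
have d' k : (k < 24)%N -> (rootht k <= m.+1)%N -> wtP k /\ dnP k.
  move=> lk; rewrite leq_eqVlt ltnS => /orP[/eqP hk|]; last exact: IHd.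
  case: (ltnP k 4) => [lk4|le4].
    split=> i li.
      have /andP[_ /allP/(_ k)] := F4_check_simpleP; rewrite mem_iota => /(_ lk4)/allP/(_ i).
      by rewrite mem_iota => /(_ li)/Z.eqb_spec ->; rewrite b_simple // he.
    rewrite b_simple // /adFpos lk4 bracket_anti ef //; case: eqP => _.
      by rewrite lincomb1 b_coroot -[(-1)%coqZ]/(Z.opp 1) zFN scaleNr /zF scale1r.
    by rewrite lincomb_nil oppr0.
  have := @pos_roots_parent e k; rewrite le4 lk => /(_ isT).
  have := F4_check_parentsP => /allP/(_ k); rewrite mem_iota le4 lk => /(_ isT).
  case: (nth _ F4_parents _) => [[j p] c] /and5P[lj lp /eqP upE c0 /eqP hp] Ek.
  have lp24 : (p < 24)%N := ltn_trans lp lk.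
  have {}Ek : b k = (zF F c)^-1 *: bracket (e j) (b p) by rewrite /b /F4_basis lk lp24.
  have nzc : zF F c != 0 by rewrite zF_eq0.
  have [wp dp] : wtP p /\ dnP p by apply: IHd => //; move: hk; rewrite -hp => -[->].
  have [_ upjp dnjp cE] := chk lj lp24.
  have [_ _ wk] : [/\ (k < 24)%N, rootht k = (rootht p).+1 &
      forall i, (i < 4)%N -> pairZ k i = Z.add (pairZ p i) (cartanZ j i)].
    by apply: (upjp (k, c)); rewrite upE mem_head.
  split=> i li.
    rewrite Ek linearZ /= bracket_jacobi he // wp // linearZ bracketZl /= -scalerDl.
    by rewrite scalerA mulrC -scalerA wk // zFD addrC.
  rewrite Ek linearZ /= ef_commP // => [|l ll hl].
    by rewrite cE // upE /sapp /= cats0 /lincomb big_map /= scaler_sumr;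
       apply: eq_bigr => y _; rewrite zFM scalerA mulKf.
  by apply: IHu => //; rewrite hl -ltnS hp hk.
split=> // k lk; rewrite ltnS => le_k j lj.
have [wk dk] := d' k lk (leqW le_k).
have [[i0 li0 pos] upjk dnjk cE] := chk lj lk.
set z := bracket (e j) (b k); set s := adEpos j k.
apply/eqP; rewrite -subr_eq0; apply/eqP.
(* [z - lincomb b s] is a lowest weight vector of positive weight for some sl_2. *)
have fz i : (i < 4)%N -> bracket (f i) (z - lincomb b s) = 0.
  move=> li; rewrite linearB /= ef_commP //; last first.
    by move=> l ll hl; apply: IHu => //; rewrite hl.
  rewrite cE // (lincomb_app (phi := bracket (f i)) (ad := adFpos i)) ?subrr //.
  move=> x /upjk[lx hx _].
  have [_ dx] : wtP x.1 /\ dnP x.1 by apply: d' => //; rewrite hx.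
  exact: dx.
have hz i : (i < 4)%N -> bracket (h i) (z - lincomb b s)
    = zF F (Z.add (pairZ k i) (cartanZ j i)) *: (z - lincomb b s).
  move=> li; rewrite linearB scalerBr /=; congr (_ - _).
    rewrite /z bracket_jacobi he // wk // linearZ bracketZl /= -scalerDl.
    by rewrite zFD addrC.
  rewrite /lincomb raddf_sum scaler_sumr big_seq [RHS]big_seq; apply: eq_bigr => x xs.
  have [lx hx wx] := upjk x xs.
  have [wtx _] : wtP x.1 /\ dnP x.1 by apply: d' => //; rewrite hx.
  rewrite -[LHS]/(bracket (h i) (zF F x.2 *: b x.1)) linearZ /=.
  by rewrite wtx // wx // !scalerA mulrC.
pose m' := (Z.to_nat (Z.add (pairZ k i0) (cartanZ j i0))).-1.
apply: (@sl2_lowest_eq0 F n n (bracket (e i0)) (bracket (f i0)) (bracket (h i0)) m').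
- by move=> v /=; rewrite bracket_jacobi ef // eqxx addrK.
- by move=> v /=; rewrite bracket_jacobi he // addrK bracketZl /zF; case: i0 li0 {pos m'} => [|[|[|[|]]]].
- exact: fz.
rewrite /= hz //; congr (_ *: _); rewrite /m'.
move/Z.ltb_spec0: pos; case: (Z.add _ _) => //= q _.
have q0 : (0 < Pos.to_nat q)%N by apply/ssrnat.ltP; exact: Pos2Nat.is_pos.
by rewrite prednK.
Qed.

Lemma half_table k : (k < 24)%N -> [/\ wtP k, dnP k & upP k].
Proof.
move=> lk; have [d u] := table_le (rootht k).+1.
by have [] := d k lk (leqnSn _); split=> //; apply: u.
Qed.

End Half.
End RootVectors.

(* Exchanging positive and negative roots negates the coroots. *)
Definition swapv (s : svec) : svec :=
  [seq if (x.1 < 24)%N then (24 + x.1, x.2)%N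
       else if (x.1 < 48)%N then (x.1 - 24, x.2)%N else (x.1, Z.opp x.2) | x <- s].

Definition adE (j k : nat) : svec :=
  if (k < 24)%N then adEpos j k
  else if (k < 48)%N then swapv (adFpos j (k - 24)) else adEpos j k.

Definition adF (j k : nat) : svec :=
  if (k < 24)%N then adFpos j k
  else if (k < 48)%N then swapv (adEpos j (k - 24))
  else [:: ((24 + j)%N, cartanZ j (k - 48))].

(** The last clause gives every positive root a simple coroot with nonzero pairing, from which the
    nilpotency of its root vector follows. *)
Definition F4_check_bounds : bool :=
  all (fun j => all (fun k => all (fun x => x.1 < 52)%N (adE j k)
    && all (fun x => x.1 < 52)%N (adF j k)) (iota 0 52)) (iota 0 4)
  && all (fun k => has (fun i => ~~ Z.eqb (pairZ k i) 0) (iota 0 4)) (iota 0 24).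

Lemma F4_check_boundsP : F4_check_bounds. Proof. by vm_compute. Qed.

Section F4Basis.
Variables (F : numFieldType) (n : nat).
Implicit Types e f h : nat -> 'M[F]_n.

Lemma F4_basis_coroot e f h j : F4_basis e f h (48 + j) = h j.
Proof. exact: (congr1 h (addKn 48 j)). Qed.

Lemma F4_basis_simple e f h j : (j < 4)%N -> F4_basis e f h j = e j.
Proof. by move=> lj; rewrite /F4_basis (leq_trans lj) // pos_roots_simple. Qed.

Lemma F4_basis_neg e f h h' k : (k < 24)%N -> F4_basis e f h (24 + k) = F4_basis f e h' k.
Proof.
move=> lk; rewrite /F4_basis lk ltnNge leq_addr /= addKn.
by rewrite -[48%N]/(24 + 24)%N ltn_add2l lk.
Qed.

Lemma F4_basis_parent e f h k : (4 <= k < 24)%N ->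
  let: (j, p, c) := nth (0%N, 0%N, 0%coqZ) F4_parents (k - 4) in
  [/\ (j < 4)%N, (p < k)%N &
      F4_basis e f h k = (zF F c)^-1 *: bracket (e j) (F4_basis e f h p)].
Proof.
move=> lk4; have := pos_roots_parent e lk4; case/andP: lk4 => le4 lk.
have := F4_check_parentsP => /allP/(_ k); rewrite mem_iota le4 lk => /(_ isT).
case: (nth _ F4_parents _) => [[j p] c] /and5P[lj lp _ _ _] E.
by split=> //; rewrite /F4_basis lk (ltn_trans lp lk).
Qed.

(** [I] singles out roots whose recursive construction stays inside [I]; the roots without alpha_i
    give the Levi part of a parabolic. *)
Lemma F4_basis_ind e f h (P : 'M[F]_n -> Prop) (I : pred nat) :
  (forall j, (j < 4)%N -> I j -> P (e j)) ->
  (forall j k, (j < 4)%N -> I j -> (k < 24)%N -> P (F4_basis e f h k) ->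
     P (bracket (e j) (F4_basis e f h k))) ->
  (forall a X, P X -> P (a *: X)) ->
  (forall l, (4 <= l < 24)%N -> I l ->
     let: (j, p, _) := nth (0%N, 0%N, 0%coqZ) F4_parents (l - 4) in I j && I p) ->
  forall k, (k < 24)%N -> I k -> P (F4_basis e f h k).
Proof.
move=> Pe Pb PZ closed k; elim/ltn_ind: k => k IH lk Ik.
case: (ltnP k 4) => [lk4|le4]; first by rewrite F4_basis_simple //; apply: Pe.
have hk : (4 <= k < 24)%N by rewrite le4.
have := F4_basis_parent e f h hk; have := closed k hk Ik.
case: (nth _ F4_parents _) => [[j p] c] /= /andP[Ij Ip] [lj lp ->].
by apply: PZ; apply: Pb => //; [exact: ltn_trans lk | apply: IH => //; exact: ltn_trans lk].
Qed.

Lemma lincomb_swapv e f h s :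
  lincomb (F4_basis f e (fun j => - h j)) s = lincomb (F4_basis e f h) (swapv s).
Proof.
rewrite /lincomb big_map; apply: eq_bigr => -[k c] _ /=.
case: ltnP => [lk|le24] /=; first by rewrite (F4_basis_neg _ _ _ (fun j => - h j)).
case: ltnP => [lk|le48] /=.
  have lk2 : (k - 24 < 24)%N by rewrite ltn_subLR.
  by congr (_ *: _); rewrite /F4_basis lk2 lk ltnNge le24.
by rewrite -(subnKC le48) !F4_basis_coroot zFN scaleNr scalerN.
Qed.

Lemma split52 k : (k < 52)%N -> [\/ (k < 24)%N, exists2 l, (l < 24)%N & k = (24 + l)%N
  | exists2 l, (l < 4)%N & k = (48 + l)%N].
Proof.
move=> lk; case: (ltnP k 24) => [l1|l1]; first by constructor 1.
case: (ltnP k 48) => [l2|l2].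
  by constructor 2; exists (k - 24)%N; rewrite ?subnKC // ltn_subLR.
by constructor 3; exists (k - 48)%N; rewrite ?subnKC // ltn_subLR.
Qed.

Lemma F4_basis_closed e f h (P : 'M[F]_n -> Prop) :
  (forall X Y, P X -> P Y -> P (bracket X Y)) -> (forall a X, P X -> P (a *: X)) ->
  (forall j, (j < 4)%N -> [/\ P (e j), P (f j) & P (h j)]) ->
  forall k, (k < 52)%N -> P (F4_basis e f h k).
Proof.
move=> Pb PZ Pef k /split52[lk|[l ll ->]|[l ll ->]].
- apply: (F4_basis_ind (I := xpredT)) => // [j /Pef[]//|j k' lj _ _ Pk'|l' _ _].
  + by apply: Pb => //; have [] := Pef j lj.
  + by case: (nth _ _ _) => [[]].
- rewrite (F4_basis_neg _ _ _ h) //.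
  apply: (F4_basis_ind (I := xpredT)) => // [j /Pef[]//|j k' lj _ _ Pk'|l' _ _].
  + by apply: Pb => //; have [] := Pef j lj.
  + by case: (nth _ _ _) => [[]].
by rewrite F4_basis_coroot; have [] := Pef l ll.
Qed.

End F4Basis.

Section F4Algebra.
Variables (F : numFieldType) (n : nat) (e f h : nat -> 'M[F]_n).
Hypothesis rel : chevalley_relations e f h.
Let b := F4_basis e f h.
Let b' := F4_basis f e (fun j => - h j).

Let negE k : (k < 24)%N -> b (24 + k) = b' k.
Proof. exact: F4_basis_neg. Qed.

Lemma F4_tableE j k : (j < 4)%N -> (k < 52)%N -> bracket (e j) (b k) = lincomb b (adE j k).
Proof.
move=> lj /split52[lk|[l ll ->]|[l ll ->]].
- by have [_ _ ->] := half_table rel lk; rewrite // /adE lk.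
- have [_ + _] := half_table (chevalley_relations_opp rel) ll.
  move=> /(_ j lj); rewrite -/b' -negE // => ->; rewrite lincomb_swapv.
  by rewrite /adE ltnNge leq_addr /= -[48%N]/(24 + 24)%N ltn_add2l ll addKn.
- rewrite /b F4_basis_coroot bracket_anti.
  have [_ he _] := rel; rewrite he //.
  have -> : adE j (48 + l) = [:: (j, Z.opp (cartanZ j l))].
    by rewrite -[in RHS](addKn 48 l).
  by rewrite lincomb1 zFN scaleNr F4_basis_simple.
Qed.

Lemma F4_tableF j k : (j < 4)%N -> (k < 52)%N -> bracket (f j) (b k) = lincomb b (adF j k).
Proof.
move=> lj /split52[lk|[l ll ->]|[l ll ->]].
- by have [_ H _] := half_table rel lk; rewrite H // /adF lk.
- have [_ _ +] := half_table (chevalley_relations_opp rel) ll.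
  move=> /(_ j lj); rewrite -/b' -negE // => ->; rewrite lincomb_swapv.
  by rewrite /adF ltnNge leq_addr /= -[48%N]/(24 + 24)%N ltn_add2l ll addKn.
- rewrite /b F4_basis_coroot bracket_anti.
  have [_ _ hf] := rel; rewrite hf //.
  have -> : adF j (48 + l) = [:: ((24 + j)%N, cartanZ j l)].
    by rewrite -[in RHS](addKn 48 l).
  by rewrite lincomb1 scaleNr opprK -/b negE ?(leq_trans lj) // /b' F4_basis_simple.
Qed.

Definition F4_space : {vspace 'M[F]_n} := <<[seq b k | k <- iota 0 52]>>%VS.

Lemma F4_basis_mem k : (k < 52)%N -> b k \in F4_space.
Proof. by move=> lk; apply/memv_span/map_f; rewrite mem_iota. Qed.

Lemma lincomb_mem s : all (fun x => x.1 < 52)%N s -> lincomb b s \in F4_space.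
Proof.
move=> /allP ss; rewrite /lincomb big_seq; apply: memv_suml => x xs.
by apply/memvZ/F4_basis_mem/ss.
Qed.

Lemma F4_spaceP X : X \in F4_space -> exists c : nat -> F, X = \sum_(k < 52) c k *: b k.
Proof.
move=> XU; pose s := [tuple of [seq b k | k <- iota 0 52]].
have XS : X \in <<s>>%VS by [].
exists (fun k => if insub k is Some i then coord s i X else 0).
rewrite {1}(coord_span XS); apply: eq_bigr => i _; rewrite valK; congr (_ *: _).
by rewrite (nth_map 0%N) ?size_iota // nth_iota // add0n.
Qed.

Lemma F4_table_bounds j k : (j < 4)%N -> (k < 52)%N ->
  all (fun x => x.1 < 52)%N (adE j k) /\ all (fun x => x.1 < 52)%N (adF j k).
Proof.
move=> lj lk; have /andP[/allP/(_ j) H _] := F4_check_boundsP.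
move: H; rewrite mem_iota => /(_ lj)/allP/(_ k); rewrite mem_iota => /(_ lk).
by move/andP.
Qed.

(** The tables show that e_j and f_j normalise the span. By Jacobi the normaliser is closed under
    brackets, so it contains every basis element. *)
Lemma F4_space_bracket X Y : X \in F4_space -> Y \in F4_space -> bracket X Y \in F4_space.
Proof.
pose N X := forall Y, Y \in F4_space -> bracket X Y \in F4_space.
have NP Z : (forall k, (k < 52)%N -> bracket Z (b k) \in F4_space) -> N Z.
  move=> H W /F4_spaceP[c ->]; rewrite linear_sum; apply: memv_suml => k _.
  by rewrite linearZ; apply/memvZ/H.
have Nb Z W : N Z -> N W -> N (bracket Z W).
  move=> NZ NW V VU.
  have -> : bracket (bracket Z W) V = bracket Z (bracket W V) - bracket W (bracket Z V).
    by rewrite (bracket_jacobi Z W V) addrK.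
  by apply: memvB; [apply/NZ/NW | apply/NW/NZ].
have NZ a Z : N Z -> N (a *: Z).
  by move=> NZ V VU; rewrite bracketZl; apply/memvZ/NZ.
have Nef j : (j < 4)%N -> [/\ N (e j), N (f j) & N (h j)].
  move=> lj.
  have Ne : N (e j).
    by apply: NP => k lk; rewrite F4_tableE //; apply: lincomb_mem; have [] := F4_table_bounds lj lk.
  have Nf : N (f j).
    by apply: NP => k lk; rewrite F4_tableF //; apply: lincomb_mem; have [] := F4_table_bounds lj lk.
  have [ef _ _] := rel; split=> //.
  by have := Nb _ _ Ne Nf; rewrite ef // eqxx.
have Nall k : (k < 52)%N -> N (b k) by apply: F4_basis_closed.
move=> /F4_spaceP[c ->] YU; rewrite bracket_anti linear_sum -sumrN; apply: memv_suml => k _.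
by rewrite linearZ -scalerN -bracket_anti; apply/memvZ/Nall.
Qed.

Lemma F4_root_nilpotent k : (k < 24)%N -> exists2 N, (1 < N)%N & mxpow (b k) N = 0.
Proof.
move=> lk; have /andP[_ /allP/(_ k)] := F4_check_boundsP.
rewrite mem_iota => /(_ lk)/hasP[j]; rewrite mem_iota => li nz.
have [wk _ _] := half_table rel lk.
by apply: (bracket_eigen_nilpotent _ (wk j li)); rewrite zF_eq0.
Qed.

End F4Algebra.

(** * Weights and coroots *)

Lemma int_of_ZD x y : int_of_Z (Z.add x y) = int_of_Z x + int_of_Z y.
Proof. exact: (rmorphD int_of_Z). Qed.
Lemma int_of_ZN x : int_of_Z (Z.opp x) = - int_of_Z x.
Proof. exact: (rmorphN int_of_Z). Qed.

Section Weights.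
Variables (F : numFieldType) (n : nat) (T : set 'M[F]_n).
Hypothesis uT : T `<=` [set X | X \in unitmx].
Implicit Types (X Y : 'M[F]_n) (chi : 'M[F]_n -> F).

Lemma weight_vectorB chi X Y :
  weight_vector T chi X -> weight_vector T chi Y -> weight_vector T chi (X - Y).
Proof.
by move=> wX wY t Tt; rewrite mulmxBr mulmxBl wX // wY // scalerBr.
Qed.

Lemma weight_vectorZ chi a X : weight_vector T chi X -> weight_vector T chi (a *: X).
Proof.
by move=> wX t Tt; rewrite -scalemxAr -scalemxAl wX // !scalerA mulrC.
Qed.

Lemma weight_vector_sum chi (I : Type) (r : seq I) (P : pred I) (y : I -> 'M[F]_n) :
  (forall i, P i -> weight_vector T chi (y i)) ->
  weight_vector T chi (\sum_(i <- r | P i) y i).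
Proof.
move=> wy t Tt; rewrite mulmx_sumr mulmx_suml scaler_sumr.
by apply: eq_bigr => i Pi; rewrite wy.
Qed.

Lemma weight_vector_bracket chi psi X Y : weight_vector T chi X -> weight_vector T psi Y ->
  weight_vector T (fun t => chi t * psi t) (bracket X Y).
Proof.
move=> wX wY t Tt; have ut : t \in unitmx := uT Tt.
have conjM (Z W : 'M[F]_n) : t *m (Z *m W) *m invmx t = (t *m Z *m invmx t) *m (t *m W *m invmx t).
  by rewrite !mulmxA mulmxKV.
rewrite /bracket mulmxBr mulmxBl !conjM wX // wY // -!scalemxAl -!scalemxAr !scalerA.
by rewrite [psi t * _]mulrC scalerBr.
Qed.

(** As for the independence of characters: with t separating [psi i] from [chi], comparing the two
    expressions for the conjugate by t eliminates the i-th term. The [psi i] may coincide with one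
    another. *)
Lemma weight_sum_eq0 chi (I : eqType) (r : seq I) (psi : I -> 'M[F]_n -> F) (y : I -> 'M[F]_n) :
  (forall i, i \in r -> weight_vector T (psi i) (y i)) ->
  (forall i, i \in r -> exists2 t, T t & psi i t != chi t) ->
  weight_vector T chi (\sum_(i <- r) y i) -> \sum_(i <- r) y i = 0.
Proof.
elim: r y => [|i r IH] y wy sep wS; first by rewrite big_nil.
have [t Tt ne] := sep i (mem_head _ _).
have E : (chi t - psi i t) *: (\sum_(j <- i :: r) y j) = \sum_(j <- r) (psi j t - psi i t) *: y j.
  rewrite scalerBl -wS // mulmx_sumr mulmx_suml scaler_sumr -sumrB big_cons.
  rewrite wy ?mem_head // subrr add0r big_seq [RHS]big_seq; apply: eq_bigr => j jr.
  by rewrite wy ?inE ?jr ?orbT // scalerBl.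
have : \sum_(j <- r) (psi j t - psi i t) *: y j = 0.
  apply: IH => [j jr|j jr|]; last by rewrite -E; apply: weight_vectorZ.
    by apply/weight_vectorZ/wy; rewrite inE jr orbT.
  by apply: sep; rewrite inE jr orbT.
rewrite -E => /eqP; rewrite scaler_eq0 subr_eq0 eq_sym (negbTE ne) => /eqP.
exact.
Qed.

Lemma weight_component chi (m : nat) (psi : nat -> 'M[F]_n -> F) (y : nat -> 'M[F]_n) (P : pred nat) :
  (forall k, (k < m)%N -> weight_vector T (psi k) (y k)) ->
  (forall k, (k < m)%N -> P k -> psi k = chi) ->
  (forall k, (k < m)%N -> ~~ P k -> exists2 t, T t & psi k t != chi t) ->
  weight_vector T chi (\sum_(k < m) y k) ->
  \sum_(k < m) y k = \sum_(k < m | P k) y k.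
Proof.
move=> wy eqP neP wS; rewrite [LHS](bigID (fun k : 'I_m => P k)) /=.
rewrite -[X in _ + X]big_filter.
rewrite (weight_sum_eq0 (chi := chi) (psi := fun k : 'I_m => psi k)) ?addr0 //.
- by move=> k _; apply: wy.
- by move=> k; rewrite mem_filter => /andP[nP _]; apply: neP.
rewrite big_filter (_ : \sum_(k < m | ~~ P k) y k = \sum_(k < m) y k - \sum_(k < m | P k) y k).
  apply: weight_vectorB => //; apply: weight_vector_sum => k Pk.
  by rewrite -(eqP k) //; apply: wy.
by rewrite [X in _ = X - _](bigID (fun k : 'I_m => P k)) /= addrAC subrr add0r.
Qed.

End Weights.

(* The weight of the k-th basis element is the product of the a_i ^ F4_weight k i. *)
Definition F4_weight (k : nat) (i : nat) : Z :=
  if (k < 24)%N then rootc k i else if (k < 48)%N then Z.opp (rootc (k - 24) i) else 0%coqZ.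

Definition F4_weights_check : bool :=
  [&& all (fun k => let: (j, p, _) := nth (0%N, 0%N, 0%coqZ) F4_parents (k - 4) in
     all (fun i => Z.eqb (rootc k i) (Z.add (rootc p i) (if i == j then 1 else 0)%coqZ)) (iota 0 4))
       (iota 4 20),
   all (fun k => all (fun i => Z.eqb (rootc k i) (if i == k then 1 else 0)%coqZ) (iota 0 4)) (iota 0 4)
   & all (fun k => all (fun l => (k == l) || has (fun i => ~~ Z.eqb (F4_weight k i) (F4_weight l i)) (iota 0 4))
       (iota 0 52)) (iota 0 48)].

Lemma F4_weights_checkP : F4_weights_check. Proof. by vm_compute. Qed.

Section F4Weights.
Variables (F : numFieldType) (n : nat) (T : set 'M[F]_n).
Hypothesis uT : T `<=` [set X | X \in unitmx].
Variables (e f h : nat -> 'M[F]_n).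

Definition weight_fun (a : nat -> 'M[F]_n -> F) (c : nat -> Z) (t : 'M[F]_n) : F :=
  \prod_(i < 4) a i t ^ int_of_Z (c i).

Lemma pos_root_weight (e' f' h' : nat -> 'M[F]_n) (a : nat -> 'M[F]_n -> F) k :
  (forall j t, (j < 4)%N -> T t -> a j t != 0) ->
  (forall j, (j < 4)%N -> weight_vector T (a j) (e' j)) ->
  (k < 24)%N -> weight_vector T (weight_fun a (rootc k)) (F4_basis e' f' h' k).
Proof.
move=> a0 we; have /and3P[/allP c1 /allP c2 _] := F4_weights_checkP.
have simple j t : (j < 4)%N -> T t -> \prod_(i < 4) a i t ^ int_of_Z (if i == j :> nat then 1 else 0)%coqZ = a j t.
  move=> lj Tt; rewrite (bigD1 (Ordinal lj)) //= eqxx expr1z big1 ?mulr1 // => i.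
  by rewrite -val_eqE /= => /negPf->; rewrite expr0z.
elim/ltn_ind: k => k IH lk; case: (ltnP k 4) => [lk4|le4].
  rewrite F4_basis_simple // => t Tt; rewrite we //; congr (_ *: _).
  rewrite -(simple k t) //; apply: eq_bigr => i _; congr (_ ^ int_of_Z _).
  by have := c2 k; rewrite mem_iota => /(_ lk4)/allP/(_ i); rewrite mem_iota ltn_ord => /(_ isT)/Z.eqb_spec.
have hk : (4 <= k < 24)%N by rewrite le4.
have := F4_basis_parent e' f' h' hk; have := c1 k; rewrite mem_iota => /(_ hk).
case: (nth _ F4_parents _) => [[j p] c] /allP wk [lj lp ->].
have wb := weight_vector_bracket uT (we j lj) (IH p lp (ltn_trans lp lk)).
apply: weight_vectorZ => t Tt; rewrite wb //; congr (_ *: _).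
rewrite /weight_fun -[X in X * _](simple j t) // -big_split; apply: eq_bigr => i _ /=.
have wki := wk i; rewrite mem_iota ltn_ord in wki.
have {wki}/Z.eqb_spec -> := wki isT.
rewrite -expfzDr ?a0 //; congr (_ ^ _).
by rewrite int_of_ZD addrC.
Qed.

Variable a : nat -> 'M[F]_n -> F.
Hypothesis a0 : forall j t, (j < 4)%N -> T t -> a j t != 0.
Hypothesis we : forall j, (j < 4)%N -> weight_vector T (a j) (e j).
Hypothesis wf : forall j, (j < 4)%N -> weight_vector T (fun t => (a j t)^-1) (f j).
Hypothesis wh : forall j t, (j < 4)%N -> T t -> t *m h j *m invmx t = h j.

Lemma F4_basis_weight k : (k < 52)%N ->
  weight_vector T (weight_fun a (F4_weight k)) (F4_basis e f h k).
Proof.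
move=> /split52[lk|[l ll ->]|[l ll ->]].
- rewrite (_ : F4_weight k = rootc k); first exact: pos_root_weight.
  by apply/funext => i; rewrite /F4_weight lk.
- rewrite (F4_basis_neg _ _ _ h) // => t Tt.
  rewrite (@pos_root_weight f e h (fun j t => (a j t)^-1)) //; last first.
    by move=> j t' lj Tt'; rewrite invr_eq0 a0.
  congr (_ *: _); apply: eq_bigr => i _.
  rewrite /F4_weight ltnNge leq_addr /= -[48%N]/(24 + 24)%N ltn_add2l ll addKn.
  by rewrite int_of_ZN exprz_inv.
- rewrite F4_basis_coroot => t Tt; rewrite wh // [weight_fun _ _ _]big1 ?scale1r //.
Qed.

Hypothesis a_free : forall c : nat -> Z, (forall t, T t -> weight_fun a c t = 1) ->
  forall i, (i < 4)%N -> c i = 0%coqZ.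

Lemma weight_fun_sep (c d : nat -> Z) i : (i < 4)%N -> c i != d i ->
  exists2 t, T t & weight_fun a c t != weight_fun a d t.
Proof.
move=> li ne; apply: contrapT => no; case/eqP: ne.
suff : Z.add (c i) (Z.opp (d i)) = 0%coqZ by lia.
apply: (a_free (c := fun i => Z.add (c i) (Z.opp (d i)))) => // t Tt.
have E : weight_fun a c t = weight_fun a d t.
  by apply/eqP/negPn/negP => H; apply: no; exists t.
have nz : weight_fun a d t != 0.
  by apply/prodf_neq0 => j _; rewrite expfz_neq0 // a0.
apply: (mulIf nz); rewrite mul1r -[RHS]E -big_split; apply: eq_bigr => j _ /=.
rewrite -expfzDr ?a0 //; congr (_ ^ _).
by rewrite int_of_ZD int_of_ZN subrK.
Qed.

(** Distinct exponents give distinct characters because the simple roots are independent. The bound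
    48 excludes the zero weight, shared by the four coroots. *)
Lemma F4_root_space k0 X : (k0 < 48)%N -> X \in F4_space e f h ->
  weight_vector T (weight_fun a (F4_weight k0)) X ->
  exists x, X = x *: F4_basis e f h k0.
Proof.
move=> lk /F4_spaceP[x ->] wX; exists (x k0).
have lk52 : (k0 < 52)%N by apply: ltn_trans lk _.
rewrite [LHS](weight_component (y := fun k => x k *: F4_basis e f h k)
  (psi := fun k => weight_fun a (F4_weight k)) (P := pred1 k0) _ _ _ wX).
- by rewrite (big_pred1 (Ordinal lk52)).
- by move=> k lk'; apply/weight_vectorZ/F4_basis_weight.
- by move=> k _ /eqP->.
- move=> k lk' /= ne; have /and3P[_ _ /allP/(_ k0)] := F4_weights_checkP.
  rewrite mem_iota => /(_ lk)/allP/(_ k); rewrite mem_iota => /(_ lk').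
  rewrite eq_sym (negbTE ne) => /hasP[j]; rewrite mem_iota => li nw.
  apply: (weight_fun_sep (i := j)) => //; apply: contra nw => /eqP->.
  exact/Z.eqb_refl.
Qed.

Lemma F4_cartan_space X : X \in F4_space e f h ->
  (forall t, T t -> t *m X *m invmx t = X) ->
  exists d : nat -> F, X = \sum_(k < 4) d k *: h k.
Proof.
move=> /F4_spaceP[x ->] wX; exists (fun k => x (48 + k)%N).
pose zero_weight : 'M[F]_n -> F := weight_fun a (F4_weight 48).
have wX' : weight_vector T zero_weight (\sum_(k < 52) x k *: F4_basis e f h k).
  move=> t Tt; rewrite wX // [zero_weight t]big1 ?scale1r // => i _.
rewrite [LHS](weight_component (y := fun k => x k *: F4_basis e f h k)
  (psi := fun k => weight_fun a (F4_weight k)) (P := fun k => 48 <= k)%N _ _ _ wX').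
- rewrite [LHS](_ : _ = \sum_(k < 48 + 4 | (48 <= k)%N) x k *: F4_basis e f h k) //.
  rewrite big_split_ord /= big_pred0 ?add0r; last by move=> k; rewrite leqNgt ltn_ord.
  by apply: eq_big => k; [rewrite leq_addr | rewrite F4_basis_coroot].
- by move=> k lk'; apply/weight_vectorZ/F4_basis_weight.
- move=> k _ le48; rewrite /zero_weight; congr weight_fun; apply/funext => i.
  by rewrite /F4_weight (ltnNge k 48) le48 (ltnNge k 24) (leq_trans _ le48).
- move=> k lk' /=; rewrite -ltnNge => lk.
  have /and3P[_ _ /allP/(_ k)] := F4_weights_checkP.
  rewrite mem_iota => /(_ lk)/allP/(_ 48%N); rewrite mem_iota => /(_ isT).
  rewrite (ltn_eqF lk) orFb => /hasP[j]; rewrite mem_iota => li nw.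
  apply: (weight_fun_sep (i := j)) => //; apply: contra nw => /eqP->.
Qed.

End F4Weights.

(** * Derivatives of cocharacters *)

Section Cocharacters.
Variables (F : numFieldType) (n : nat).
Local Notation N := (n * n)%N.
Local Notation A := {mpoly F[N]}.
Implicit Types (p q r : A) (X Y D : 'M[F]_n) (T : set 'M[F]_n).

Lemma diffat_var k X Y : diffat 'X_k X Y = mxvec Y 0 k.
Proof.
rewrite /diffat (bigD1 k) //= mderivX mnm1E eqxx scale1r.
rewrite -{1}(add0m U_(k)%MM) addmK mpolyX0 mx_eval1 mul1r big1 ?addr0 // => i ne_ik.
by rewrite mderivX mnm1E eq_sym (negbTE ne_ik) scale0r mx_eval0 mul0r.
Qed.

Lemma diffat_const a X Y : diffat a%:MP X Y = 0.
Proof. by rewrite /diffat big1 // => i _; rewrite mderivC mx_eval0 mul0r. Qed.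

Lemma diffatDp p q X Y : diffat (p + q) X Y = diffat p X Y + diffat q X Y.
Proof. by rewrite -big_split; apply: eq_bigr => i _; rewrite mderivD mx_evalD mulrDl. Qed.

Lemma diffatBp p q X Y : diffat (p - q) X Y = diffat p X Y - diffat q X Y.
Proof. by rewrite -sumrB; apply: eq_bigr => i _; rewrite mderivB mx_evalB mulrBl. Qed.

(* [D] is the derivative of the cocharacter [lam] at 1; regular functions
   along [lam] are Laurent polynomials P(s) / s^d. *)
Definition cochar_derivative (lam : F -> 'M[F]_n) D := forall p, exists (d : nat) (P : {poly F}),
  [/\ forall s, s != 0 -> mx_eval p (lam s) = P.[s] / s ^+ d,
      P.[1] = mx_eval p 1%:M & P^`().[1] - d%:R * P.[1] = diffat p 1%:M D].

Lemma cochar_derivative_exists T lam : T `<=` [set X | X \in unitmx] -> cocharacter T lam ->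
  exists D, cochar_derivative lam D.
Proof.
move=> uT [[k [M lamE]] lamT lamM].
have lam1 : lam 1 = 1%:M.
  have u1 : lam 1 \in unitmx by apply/uT/lamT/oner_neq0.
  rewrite -[LHS](mulKmx u1) -lamM ?oner_neq0 // mul1r mulVmx //.
pose D := \matrix_(i, j) ((M i j)^`().[1] - k%:R * (M i j).[1]).
have vE s i : s != 0 -> mxvec (lam s) 0 i = (mxvec M 0 i).[s] / s ^+ k.
  by move=> s0; rewrite lamE //; case/mxvec_indexP: i => i j; rewrite !mxvecE mxE.
exists D; elim/mpoly_ring_ind => [a|i|p q [d [P [PE P1 Pd]]] [d' [Q [QE Q1 Qd]]]|
    p q [d [P [PE P1 Pd]]] [d' [Q [QE Q1 Qd]]]].
- exists 0%N, a%:P; split=> [s s0||].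
  + by rewrite mx_evalC hornerC expr0 divr1.
  + by rewrite mx_evalC hornerC.
  + by rewrite diffat_const derivC horner0 mul0r subrr.
- exists k, (mxvec M 0 i); split=> [s s0||].
  + by rewrite mx_evalX vE.
  + by rewrite mx_evalX -lam1 vE ?oner_neq0 // expr1n divr1.
  + by rewrite diffat_var; case/mxvec_indexP: i => i j; rewrite !mxvecE mxE.
- exists (d + d')%N, (P * 'X^d' + Q * 'X^d); split=> [s s0||].
  + rewrite mx_evalD PE // QE // hornerD !hornerM !hornerXn exprD.
    by rewrite mulrDl !invfM !mulrA mulfK ?expf_neq0 // [_ / s ^+ d / _]mulrAC mulfK ?expf_neq0.
  + by rewrite mx_evalD -P1 -Q1 hornerD !hornerM !hornerXn !expr1n !mulr1.
  + rewrite diffatDp -Pd -Qd derivD !derivM !derivXn !hornerD !hornerM !hornerMn !hornerXn.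
    by rewrite !expr1n !mulr1 natrD; ring.
- exists (d + d')%N, (P * Q); split=> [s s0||].
  + by rewrite mx_evalM PE // QE // hornerM exprD invfM mulrACA.
  + by rewrite mx_evalM -P1 -Q1 hornerM.
  + by rewrite diffatM -Pd -Qd -P1 -Q1 derivM hornerD !hornerM natrD; ring.
Qed.

Lemma cochar_derivative_weight lam D q r (m : int) : cochar_derivative lam D ->
  (forall s, s != 0 -> mx_eval q (lam s) = s ^ m * mx_eval r (lam s)) ->
  diffat q 1%:M D = m%:~R * mx_eval r 1%:M + diffat r 1%:M D.
Proof.
move=> jet qr; have [dq [P [PE P1 Pd]]] := jet q; have [dr [R [RE R1 Rd]]] := jet r.
have main (a b : nat) : b%:Z = a%:Z + m + dq%:Z - dr%:Z -> diffat q 1%:M D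
    = m%:~R * mx_eval r 1%:M + diffat r 1%:M D.
  move=> bE.
  have E : P * 'X^a = R * 'X^b.
    apply/eqP; rewrite -subr_eq0; apply/eqP; apply: (poly_cofin_eq0 (q := 'X)).
      by rewrite polyX_eq0.
    move=> s; rewrite hornerX => s0.
    have := qr s s0; rewrite PE // RE // => H.
    rewrite hornerD hornerN !hornerM !hornerXn.
    have -> : P.[s] = s ^ m * (R.[s] / s ^+ dr) * s ^+ dq by rewrite -H divfK // expf_neq0.
    rewrite !exprnN !exprnP bE !expfzDr //.
    move: (s ^ m) (s ^ (- dr%:Z)) (s ^ dq) (s ^ a) => u v w x; ring.
  have E1 := congr1 (horner^~ 1) E; rewrite !hornerM !hornerXn !expr1n !mulr1 in E1.
  have := congr1 (fun u : {poly F} => u^`().[1]) E; rewrite !derivM !derivXn !hornerD !hornerM.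
  rewrite !hornerMn !hornerXn !expr1n !mulr1 => Ed.
  rewrite -Pd -Rd -R1 E1.
  have -> : P^`().[1] = R^`().[1] + R.[1] * b%:R - R.[1] * a%:R.
    by rewrite -Ed E1 addrK.
  have -> : (b%:R : F) = a%:R + m%:~R + dq%:R - dr%:R.
    by have := congr1 (fun z : int => z%:~R : F) bE; rewrite !(rmorphD, rmorphN).
  ring.
(* Natural exponents with b - a = m + dq - dr, whatever the sign of m. *)
apply: (main (absz m + dr)%N (absz ((absz m)%:Z + m)%R + dq)%N); lia.
Qed.

End Cocharacters.

Section Torus.
Variables (F : numFieldType) (n : nat).
Implicit Types (X Y : 'M[F]_n) (T : set 'M[F]_n).

Lemma torus_comm T s t : is_torus T -> T s -> T t -> s *m t = t *m s.
Proof.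
case=> _ [Q uQ QT] Ts Tt.
have /diag_mxP[ds Es] := QT s Ts; have /diag_mxP[dt Et] := QT t Tt.
have QM u v : Q *m (u *m v) *m invmx Q = (Q *m u *m invmx Q) *m (Q *m v *m invmx Q).
  by rewrite !mulmxA mulmxKV.
have Q_inj u v : Q *m u *m invmx Q = Q *m v *m invmx Q -> u = v.
  by move/(congr1 (fun M => invmx Q *m M *m Q)); rewrite !mulmxA mulVmx // !mul1mx !mulmxKV.
by apply: Q_inj; rewrite !QM Es Et diag_mxC.
Qed.

Lemma diffat_coord_inj X Y : (forall k, diffat 'X_k 1%:M X = diffat 'X_k 1%:M Y) -> X = Y.
Proof.
by move=> E; apply: (can_inj mxvecK); apply/rowP => k; rewrite -!(diffat_var k 1%:M).
Qed.

(** A torus is commutative, so the coordinates of t s - s t are linear functions of s vanishing on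
    T; their differentials vanish on [lie T]. *)
Lemma torus_lie_fixed T X t : is_torus T -> lie T X -> T t -> t *m X *m invmx t = X.
Proof.
move=> torT lX Tt; have [[[uT _ _ _] _] _] := torT.1.
have ut : t \in unitmx := uT _ Tt.
suff -> : t *m X = X *m t by rewrite mulmxK.
apply: diffat_coord_inj => k.
have E (L R : 'M[F]_n) : diffat (sandwich L R 0 'X_k) 1%:M X = mxvec (L *m X *m R) 0 k.
  by rewrite diffat_sandwich diffat_var.
rewrite !(diffat_var k 1%:M); apply/eqP; rewrite -subr_eq0; apply/eqP.
have /lieP/(_ (sandwich t 1%:M 0 'X_k - sandwich 1%:M t 0 'X_k)) := lX.
have -> : diffat (sandwich t 1%:M 0 'X_k - sandwich 1%:M t 0 'X_k) 1%:M X
    = mxvec (t *m X) 0 k - mxvec (X *m t) 0 k.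
  have /= Et := E t 1%:M; have /= E1 := E 1%:M t.
  rewrite mulmx1 in Et; rewrite mul1mx in E1.
  by rewrite -Et -E1; exact: diffatBp.
apply=> s Ts.
have M (L R : 'M[F]_n) : mx_eval (sandwich L R 0 'X_k) s = mxvec (L *m s *m R) 0 k.
  by rewrite mx_eval_sandwich mx_evalX addr0.
have /= Mt := M t 1%:M; have /= M1 := M 1%:M t.
rewrite mulmx1 in Mt; rewrite mul1mx in M1.
rewrite mx_evalB.
apply/eqP; rewrite subr_eq0; apply/eqP; rewrite (torus_comm torT Ts Tt) in M1.
exact: etrans Mt (esym M1).
Qed.

Lemma cochar_derivative_lie T lam D :
  (forall s, s != 0 -> T (lam s)) -> cochar_derivative lam D -> lie T D.
Proof.
move=> lamT jet; apply/lieP => p p0.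
rewrite (cochar_derivative_weight (r := 0%:MP) (m := 0) jet) ?mul0r ?add0r ?diffat_const //.
by move=> s s0; rewrite mx_evalC mulr0 p0 //; apply: lamT.
Qed.

Lemma cochar_derivative_bracket lam D X (m : int) : cochar_derivative lam D ->
  (forall s, s != 0 -> lam s *m X = s ^ m *: (X *m lam s)) ->
  bracket D X = m%:~R *: X.
Proof.
move=> jet wX; apply/eqP; rewrite subr_eq; apply/eqP.
apply: (can_inj mxvecK); apply/rowP => k.
have dE (L R : 'M[F]_n) : diffat (sandwich L R 0 'X_k) 1%:M D = mxvec (L *m D *m R) 0 k.
  by rewrite diffat_sandwich diffat_var.
have vE (L R s : 'M[F]_n) : mx_eval (sandwich L R 0 'X_k) s = mxvec (L *m s *m R) 0 k.
  by rewrite mx_eval_sandwich mx_evalX addr0.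
have E := cochar_derivative_weight (q := sandwich 1%:M X 0 'X_k)
  (r := sandwich X 1%:M 0 'X_k) (m := m) jet.
have {E} : mxvec (1%:M *m D *m X) 0 k
    = m%:~R * mxvec (X *m 1%:M *m 1%:M) 0 k + mxvec (X *m D *m 1%:M) 0 k.
  apply: etrans (esym (dE _ _)) (etrans (E _) (congr2 _ (congr1 _ (vE _ _ _)) (dE _ _))).
  move=> s s0.
  apply: etrans (vE 1%:M X _) _; apply: etrans (esym (congr1 _ (vE X 1%:M _))).
  by rewrite mul1mx mulmx1 wX // linearZ mxE.
by rewrite mul1mx !mulmx1 => ->; rewrite linearD linearZ !mxE.
Qed.

End Torus.

Lemma cartan_F4E i j : (i < 4)%N -> (j < 4)%N ->
  cartan_F4 (inord i) (inord j) = int_of_Z (cartanZ i j).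
Proof.
move=> li lj; rewrite /cartan_F4 !inordK //.
by case: i li => [|[|[|[|]]]] // _; case: j lj => [|[|[|[|]]]].
Qed.

(* Positions in [F4_roots] of the positive roots of B_4, i.e. those with an even
   coefficient at alpha_4, and of its simple roots. *)
Definition B4_positive : seq nat :=
  [:: 0; 1; 2; 4; 5; 7; 8; 10; 13; 15; 17; 19; 20; 21; 22; 23]%N.
Definition B4_simple : seq nat := [:: 15; 0; 1; 2]%N.

Definition B4_positive_check : bool :=
  all (fun k => (k \in B4_simple) || ((4 <= k < 24)%N &&
     let: (j, p, _) := nth (0%N, 0%N, 0%coqZ) F4_parents (k - 4) in
     (j < 3)%N && (p \in B4_positive))) B4_positive.

Lemma B4_positive_checkP : B4_positive_check. Proof. by []. Qed.

(** * Root spaces of [lie G], coroots, and the positive part of B_4 *)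

Section Generators.
Variables (F : numFieldType) (n : nat) (G T B : set 'M[F]_n).
Variables (alpha : 'I_4 -> 'M[F]_n -> F) (e0 f0 h0 : 'I_4 -> 'M[F]_n).
Hypotheses (gG : is_group G) (torT : is_torus T) (sTG : T `<=` G) (sBG : B `<=` G).
Hypothesis baseG : root_base G T alpha.
Hypothesis chev : chevalley_generators cartan_F4 G T B alpha e0 f0 h0.

Let e j := e0 (inord j).
Let f j := f0 (inord j).
Let h j := h0 (inord j).
Let a j := alpha (inord j).
Let b := F4_basis e f h.

Let inord_eq i j : (i < 4)%N -> (j < 4)%N -> (inord i == inord j :> 'I_4) = (i == j).
Proof. by move=> li lj; rewrite -val_eqE /= !inordK. Qed.

Lemma chevalley_relations_of : chevalley_relations e f h.
Proof.
split=> i j li lj.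
- by rewrite (chev_ef chev) inord_eq.
- by rewrite (chev_he chev) cartan_F4E // /zF scaler_int.
- by rewrite (chev_hf chev) cartan_F4E // /zF mulrNz scaleNr scaler_int.
Qed.
Let rel := chevalley_relations_of.

Lemma lie_F4_space X : lie G X -> X \in F4_space e f h.
Proof.
apply: (chev_gen chev) => [j|Y Z]; last exact: F4_space_bracket.
rewrite -(inord_val j); split.
  rewrite -[e0 _]/(e j) -(F4_basis_simple e f h) //; apply: F4_basis_mem.
  exact: ltn_trans (ltn_ord j) _.
rewrite -[f0 _]/(f j) -(F4_basis_simple f e h) // -(F4_basis_neg e f h) ?(leq_trans (ltn_ord j)) //.
by apply: F4_basis_mem; rewrite -[52%N]/(24 + 28)%N ltn_add2l (leq_trans (ltn_ord j)).
Qed.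

Lemma lie_G_generators j : (j < 4)%N -> [/\ lie G (e j), lie G (f j) & lie G (h j)].
Proof.
move=> lj; split.
- by apply: lie_subset sBG _; have [] := chev_e chev (inord j).
- by have [] := chev_f chev (inord j).
- by apply: lie_subset sTG _; apply: (chev_h chev).
Qed.

Let uT : T `<=` [set X | X \in unitmx].
Proof. by case: torT => -[[[]]]. Qed.

Let a0 j t : (j < 4)%N -> T t -> a j t != 0.
Proof. by case: baseG => _ /(_ (inord j))[[_ nz _] _ _] _ _ _; apply: nz. Qed.

Let we j : (j < 4)%N -> weight_vector T (a j) (e j).
Proof. by have [] := chev_e chev (inord j). Qed.

Let wf j : (j < 4)%N -> weight_vector T (fun t => (a j t)^-1) (f j).
Proof. by have [] := chev_f chev (inord j). Qed.

Let wh j t : (j < 4)%N -> T t -> t *m h j *m invmx t = h j.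
Proof. by move=> _; apply: torus_lie_fixed => //; apply: (chev_h chev). Qed.

Let a_char (c : nat -> Z) t : weight_fun a c t = char_comb alpha (fun j => int_of_Z (c j)) t.
Proof. by apply: eq_bigr => j _; rewrite /a inord_val. Qed.

Let a_free (c : nat -> Z) : (forall t, T t -> weight_fun a c t = 1) ->
  forall i, (i < 4)%N -> c i = 0%coqZ.
Proof.
move=> c1 i li; have [_ _ free _] := baseG.
have /(_ (inord i)) : (fun j : 'I_4 => int_of_Z (c j)) =1 (fun=> 0).
  by apply: free => t /c1; rewrite a_char.
by rewrite inordK // => E; rewrite -[c i]int_of_ZK E.
Qed.

Lemma F4_root_space_lie k X : (k < 48)%N -> lie G X ->
  weight_vector T (weight_fun a (F4_weight k)) X -> exists x, X = x *: b k.
Proof. by move=> lk /lie_F4_space; apply: (F4_root_space uT a0 we wf wh a_free lk). Qed.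

Lemma F4_cartan_space_lie X : lie G X -> (forall t, T t -> t *m X *m invmx t = X) ->
  exists d : nat -> F, X = \sum_(k < 4) d k *: h k.
Proof. by move=> /lie_F4_space; apply: (F4_cartan_space uT a0 we wf wh a_free). Qed.

Lemma simple_weight j t : (j < 4)%N -> T t -> weight_fun a (F4_weight j) t = a j t.
Proof.
move=> lj Tt; rewrite /weight_fun (bigD1 (Ordinal lj)) //= big1 ?mulr1.
  by case: j lj => [|[|[|[|]]]] //= _; rewrite expr1z.
move=> i; rewrite -val_eqE /=; case: j lj => [|[|[|[|]]]] // _;
  by case: i => [[|[|[|[|]]]]].
Qed.

(** The Chevalley relations also hold for zero matrices. Nonvanishing comes from [root_base]: the
    simple root has a nonzero root vector, and its weight space is spanned by [e j]. *)
Lemma F4_simple_neq0 j : (j < 4)%N -> e j != 0.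
Proof.
move=> lj; have [_ /(_ (inord j))[_ _ [X [nX lX wX]]] _ _] := baseG.
have [|x E] := @F4_root_space_lie j X (leq_trans lj (isT : (4 <= 48)%N)) lX.
  by move=> t Tt; rewrite simple_weight // wX.
by apply: contra nX; rewrite E /b F4_basis_simple // => /eqP->; rewrite scaler0.
Qed.

(** D and h_j act alike on every e_i. Their difference is fixed by T, so it is a combination of the
    h_k; all simple roots kill it, and the Cartan matrix is invertible. *)
Lemma coroot_derivative (alphav : 'I_4 -> F -> 'M[F]_n) j D : (j < 4)%N ->
  simple_coroots cartan_F4 T alpha alphav -> cochar_derivative (alphav (inord j)) D ->
  D = h j.
Proof.
move=> lj avP jet; have [[_ lamT _] avE] := avP (inord j).
have lD : lie T D by apply: cochar_derivative_lie jet.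
have De i : (i < 4)%N -> bracket D (e i) = zF F (cartanZ i j) *: e i.
  move=> li; rewrite /zF -cartan_F4E //; apply: cochar_derivative_bracket jet _ => s s0.
  have Tl := lamT s s0; have ul : alphav (inord j) s \in unitmx := uT Tl.
  by rewrite -avE // scalemxAl -we // mulmxKV.
have [d zE] : exists d : nat -> F, D - h j = \sum_(k < 4) d k *: h k.
  have lz : lie T (D - h j).
    by rewrite -scaleN1r; apply/lieD/lieZ/(chev_h chev).
  apply: F4_cartan_space_lie => [|t Tt]; first exact: lie_subset lz.
  exact: torus_lie_fixed lz Tt.
have [_ he _] := rel.
have Ez i : (i < 4)%N -> \sum_(k < 4) d k * zF F (cartanZ i k) = 0.
  move=> li; have := F4_simple_neq0 li; apply: contraNeq => nz.
  suff : (\sum_(k < 4) d k * zF F (cartanZ i k)) *: e i == 0.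
    by rewrite scaler_eq0 (negbTE nz).
  rewrite scaler_suml (eq_bigr (fun k : 'I_4 => - bracket (e i) (d k *: h k))).
    rewrite sumrN -(linear_sum (bracket (e i))) -zE /=.
    have -> : bracket (e i) (D - h j) = bracket (e i) D - bracket (e i) (h j).
      exact: (linearB (bracket (e i))).
    by rewrite [X in X - _]bracket_anti [X in _ - X]bracket_anti De // he // subrr oppr0.
  by move=> k _; rewrite linearZ /= (bracket_anti (e i)) he // scalerN opprK scalerA.
pose S i := d 0%N * zF F (cartanZ i 0) + d 1%N * zF F (cartanZ i 1)
    + d 2%N * zF F (cartanZ i 2) + d 3%N * zF F (cartanZ i 3).
have {}Ez i : (i < 4)%N -> S i = 0.
  by move/Ez; rewrite !big_ord_recr big_ord0 /= add0r.
have zFE : ((zF F 2%coqZ = 2%:R) * (zF F (-1)%coqZ = -1) * (zF F (-2)%coqZ = - 2%:R) * (zF F 0%coqZ = 0))%type.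
  by [].
(* The inverse of the Cartan matrix of F_4. *)
have d0 : d 0%N = 2%:R * S 0%N + 3%:R * S 1%N + 4%:R * S 2%N + 2%:R * S 3%N.
  by rewrite /S /cartanZ /= !zFE; ring.
have d1 : d 1%N = 3%:R * S 0%N + 6%:R * S 1%N + 8%:R * S 2%N + 4%:R * S 3%N.
  by rewrite /S /cartanZ /= !zFE; ring.
have d2 : d 2%N = 2%:R * S 0%N + 4%:R * S 1%N + 6%:R * S 2%N + 3%:R * S 3%N.
  by rewrite /S /cartanZ /= !zFE; ring.
have d3 : d 3%N = S 0%N + 2%:R * S 1%N + 3%:R * S 2%N + 2%:R * S 3%N.
  by rewrite /S /cartanZ /= !zFE; ring.
apply/eqP; rewrite -subr_eq0 zE !big_ord_recr big_ord0 /= d0 d1 d2 d3 !Ez //.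
by rewrite !mulr0 !addr0 !scale0r !addr0.
Qed.

Variable H : set 'M[F]_n.
Hypotheses (gH : is_group H) (sHG : H `<=` G) (baseH : root_base H T (B4_simple_roots alpha)).

(** [root_base] yields some root vector in [lie H] for each beta_i, and root spaces of [lie G] are
    lines, so it is a multiple of the basis vector. The other roots are reached by brackets with e_j
    for j < 3. *)
Lemma B4_basis_lie k : k \in B4_positive -> lie H (b k).
Proof.
have simple i : (i < 4)%N -> lie H (b (nth 0%N B4_simple i)).
  move=> li.
  have wE t : B4_simple_roots alpha (inord i) t
      = weight_fun a (F4_weight (nth 0%N B4_simple i)) t.
    rewrite a_char; apply: eq_bigr => m _; congr (_ ^ _); rewrite /B4_coef inordK //.
    by case: i li => [|[|[|[|]]]] // _; case: m => [[|[|[|[|]]]]].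
  have [_ /(_ (inord i))[_ _ [X [nX lX wX]]] _ _] := baseH.
  have lk : (nth 0%N B4_simple i < 48)%N by case: (i) li => [|[|[|[|]]]].
  have [|x E] := @F4_root_space_lie _ X lk (lie_subset sHG lX).
    by move=> t Tt; rewrite wX // wE.
  have nx : x != 0 by apply: contra nX; rewrite E => /eqP->; rewrite scale0r.
  by rewrite -[b _](scalerK nx) -E; apply: lieZ.
elim/ltn_ind: k => k IH kH; have /allP/(_ k kH) := B4_positive_checkP.
case/orP=> [|/andP[hk]].
  by move=> kS; rewrite -(nth_index 0%N kS); apply: simple; rewrite -[4%N]/(size B4_simple) index_mem.
have := F4_basis_parent e f h hk; case: (nth _ F4_parents _) => [[j p] c] [lj lp bk] /andP[lj3 pH].
rewrite -/b in bk; rewrite bk; apply/lieZ/lie_bracket/IH => //.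
by rewrite -(F4_basis_simple e f h lj); case: j lj3 {bk lj} => [|[|[|]]] // _; [apply: (simple 1%N)|apply: (simple 2)|apply: (simple 3)].
Qed.

End Generators.

(** * Polynomial representations and parabolic subgroups *)

Section PolynomialRepresentations.
Variables (F : numFieldType) (n m : nat) (G : set 'M[F]_n).
Hypothesis gG : is_group G.
Implicit Types (X Y : 'M[F]_n) (v : 'cV[F]_m).

(** As a polynomial in s this determinant is invertible, hence constant, with value 1 at s = 0. *)
Lemma det_expmx N X s : (0 < N)%N -> mxpow X N = 0 -> \det (expmx N X s) = 1.
Proof.
move=> N0 XN; have XN' : mxpow (- X) N = 0 by rewrite mxpowN XN scaler0.
have dE Y t : \det (expmx N Y t) = (\det (exppoly N Y)).[t].
  by rewrite /expmx det_map_mx.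
have : \det (exppoly N X) * \det (exppoly N (- X)) = 1.
  apply/eqP; rewrite -subr_eq0; apply/eqP/poly_fun_eq0 => t.
  by rewrite hornerD hornerN hornerM hornerC -!dE -det_mulmx expmx_invl // det1 subrr.
move/(congr1 (fun q : {poly F} => q \is a GRing.unit)); rewrite unitr1 unitrM => /andP[+ _].
rewrite poly_unitE => /andP[/eqP/eqP/size_poly1P[c c0 cE] _].
have := dE X 0; rewrite expmx0 // det1 dE cE !hornerC => <-.
by [].
Qed.

Variable p : 'M[{mpoly F[n * n]}]_m.

Definition rep_at (A : 'M[F]_n) : 'M[F]_m := map_mx (fun q => mx_eval q A) p.
Definition rep_diff X : 'M[F]_m := \matrix_(i, j) diffat (p i j) 1%:M X.

Hypothesis rep1 : rep_at 1%:M = 1%:M.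
Hypothesis repM : forall A B, G A -> G B -> rep_at (A *m B) = rep_at A *m rep_at B.

Lemma rep_diffZ a X : rep_diff (a *: X) = a *: rep_diff X.
Proof. by apply/matrixP => i j; rewrite !mxE diffatZ. Qed.

Lemma mx_eval_lincomb (I : finType) (c : I -> F) (q : I -> {mpoly F[n * n]}) A :
  mx_eval (\sum_k (c k)%:MP * q k) A = \sum_k c k * mx_eval (q k) A.
Proof. by rewrite mx_eval_sum; apply: eq_bigr => k _; rewrite mx_evalM mx_evalC. Qed.

Lemma diffat_lincomb (I : finType) (c : I -> F) (q : I -> {mpoly F[n * n]}) X :
  diffat (\sum_k (c k)%:MP * q k) 1%:M X = \sum_k c k * diffat (q k) 1%:M X.
Proof.
rewrite diffat_sum; apply: eq_bigr => k _.
by rewrite diffatM diffat_const mx_evalC mul0r add0r.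
Qed.

(** The relation rho(A B) = rho(A) rho(B), differentiated in B at 1. It holds for B in G only, so
    the tangency of X is essential. *)
Lemma rep_diff_translate A X i j : G A -> lie G X ->
  diffat (p i j) A (A *m X) = (rep_at A *m rep_diff X) i j.
Proof.
move=> GA lX; pose q := sandwich A 1%:M 0 (p i j) - \sum_k (rep_at A i k)%:MP * p k j.
have q0 : vanishes G q.
  move=> B GB; rewrite mx_evalB mx_eval_sandwich mulmx1 addr0 mx_eval_lincomb.
  have := congr1 (fun M : 'M_m => M i j) (repM GA GB); rewrite !mxE => ->.
  by apply/eqP; rewrite subr_eq0; apply/eqP/eq_bigr => k _; rewrite !mxE.
have := lX q q0; rewrite -[X in X = 0 -> _]/(diffat q 1%:M X) diffatBp.
move/eqP; rewrite subr_eq0 diffat_lincomb => /eqP E.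
rewrite mxE; under eq_bigr do rewrite [rep_diff X _ _]mxE.
by rewrite -E diffat_sandwich !mulmx1 addr0.
Qed.

Lemma rep_diff_bracket X Y : lie G X -> lie G Y ->
  rep_diff (bracket X Y) = bracket (rep_diff X) (rep_diff Y).
Proof.
move=> lX lY.
have main Z W i j : lie G Z -> lie G W ->
    diffat (flow 0 W 0 (p i j)) 1%:M Z = (rep_diff Z *m rep_diff W) i j.
  move=> lZ lW; pose q := flow 0 W 0 (p i j) - \sum_k (rep_diff W k j)%:MP * p i k.
  have q0 : vanishes G q.
    move=> B GB; rewrite mx_evalB mx_eval_flow mul0mx add0r addr0 rep_diff_translate //.
    rewrite mx_eval_lincomb mxE; apply/eqP; rewrite subr_eq0; apply/eqP/eq_bigr => k _.
    by rewrite [rep_at B _ _]mxE mulrC.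
  have := lZ q q0; rewrite -[X in X = 0 -> _]/(diffat q 1%:M Z) diffatBp.
  move/eqP; rewrite subr_eq0 diffat_lincomb => /eqP ->.
  by rewrite mxE; apply: eq_bigr => k _; rewrite mulrC [rep_diff Z _ _]mxE.
apply/matrixP => i j; transitivity (diffat (p i j) 1%:M (bracket X Y)); first by rewrite mxE.
rewrite diffat_bracket [RHS]mxE [X in _ = _ + X]mxE.
by congr (_ - _); apply: main.
Qed.

(** The 2 x 2 minors of the pair (rho(A) v, v), which turn stability of the line of v into
    polynomial equations in A. *)
Definition minor_poly v i j : {mpoly F[n * n]} :=
  (\sum_k (v j 0 * v k 0)%:MP * p i k) - \sum_k (v i 0 * v k 0)%:MP * p j k.

Lemma mx_eval_minor_poly v i j A :
  mx_eval (minor_poly v i j) A = v j 0 * (rep_at A *m v) i 0 - v i 0 * (rep_at A *m v) j 0.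
Proof.
rewrite mx_evalB !mx_eval_lincomb !mxE !big_distrr /=.
by congr (_ - _); apply: eq_bigr => k _; rewrite !mxE -mulrA; congr (_ * _); rewrite mulrC.
Qed.

Lemma diffat_minor_poly v i j X :
  diffat (minor_poly v i j) 1%:M X
  = v j 0 * (rep_diff X *m v) i 0 - v i 0 * (rep_diff X *m v) j 0.
Proof.
rewrite /minor_poly diffatBp !diffat_lincomb !mxE !big_distrr /=.
by congr (_ - _); apply: eq_bigr => k _; rewrite !mxE -mulrA; congr (_ * _); rewrite mulrC.
Qed.

Lemma proportional_minors v w : v != 0 ->
  (exists c, w = c *: v) <-> forall i j, v j 0 * w i 0 - v i 0 * w j 0 = 0.
Proof.
move=> v0; split=> [[c ->] i j|E]; first by rewrite !mxE mulrCA [v i 0 * _]mulrCA [v i 0 * _]mulrC subrr.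
have [j vj] : exists j, v j 0 != 0.
  apply: contrapT => no; case/eqP: v0; apply/colP => j; rewrite mxE.
  by apply/eqP/negPn/negP => vj; apply: no; exists j.
exists (w j 0 / v j 0); apply/colP => i; rewrite !mxE.
have /eqP := E i j; rewrite subr_eq0 => /eqP E'.
by rewrite mulrAC [w j 0 * _]mulrC -E' mulrAC mulfV // mul1r.
Qed.

Lemma rep_diff_eigen v K X : v != 0 -> (forall b, K b -> exists c, rep_at b *m v = c *: v) ->
  lie K X -> exists c, rep_diff X *m v = c *: v.
Proof.
move=> v0 Kv lX; apply/(proportional_minors _ v0) => i j.
rewrite -diffat_minor_poly; apply: lX => b Kb.
by rewrite mx_eval_minor_poly; apply/(proportional_minors _ v0): i j; apply: Kv.
Qed.

Definition fixed_line v : set 'M[F]_n :=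
  [set g | G g /\ exists c, rep_at g *m v = c *: v].

Lemma fixed_line_group v : v != 0 -> is_group (fixed_line v).
Proof.
move=> v0; have [uG G1 GM GV] := gG; split.
- by move=> A [/uG].
- by split=> //; exists 1; rewrite rep1 mul1mx scale1r.
- move=> A B [GA [c Ac]] [GB [d Bd]]; split; first exact: GM.
  by exists (d * c); rewrite repM // -mulmxA Bd -scalemxAr Ac scalerA.
- move=> A [GA [c Ac]]; split; first exact: GV.
  have E : c *: (rep_at (invmx A) *m v) = v.
    by rewrite scalemxAr -Ac mulmxA -repM ?mulVmx ?rep1 ?mul1mx //; [exact: uG | exact: GV].
  have c0 : c != 0 by apply: contra v0 => /eqP c0; rewrite -E c0 scale0r.
  by exists c^-1; rewrite -{2}E scalerK.
Qed.

Lemma fixed_line_closed v : v != 0 -> zclosed G -> zclosed (fixed_line v).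
Proof.
move=> v0 [S SE]; exists (S `|` [set minor_poly v ij.1 ij.2 | ij in [set: 'I_m * 'I_m]]).
apply/seteqP; split=> A; rewrite /fixed_line /= SE /=.
  move=> [[uA A0] Av]; split=> // q [/A0 //|[[i j] _ <-]].
  by rewrite mx_eval_minor_poly; apply/(proportional_minors _ v0): i j.
move=> [uA A0]; split; first by split=> // q Sq; apply: A0; left.
apply/(proportional_minors _ v0) => i j; rewrite -mx_eval_minor_poly.
by apply: A0; right; exists (i, j).
Qed.

(** The derivative of rho(exp tX) v is rho(exp tX) applied to [rep_diff X *m v], so the curve is
    constant. *)
Lemma rep_exp_fixed N X v s : (0 < N)%N -> mxpow X N = 0 ->
  (forall s, G (expmx N X s)) -> lie G X -> rep_diff X *m v = 0 ->
  rep_at (expmx N X s) *m v = v.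
Proof.
move=> N0 XN GX lX dX; apply/colP => i.
pose P : {poly F} := \sum_k pev (p i k) (exppoly N X) * (v k 0)%:P.
have PE t : P.[t] = (rep_at (expmx N X t) *m v) i 0.
  rewrite mxE horner_sum; apply: eq_bigr => k _.
  by rewrite hornerM hornerC horner_pev mxE.
have P' : P^`() = 0.
  apply: poly_fun_eq0 => t; have -> : P^`() = \sum_k (pev (p i k) (exppoly N X) * (v k 0)%:P)^`().
    exact: (raddf_sum (@deriv F)).
  rewrite horner_sum.
  transitivity ((rep_at (expmx N X t) *m rep_diff X *m v) i 0); last first.
    by rewrite -mulmxA dX mulmx0 mxE.
  rewrite [RHS]mxE; apply: eq_bigr => k _.
  rewrite derivM derivC mulr0 addr0 hornerM hornerC deriv_pev_exppoly // horner_pev.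
  by rewrite mx_eval_flow mul0mx add0r addr0 -rep_diff_translate //; apply: GX.
have Pc : P = (P`_0)%:P.
  apply/polyP => -[|k]; rewrite coefC //=.
  have := congr1 (fun q : {poly F} => q`_k) P'; rewrite coef_deriv coef0 => /eqP.
  by rewrite mulrn_eq0 => /eqP.
rewrite -PE -[in RHS](mul1mx v) -rep1 -(expmx0 X N0) -PE.
by rewrite Pc !hornerC.
Qed.

End PolynomialRepresentations.

Definition F4_parents_check : bool :=
  all (fun i => all (fun k => let: (j, p, _) := nth (0%N, 0%N, 0%coqZ) F4_parents (k - 4) in
     Z.eqb (rootc k i) 0 ==> Z.eqb (rootc j i) 0 && Z.eqb (rootc p i) 0) (iota 4 20)) (iota 0 4).

Lemma F4_parents_checkP : F4_parents_check. Proof. by vm_compute. Qed.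

Section Parabolic.
Variables (F : numClosedFieldType) (n : nat) (G T B : set 'M[F]_n).
Variables (alpha : 'I_4 -> 'M[F]_n -> F) (e0 f0 h0 : 'I_4 -> 'M[F]_n).
Variable alphav : 'I_4 -> F -> 'M[F]_n.
Hypotheses (conG : connected_algebraic_group G) (torT : is_torus T).
Hypotheses (sTG : T `<=` G) (sBG : B `<=` G) (sTB : T `<=` B).
Hypothesis baseG : root_base G T alpha.
Hypothesis chev : chevalley_generators cartan_F4 G T B alpha e0 f0 h0.
Hypothesis alphavP : simple_coroots cartan_F4 T alpha alphav.

Let e j := e0 (inord j).
Let f j := f0 (inord j).
Let h j := h0 (inord j).
Let b := F4_basis e f h.
Let rel : chevalley_relations e f h := chevalley_relations_of chev.
Let gG : is_group G := conG.1.1.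

Lemma simple_neg_nilpotent j : (j < 4)%N -> exists2 N, (1 < N)%N & mxpow (f j) N = 0.
Proof.
move=> lj; have := F4_root_nilpotent (chevalley_relations_opp rel) (leq_trans lj (isT : 4 <= 24)%N).
by rewrite F4_basis_simple.
Qed.

Lemma simple_nilpotent j : (j < 4)%N -> exists2 N, (1 < N)%N & mxpow (e j) N = 0.
Proof.
move=> lj; have := F4_root_nilpotent rel (leq_trans lj (isT : 4 <= 24)%N).
by rewrite F4_basis_simple.
Qed.

(** Exponentials of nilpotents have determinant 1, so the subgroup of determinant 1 has all e_j and
    f_j in its Lie algebra and equals G by connectedness. Regular functions on G are therefore
    polynomial. *)
Lemma G_det1 : forall A, G A -> \det A = 1.
Proof.
pose K : set 'M[F]_n := [set A | G A /\ \det A = 1].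
suff sGK : G `<=` K by move=> A /sGK[].
have [uG G1 GM GV] := gG.
have gK : is_group K.
  split=> [A [/uG]//||A A' [GA dA] [GA' dA']|A [GA dA]].
  - by split=> //; exact: det1.
  - by split; [exact: GM | rewrite det_mulmx dA dA' mulr1].
  - by split; [exact: GV | rewrite det_inv dA invr1].
have cK : zclosed K.
  have [S SE] := conG.1.2; exists (S `|` [set det_mpoly F n - 1]).
  apply/seteqP; split=> A; rewrite /K /= SE /=.
    move=> [[uA A0] dA]; split=> // q [/A0 //|->].
    by rewrite mx_evalB mx_eval_det mx_eval1 dA subrr.
  move=> [uA A0]; split; first by split=> // q Sq; apply: A0; left.
  apply/eqP; rewrite -subr_eq0 -mx_eval_det -[1](mx_eval1 A) -mx_evalB; apply/eqP.
  by apply: A0; right.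
apply: (connected_lie_eq (conj gK cK) conG) => [A [] //|X].
have [U UK] := lie_vspace K; move=> lX; apply/UK.
have nilp_K X' N : (1 < N)%N -> mxpow X' N = 0 -> lie G X' -> lie K X'.
  move=> N1 XN lX'; apply: (lie_expmx N1) => s; split; first exact: expmx_in_group conG.1 lX' (ltnW N1) XN.
  exact: det_expmx (ltnW N1) XN.
apply: (chev_gen chev) lX => [j|Y Z /UK lY /UK lZ]; last exact/UK/lie_bracket.
have [le lf _] := lie_G_generators sTG sBG chev (ltn_ord j).
rewrite inord_val in le lf.
by split; apply/UK; [have [N N1] := simple_nilpotent (ltn_ord j) | have [N N1] := simple_neg_nilpotent (ltn_ord j)];
   rewrite /e /f inord_val => XN; apply: nilp_K N1 XN _.
Qed.

Lemma polynomial_representation m (rho : 'M[F]_n -> 'M[F]_m) : representation G rho ->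
  exists p, forall A, G A -> rho A = rep_at p A.
Proof.
case=> reg _ _; have ex (ij : 'I_m * 'I_m) : exists q, forall A, G A -> rho A ij.1 ij.2 = mx_eval q A.
  case: (reg ij.1 ij.2) => k [q qE]; exists q => A GA.
  by rewrite qE // G_det1 // expr1n divr1.
have [q qE] := choice ex; exists (\matrix_(i, j) q (i, j)) => A GA.
by apply/matrixP => i j; rewrite !mxE -qE.
Qed.

Lemma coroot_killed m (p : 'M[{mpoly F[n * n]}]_m) (v : 'cV[F]_m) j : (j < 4)%N ->
  (forall s, s != 0 -> rep_at p (alphav (inord j) s) *m v = v) -> rep_diff p (h j) *m v = 0.
Proof.
move=> lj vfix; have [lamT _] := alphavP (inord j).
have uT : T `<=` [set X | X \in unitmx] by have [[[]]] := torT.1.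
have [D jet] := cochar_derivative_exists uT lamT.
have DE : D = h j := coroot_derivative torT sTG baseG chev lj alphavP jet.
rewrite -DE.
apply/colP => i; rewrite [RHS]mxE.
have := cochar_derivative_weight (q := \sum_k (v k 0)%:MP * p i k) (r := (v i 0)%:MP) (m := 0) jet.
rewrite diffat_const mul0r addr0 diffat_lincomb => E.
rewrite mxE -[RHS]E => [|s s0].
  by apply: eq_bigr => k _; rewrite mxE mulrC.
rewrite mx_eval_lincomb expr0z mul1r mx_evalC -[in RHS](vfix s s0) mxE.
by apply: eq_bigr => k _; rewrite mxE mulrC.
Qed.

Section Stabilizer.
Variables (m : nat) (p : 'M[{mpoly F[n * n]}]_m) (v : 'cV[F]_m) (i : 'I_4).
Hypothesis rep1 : rep_at p 1%:M = 1%:M.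
Hypothesis repM : forall A B, G A -> G B -> rep_at p (A *m B) = rep_at p A *m rep_at p B.
Hypothesis v0 : v != 0.
Hypothesis Bv : forall A, B A -> exists c, rep_at p A *m v = c *: v.
Hypothesis vfix : forall j s, j != i -> s != 0 -> rep_at p (alphav j s) *m v = v.

Lemma simple_neg_killed j : (j < 4)%N -> inord j != i -> rep_diff p (f j) *m v = 0.
Proof.
move=> lj nji; have [le lf lh] := lie_G_generators sTG sBG chev lj.
have [ef he hf] := rel.
have c2 : zF F (cartanZ j j) = 2%:R by case: j lj {nji le lf lh} => [|[|[|[|]]]].
have hv : rep_diff p (h j) *m v = 0 by apply: coroot_killed => // s; apply: vfix.
have brk X Y : lie G X -> lie G Y -> rep_diff p (bracket X Y) = bracket (rep_diff p X) (rep_diff p Y).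
  exact: rep_diff_bracket.
have HE : bracket (rep_diff p (h j)) (rep_diff p (e j)) = 2%:R *: rep_diff p (e j).
  by rewrite -brk // he // c2 rep_diffZ.
have HF : bracket (rep_diff p (h j)) (rep_diff p (f j)) = - 2%:R *: rep_diff p (f j).
  by rewrite -brk // hf // c2 rep_diffZ.
have EF : bracket (rep_diff p (e j)) (rep_diff p (f j)) = rep_diff p (h j).
  by rewrite -brk // ef // eqxx.
have ev : rep_diff p (e j) *m v = 0.
  have [c cE] := rep_diff_eigen v0 Bv (chev_e chev (inord j)).1.
  have := congr1 (mulmx^~ v) HE; rewrite /bracket mulmxBl -!mulmxA cE hv.
  rewrite -scalemxAr hv scaler0 mulmx0 subrr -scalemxAl cE => /esym/eqP.
  by rewrite scaler_eq0 pnatr_eq0 => /eqP.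
move: ev hv HE HF EF; rewrite /bracket.
move: (rep_diff p (e j)) (rep_diff p (f j)) (rep_diff p (h j)) => E' F' H' ev hv HE HF EF.
(* The roles of e and f are exchanged: e kills f v, and f v has weight 2 for -h, that is [m.+1] with
   m = 1. *)
apply: (sl2_lowest_eq0 (E := mulmx F') (Fo := mulmx E') (H := mulmx (- H')) (m := 1)) => [w|w||] /=.
- by rewrite -EF opprB mulmxBl !mulmxA.
- have -> : 2%:R *: (F' *m w) = - (H' *m F' - F' *m H') *m w.
    by rewrite HF scaleNr opprK scalemxAl.
  by rewrite opprB mulmxBl !mulNmx mulmxN !mulmxA opprK addrC.
- by rewrite mulmxA -[E' *m F'](subrK (F' *m E')) EF mulmxDl hv -mulmxA ev mulmx0 addr0.
- rewrite mulNmx mulmxA -[H' *m F'](subrK (F' *m H')) HF mulmxDl -mulmxA hv mulmx0 addr0.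
  by rewrite scaleNr mulNmx opprK scalemxAl.
Qed.

Lemma fixed_line_neg j : (j < 4)%N -> inord j != i -> lie (fixed_line G p v) (f j).
Proof.
move=> lj nji; have [N N1 fN] := simple_neg_nilpotent lj.
have [_ lf _] := lie_G_generators sTG sBG chev lj.
apply: (lie_expmx N1) => s.
have GX (t : F) : G (expmx N (f j) t) by exact: expmx_in_group _ conG.1 lf (ltnW N1) fN.
split=> //; exists 1; rewrite scale1r.
apply: (rep_exp_fixed (G := G) rep1 repM) => //; [exact: ltnW | exact: simple_neg_killed].
Qed.

End Stabilizer.

(** The weight omega_i is 1 on the coroots with j <> i, so these fix v and the corresponding f_j are
    tangent to the stabilizer; their brackets give all negative roots without alpha_i. *)
Lemma parabolic_lie (i : 'I_4) P : is_group B -> fundamental_parabolic G T B alphav i P ->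
  [/\ algebraic_group P, P `<=` G, B `<=` P, forall j, (j < 4)%N -> lie P (h j) &
    (forall k, (k < 24)%N -> lie P (b k)) /\
    (forall k, (k < 24)%N -> rootc k i = 0%coqZ -> lie P (b (24 + k)%N))].
Proof.
move=> gB [m [rho [v [om [[rep _ _] [_ omE] [v0 Bv Tv] PE]]]]].
have [p pE] := polynomial_representation rep; have [_ rho1 rhoM] := rep.
have [uG G1 GM GV] := gG.
have rep1 : rep_at p 1%:M = 1%:M by rewrite -pE.
have repM A A' : G A -> G A' -> rep_at p (A *m A') = rep_at p A *m rep_at p A'.
  by move=> GA GA'; rewrite -!pE ?rhoM //; apply: GM.
have {}PE : P = fixed_line G p v.
  by rewrite PE; apply/seteqP; split=> A [GA Av]; split=> //; move: Av; rewrite pE.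
have Bv' A : B A -> exists c, rep_at p A *m v = c *: v by move=> BA; rewrite -pE; [exact: Bv | exact: sBG].
have vfix j s : j != i -> s != 0 -> rep_at p (alphav j s) *m v = v.
  move=> nji s0; have [[_ lamT _] _] := alphavP j.
  rewrite -pE; last exact/sTG/lamT.
  by rewrite Tv ?omE // ?[i == j]eq_sym ?(negbTE nji) ?scale1r //; exact: lamT.
have gP : is_group P by rewrite PE; apply: fixed_line_group.
have sBP : B `<=` P by move=> A BA; rewrite PE; split; [exact: sBG | exact: Bv'].
have lf j : (j < 4)%N -> inord j != i -> lie P (f j) by rewrite PE; apply: fixed_line_neg.
have lB j : (j < 4)%N -> lie P (e j).
  by move=> _; apply: lie_subset sBP _; exact: (chev_e chev (inord j)).1.
split=> //.
- by split=> //; rewrite PE; apply: fixed_line_closed => //; exact: conG.1.2.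
- by rewrite PE => A [].
- by move=> j _; apply: lie_subset sBP _; apply: lie_subset sTB _; apply: (chev_h chev).
split=> k lk.
  apply: (F4_basis_ind (I := xpredT)) => // [j lj _|j k' lj _ _ Pk'|a X|l _ _].
  - exact: lB.
  - by apply: lie_bracket => //; apply: lB.
  - exact: lieZ.
  - by case: (nth _ _ _) => [[]].
move=> rk; rewrite /b (F4_basis_neg _ _ _ h) //.
have ne j : (j < 4)%N -> Z.eqb (rootc j i) 0 -> inord j != i.
  move=> lj /Z.eqb_spec rj; apply/eqP => E; move: rj; rewrite -E inordK //.
  by case: j lj {E} => [|[|[|[|]]]].
apply: (F4_basis_ind (I := fun k => Z.eqb (rootc k i) 0)) => //.
- by move=> j lj rj; apply: lf => //; apply: ne.
- by move=> j k' lj rj _ Pk'; apply: lie_bracket => //; apply: lf => //; apply: ne.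
- by move=> a X; exact: lieZ.
- move=> l ll rl; have /allP/(_ i) := F4_parents_checkP; rewrite mem_iota ltn_ord => /(_ isT)/allP/(_ l).
  by rewrite mem_iota => /(_ ll); case: (nth _ _ _) => [[j q] c]; rewrite rl.
- by rewrite rk.
Qed.

End Parabolic.

(** * The open orbit *)

(* A dense vector lists its coefficients; missing ones are 0. *)
Fixpoint dcomb (a c : Z) (v w : seq Z) : seq Z :=
  match v, w with
  | [::], _ => map (Z.mul c) w
  | _, [::] => map (Z.mul a) v
  | x :: v', y :: w' => Z.add (Z.mul a x) (Z.mul c y) :: dcomb a c v' w'
  end.

Fixpoint matvec (cols : seq (seq Z)) (v : seq Z) : seq Z :=
  match cols, v with
  | col :: cols', x :: v' =>
      if Z.eqb x 0 then matvec cols' v' else dcomb 1 x (matvec cols' v') col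
  | _, _ => [::]
  end.

Definition dunit (k : nat) : seq Z := ncons k 0%coqZ [:: 1%coqZ].

(* Twice the image of the k-th basis element under exp (ad f_j). *)
Definition twice_exp_col (j k : nat) : seq Z :=
  let ad s := sapp (adF j) s in
  dense 52 ([:: (k, 2%coqZ)] ++ [seq (x.1, Z.mul 2 x.2) | x <- adF j k] ++ ad (adF j k)).

(** The columns of exp(ad f_j) = 1 + ad f_j + (ad f_j)^2 / 2. [exp_check] confirms that halving is
    exact and that the cube of ad f_j is 0. *)
Definition exp_table : seq (seq (seq Z)) := Eval vm_compute in
  [seq [seq [seq Z.div x 2 | x <- twice_exp_col j k] | k <- iota 0 52] | j <- iota 0 4].

Definition exp_cols (j : nat) : seq (seq Z) := nth [::] exp_table j.

Definition exp_check : bool :=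
  all (fun j => (size (exp_cols j) == 52)%N && all (fun k =>
    [&& map (Z.mul 2) (nth [::] (exp_cols j) k) == twice_exp_col j k,
        all (fun x => x.1 < 52)%N (adF j k),
        all (fun x => x.1 < 52)%N (sapp (adF j) (adF j k)),
        all (fun x => x.1 < 52)%N (sapp (adF j) (sapp (adF j) (adF j k)))
      & dense 52 (sapp (adF j) (sapp (adF j) (adF j k))) == dense 52 [::]])
  (iota 0 52)) (iota 0 4).

Lemma exp_checkP : exp_check. Proof. by vm_compute. Qed.

(* The base point of the open orbit of G/P_i is the product of the exp f_j along
   this word, found by a computer search. *)
Definition base_word (i : nat) : seq nat := nth [::]
  [:: [:: 0; 1; 2; 3; 1; 2; 0; 1; 2; 3; 0; 1; 2; 1; 0]%N;
      [:: 3; 1; 2; 3; 1; 2; 3; 1; 2; 0; 1; 2; 3; 1; 2; 1; 0; 1; 2; 1; 3; 2; 1; 0]%N;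
      [:: 2; 1; 2; 0; 1; 2; 3; 2; 1; 2; 0; 1; 2; 3; 2; 1; 2; 0; 1; 2]%N;
      [:: 3; 2; 1; 2; 0; 1; 2; 3; 2; 1; 2; 0; 1; 2; 3]%N] i.

(* Pairs (k, l): the image of the k-th basis element is used to pivot on column l.
   This order keeps the coefficients small. *)
Definition pivots (i : nat) : seq (nat * nat) := nth [::]
  [:: [:: (39, 39); (36, 36); (32, 32); (33, 33); (29, 29); (25, 25); (30, 30); (26, 26); (27,
      27); (48, 35); (0, 24); (49, 28); (50, 31); (51, 42); (4, 44); (1, 37); (13, 38); (10,
      34); (8, 40); (2, 45); (7, 41); (5, 43); (3, 47); (6, 46); (9, 9); (11, 11); (12, 12);
      (15, 3); (14, 14); (17, 6); (16, 16); (18, 18)]%N;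
      [:: (30, 30); (26, 26); (27, 27); (24, 24); (49, 28); (50, 25); (51, 29); (48, 33); (3,
      3); (1, 31); (4, 32); (5, 35); (7, 36); (13, 39); (0, 34); (10, 38); (2, 37); (8, 40); (6,
      42); (9, 9); (12, 12); (15, 41); (11, 6); (17, 43); (14, 44); (16, 47); (19, 45); (18,
      46); (20, 18); (21, 16); (22, 14); (23, 11)]%N;
      [:: (28, 28); (25, 25); (24, 24); (27, 27); (50, 30); (49, 26); (1, 35); (8, 29); (48,
      31); (51, 32); (0, 33); (4, 34); (10, 38); (13, 36); (2, 41); (7, 39); (5, 37); (3, 40);
      (6, 6); (9, 9); (12, 12); (15, 42); (11, 43); (14, 44); (17, 45); (16, 46); (19, 47); (18,
      3); (20, 18); (21, 16); (22, 14); (23, 11)]%N;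
      [:: (37, 37); (34, 34); (32, 32); (31, 31); (28, 28); (24, 24); (29, 29); (25, 25); (26,
      26); (48, 35); (0, 33); (49, 30); (1, 38); (4, 41); (7, 27); (8, 36); (5, 47); (2, 40);
      (10, 39); (13, 43); (50, 44); (51, 42); (3, 46); (6, 45); (9, 9); (11, 11); (12, 12); (15,
      6); (17, 14); (14, 3); (16, 16); (18, 18)]%N] i.

Definition word_image (w : seq nat) (v : seq Z) : seq Z :=
  foldr (fun j => matvec (exp_cols j)) v w.

Definition borel_index (k : nat) : bool := (k \in B4_positive) || (48 <= k)%N.

Definition parabolic_index (i k : nat) : bool :=
  [|| (k < 24)%N, (k < 48)%N && Z.eqb (rootc (k - 24) i) 0 | (48 <= k < 52)%N].

(** Elimination takes place modulo the Borel subalgebra; stopping at 48 discards the coroots, which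
    all belong to it. *)
Definition drop_borel (v : seq Z) : seq Z :=
  [seq if borel_index k then 0%coqZ else nth 0%coqZ v k | k <- iota 0 48].

(** Fraction-free elimination. The list has the newest row first, so [foldr] clears the oldest pivot
    first; newer rows are 0 at older pivots and do not spoil them. *)
Definition row_reduce (ps : seq (nat * seq Z)) (v : seq Z) : seq Z :=
  foldr (fun p v => let c := nth 0%coqZ v p.1 in
    if Z.eqb c 0 then v else
    let a := nth 0%coqZ p.2 p.1 in let g := Z.gcd a c in
    dcomb (Z.div a g) (Z.opp (Z.div c g)) v p.2) v ps.

(** Division by the content keeps the integers small. The product test makes soundness independent
    of any property of the gcd. *)
Definition primitive_row (v : seq Z) : seq Z :=
  let g := foldr Z.gcd 0%coqZ v in let w := [seq Z.div x g | x <- v] in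
  if ~~ Z.eqb g 0 && (map (Z.mul g) w == v) then w else v.

Definition eliminate (i : nat) : seq (nat * seq Z) :=
  foldl (fun ps kl => (kl.2, primitive_row (row_reduce ps
      (drop_borel (word_image (base_word i) (dunit kl.1))))) :: ps) [::] (pivots i).

(** Back substitution, newest row first: besides its pivot a row may involve only basis elements
    already reached. Of the elimination itself, only that its rows stay in the subspace has to be
    proved. *)
Fixpoint spans (known : seq nat) (ps : seq (nat * seq Z)) : bool :=
  match ps with
  | [::] => all (fun k => k \in known) (iota 0 52)
  | (k, r) :: ps' => [&& (k < 52)%N, ~~ Z.eqb (nth 0%coqZ r k) 0,
      all (fun l => [|| l == k, l \in known | Z.eqb (nth 0%coqZ r l) 0]) (iota 0 52)
      & spans (k :: known) ps']
  end.

Definition spans_check : bool :=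
  all (fun i => all (fun kl => parabolic_index i kl.1 && (kl.1 < 52)%N) (pivots i)
    && spans (B4_positive ++ iota 48 4) (eliminate i)) (iota 0 4).

Lemma spans_checkP : spans_check. Proof. by vm_compute. Qed.

Lemma nth_dcomb a c v w k : nth 0%coqZ (dcomb a c v w) k
  = Z.add (Z.mul a (nth 0%coqZ v k)) (Z.mul c (nth 0%coqZ w k)).
Proof.
have nth_mul d u l : nth 0%coqZ (map (Z.mul d) u) l = Z.mul d (nth 0%coqZ u l).
  elim: u l => [|x u IH] [|l] //=; by rewrite Z.mul_0_r.
elim: v w k => [|x v IH] w k; first by rewrite /= nth_mul nth_nil Z.mul_0_r.
case: w => [|y w].
  have -> : dcomb a c (x :: v) [::] = map (Z.mul a) (x :: v) by [].
  by rewrite nth_mul nth_nil Z.mul_0_r Z.add_0_r.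
by case: k => [//|k] /=; rewrite IH.
Qed.

(** * Soundness of the integer elimination *)

Section DenseVectors.
Variables (F : numFieldType) (V : lmodType F) (b : nat -> V).

Definition dvec (v : seq Z) : V := \sum_(k < 52) zF F (nth 0%coqZ v k) *: b k.

Lemma dvec_dcomb a c v w : dvec (dcomb a c v w) = zF F a *: dvec v + zF F c *: dvec w.
Proof.
rewrite !scaler_sumr -big_split; apply: eq_bigr => k _ /=.
by rewrite nth_dcomb zFD !zFM scalerDl !scalerA.
Qed.

Lemma dvec_nil : dvec [::] = 0.
Proof. by rewrite /dvec big1 // => k _; rewrite nth_nil zF0 scale0r. Qed.

Lemma dvec_scale a v : dvec (map (Z.mul a) v) = zF F a *: dvec v.
Proof.
rewrite -[map _ v]/(dcomb 0 a [::] v) dvec_dcomb dvec_nil scaler0 add0r.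
by [].
Qed.

Lemma dvec_dunit k : (k < 52)%N -> dvec (dunit k) = b k.
Proof.
move=> lk; rewrite /dvec (bigD1 (Ordinal lk)) //= big1 ?addr0.
  by rewrite nth_ncons ltnn subnn /= /zF scale1r.
move=> i ne; rewrite nth_ncons; case: ltnP => [_|le]; first by rewrite zF0 scale0r.
have := ne; rewrite -val_eqE /= eqn_leq le andbT -ltnNge -subn_gt0.
by case: (i - k)%N => [//|d] _; rewrite /= nth_nil zF0 scale0r.
Qed.

Lemma dvec_dense s : all (fun x => x.1 < 52)%N s -> dvec (dense 52 s) = lincomb b s.
Proof.
move=> s52; rewrite (lincomb_dense _ s52); apply: eq_bigr => k _.
by rewrite (nth_map 0%N) ?size_iota // nth_iota.
Qed.

Lemma dvec_matvec cols v : dvec (matvec cols v)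
  = \sum_(k < size cols) zF F (nth 0%coqZ v k) *: dvec (nth [::] cols k).
Proof.
elim: cols v => [|col cols IH] v; first by rewrite big_ord0 dvec_nil.
case: v => [|x v].
  by rewrite dvec_nil big1 // => k _; rewrite nth_nil zF0 scale0r.
rewrite [matvec _ _]/= big_ord_recl /=; case: Z.eqb_spec => [->|_].
  by rewrite zF0 scale0r add0r IH.
by rewrite dvec_dcomb IH addrC /zF scale1r.
Qed.

Variable M : V -> Prop.
Hypothesis MD : forall x y, M x -> M y -> M (x + y).
Hypothesis MZ : forall a x, M x -> M (a *: x).

Let M_sum (P : pred nat) (y : nat -> V) : (forall k, (k < 52)%N -> P k -> M (y k)) ->
  M 0 -> M (\sum_(k < 52 | P k) y k).
Proof. by move=> My M0; elim/big_ind: _ => // k; apply: My. Qed.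

Lemma dvec_primitive_row v : M (dvec v) -> M (dvec (primitive_row v)).
Proof.
move=> Mv; rewrite /primitive_row; case: ifP => // /andP[g0 /eqP E].
have nz : zF F (foldr Z.gcd 0%coqZ v) != 0 by rewrite zF_eq0.
by rewrite -[dvec _](scalerK nz) -dvec_scale E; apply: MZ.
Qed.

Lemma dvec_row_reduce ps v : (forall p, p \in ps -> M (dvec p.2)) -> M (dvec v) ->
  M (dvec (row_reduce ps v)).
Proof.
elim: ps => [|p ps IH] //= Mps Mv.
have Mr : M (dvec (row_reduce ps v)).
  by apply: IH => // q qs; apply: Mps; rewrite inE qs orbT.
case: ifP => // _; rewrite dvec_dcomb.
by apply: MD; apply: MZ => //; apply: Mps; exact: mem_head.
Qed.

Lemma dvec_drop_borel v : (forall k, (k < 52)%N -> borel_index k -> M (b k)) ->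
  M (dvec v) -> M (dvec (drop_borel v)).
Proof.
move=> Mb Mv; have M0 : M 0 by rewrite -(scale0r (dvec v)); apply: MZ.
have -> : dvec (drop_borel v) = dvec v
    + -1 *: \sum_(k < 52 | borel_index k) zF F (nth 0%coqZ v k) *: b k.
  rewrite /dvec (bigID (fun k : 'I_52 => borel_index k)) [in RHS](bigID (fun k : 'I_52 => borel_index k)) /=.
  have nE k : (k < 52)%N -> nth 0%coqZ (drop_borel v) k = if borel_index k then 0%coqZ else nth 0%coqZ v k.
    move=> lk; case: (ltnP k 48) => [l48|le48].
      by rewrite (nth_map 0%N) ?size_iota // nth_iota.
    by rewrite nth_default ?size_map ?size_iota // /borel_index le48 orbT.
  rewrite scaleN1r [in RHS]addrAC subrr add0r big1 ?add0r => [|k bk].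
    by apply: eq_bigr => k nbk; rewrite nE // (negbTE nbk).
  by rewrite nE // bk zF0 scale0r.
apply/MD/MZ => //; apply: (M_sum (P := borel_index) (y := fun k => zF F (nth 0%coqZ v k) *: b k)) => //.
by move=> k lk bk; apply/MZ/Mb.
Qed.

Lemma spans_sound known ps : (forall k, k \in known -> M (b k)) ->
  (forall p, p \in ps -> M (dvec p.2)) -> spans known ps -> forall k, (k < 52)%N -> M (b k).
Proof.
elim: ps known => [|[k r] ps IH] known Mk Mps.
  move=> sp k lk; apply: Mk; have /allP : all (fun k => k \in known) (iota 0 52) := sp.
  by apply; rewrite mem_iota.
move=> sp; have /and4P[lk nz /allP rE] : [&& (k < 52)%N, ~~ Z.eqb (nth 0%coqZ r k) 0,
    all (fun l => [|| l == k, l \in known | Z.eqb (nth 0%coqZ r l) 0]) (iota 0 52)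
    & spans (k :: known) ps] := sp.
apply: IH => [l|p ps_p]; last first.
  by apply: Mps; rewrite inE ps_p orbT.
rewrite inE => /predU1P[->|]; last exact: Mk.
have Mr : M (dvec r) by exact: (Mps (k, r) (mem_head _ _)).
have nzF : zF F (nth 0%coqZ r k) != 0 by rewrite zF_eq0.
have M0 : M 0 by rewrite -(scale0r (dvec r)); apply: MZ.
rewrite -[b k](scalerK nzF); apply: MZ.
have -> : zF F (nth 0%coqZ r k) *: b k
    = dvec r + -1 *: \sum_(l < 52 | (l : nat) != k) zF F (nth 0%coqZ r l) *: b l.
  by rewrite /dvec (bigD1 (Ordinal lk)) //= scaleN1r addrK.
apply/MD/MZ => //; apply: (M_sum (P := fun l => l != k) (y := fun l => zF F (nth 0%coqZ r l) *: b l)) => // m lm ne.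
have := rE m; rewrite mem_iota => /(_ lm); rewrite (negbTE ne) /=.
by case/orP=> [/Mk|/Z.eqb_spec->]; [exact: MZ | rewrite zF0 scale0r].
Qed.

Lemma spherical_span i : (i < 4)%N ->
  (forall k, (k < 52)%N -> borel_index k -> M (b k)) ->
  (forall k, (k < 52)%N -> parabolic_index i k ->
     M (dvec (word_image (base_word i) (dunit k)))) ->
  forall k, (k < 52)%N -> M (b k).
Proof.
move=> li Mb Mp; have /allP/(_ i) := spans_checkP; rewrite mem_iota => /(_ li)/andP[/allP piv].
have {}piv k l : (k, l) \in pivots i -> parabolic_index i k /\ (k < 52)%N by move/piv/andP.
apply: spans_sound => [k|p]; first rewrite mem_cat mem_iota.
  move=> kb; apply: Mb; last by rewrite /borel_index; case/orP: kb => [->//|/andP[-> _]]; rewrite orbT.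
  by case/orP: kb => [|/andP[]//]; exact: (allP (isT : all (fun k => k < 52)%N B4_positive)).
have : forall p, p \in [::] -> M (dvec (p : nat * seq Z).2) by [].
rewrite /eliminate; move: [::] => ps; elim: (pivots i) ps piv => [|[k l] kl IH] ps piv Mps.
  exact: Mps.
apply: IH => [k' l' kl'|q]; first by apply: (piv _ l'); rewrite inE kl' orbT.
rewrite inE => /predU1P[->|]; last exact: Mps.
have [pk lk] := piv k l (mem_head _ _).
apply/dvec_primitive_row/dvec_row_reduce => //; apply: dvec_drop_borel => //.
exact: Mp.
Qed.

End DenseVectors.

Section BasePoint.
Variables (F : numFieldType) (n : nat) (e f h : nat -> 'M[F]_n).
Hypothesis rel : chevalley_relations e f h.
Let b := F4_basis e f h.
Local Notation dvec := (dvec b).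

Lemma exp_conj_basis N j k : (j < 4)%N -> (k < 52)%N -> (0 < N)%N -> mxpow (f j) N = 0 ->
  expmx N (f j) 1 *m b k *m expmx N (- f j) 1 = dvec (nth [::] (exp_cols j) k).
Proof.
move=> lj lk N0 fN; have /allP/(_ j) := exp_checkP; rewrite mem_iota => /(_ lj)/andP[_ /allP/(_ k)].
rewrite mem_iota => /(_ lk)/and5P[/eqP colE s1 s2 s3 /eqP s30].
have brk s : all (fun x => x.1 < 52)%N s -> bracket (f j) (lincomb b s) = lincomb b (sapp (adF j) s).
  move=> /allP s52; apply: (lincomb_app (phi := bracket (f j))) => x /s52 lx.
  exact: F4_tableF.
have b1 : bracket (f j) (b k) = lincomb b (adF j k) by exact: F4_tableF.
have b3 : bracket (f j) (bracket (f j) (bracket (f j) (b k))) = 0.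
  by rewrite b1 brk // brk // -dvec_dense // s30 dvec_dense // lincomb_nil.
rewrite expmx_conj2 // expr1n scale1r.
have nz2 : zF F 2%coqZ != 0 by rewrite zF_eq0.
apply: (can_inj (scalerK nz2)); rewrite -dvec_scale colE dvec_dense; last first.
  by rewrite !all_cat s2 all_map andbT; apply/andP; split; [rewrite /= lk | exact: s1].
rewrite !lincomb_cat lincomb1 b1 (brk _ s1); move: (lincomb b (sapp _ _)) => y.
rewrite !scalerDr scalerA -addrA; congr (_ + (_ + _)).
  by rewrite /lincomb big_map scaler_sumr; apply: eq_bigr => x _; rewrite zFM scalerA.
by rewrite mul1r mulfV // scale1r.
Qed.

Lemma exp_conj_dvec N j v : (j < 4)%N -> (0 < N)%N -> mxpow (f j) N = 0 ->
  expmx N (f j) 1 *m dvec v *m expmx N (- f j) 1 = dvec (matvec (exp_cols j) v).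
Proof.
move=> lj N0 fN; rewrite dvec_matvec mulmx_sumr mulmx_suml.
have /allP/(_ j) := exp_checkP; rewrite mem_iota => /(_ lj)/andP[/eqP -> _].
apply: eq_bigr => k _; rewrite -scalemxAr -scalemxAl; congr (_ *: _).
exact: exp_conj_basis.
Qed.

(** The leftmost factor of x conjugates last, which is the order in which [foldr] applies the
    matrices. *)
Lemma base_point (K : set 'M[F]_n) w : algebraic_group K ->
  (forall j, (j < 4)%N -> lie K (f j)) -> all (fun j => j < 4)%N w ->
  exists2 x, K x & forall v, x *m dvec v *m invmx x = dvec (word_image w v).
Proof.
move=> aK lf; have [[uK K1 KM KV] _] := aK; elim: w => [_|j w IH /= /andP[lj /IH[x Kx xE]]].
  by exists 1%:M => // v; rewrite mul1mx invmx1 mulmx1.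
have [N N1 fN] : exists2 N, (1 < N)%N & mxpow (f j) N = 0.
  have := F4_root_nilpotent (chevalley_relations_opp rel) (leq_trans lj (isT : 4 <= 24)%N).
  by rewrite F4_basis_simple.
have N0 := ltnW N1; have KE : K (expmx N (f j) 1) by exact: expmx_in_group _ aK (lf j lj) N0 fN.
exists (expmx N (f j) 1 *m x) => [|v]; first exact: KM.
have uE : expmx N (f j) 1 \in unitmx := uK _ KE; have ux : x \in unitmx := uK _ Kx.
have -> : invmx (expmx N (f j) 1 *m x) = invmx x *m expmx N (- f j) 1.
  have uEx : expmx N (f j) 1 *m x \in unitmx by rewrite unitmx_mul uE.
  rewrite -[RHS](mulKmx uEx) -mulmxA [x *m _]mulmxA mulmxV // mul1mx.
  by rewrite expmx_invl // mulmx1.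
by rewrite -(exp_conj_dvec _ lj N0 fN) -xE !mulmxA.
Qed.

End BasePoint.

(** * From the sum of Lie algebras to the open orbit *)

Section Spherical.
Variables (F : numClosedFieldType) (n : nat).
Implicit Types (G H P K : set 'M[F]_n).

(* If b_H + Ad(x) p = g, then B_H x P x^-1, hence B_H x P, is open in G. *)
Lemma spherical_of_lie_sum G H BH P x : is_group G -> H `<=` G -> borel_subgroup H BH ->
  algebraic_group P -> P `<=` G -> G x ->
  (forall Y, lie G Y -> exists Y1 Y2,
     [/\ lie BH Y1, lie (conj_set x P) Y2 & Y = Y1 + Y2]) ->
  spherical G H P.
Proof.
move=> gG sHG borBH [gP cP] sPG Gx sumG; have [[aBH _] _ sBH _] := borBH.
have [uG G1 GM GV] := gG; have [uP P1 PM PV] := gP; have ux : x \in unitmx := uG _ Gx.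
have sxP : conj_set x P `<=` G.
  move=> A PA; have -> : A = x *m (invmx x *m A *m x) *m invmx x.
    by rewrite !mulmxA mulmxK // mulmxV // mul1mx.
  by apply: (GM); [apply: GM => //; apply: sPG | apply: GV].
have [Z cZ ZE] := product_open gG aBH (conj (conj_set_group ux gP) (conj_set_closed ux cP))
  (subset_trans sBH sHG) sxP sumG.
exists BH, (left_translate x P); split=> //; first by exists x.
split=> [_ [k Bk <-]|].
  exists (k *m x); first by apply: GM => //; apply/sHG/sBH.
  apply/seteqP; split=> _ [g Pg <-]; first by exists (x *m g); [exists g | rewrite mulmxA].
  by case: Pg => g' Pg' <-; exists g'; rewrite ?mulmxA.
(* [Z] is the closed complement of BH (x P x^-1); its right translate by x is the complement of BH x
   P. [conj_set 1%:M Z] is [Z] itself. *)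
exists [set A | (conj_set 1%:M Z) (A *m invmx x)].
  have [S SE] := cZ; exists [set sandwich 1%:M (invmx x) 0 p | p in S].
  apply/seteqP; split=> A; rewrite /conj_set /= invmx1 mul1mx mulmx1 SE /=.
    move=> [uA A0]; split; first by move: uA; rewrite unitmx_mul => /andP[].
    by move=> _ [p Sp <-]; rewrite mx_eval_sandwich mul1mx addr0; apply: A0.
  move=> [uA A0]; split; first by rewrite unitmx_mul uA unitmx_inv.
  by move=> p Sp; have := A0 _ (imageP _ Sp); rewrite mx_eval_sandwich mul1mx addr0.
have mem A : G A -> left_orbit BH (left_translate x P) (left_translate A P) <->
    exists a c, [/\ BH a, conj_set x P c & A *m invmx x = a *m c].
  move=> GA; split.
    case=> k Bk kE; have : left_translate A P A by exists 1%:M => //; rewrite mulmx1.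
    rewrite -kE => -[_ [g Pg <-] <-].
    exists k, (x *m g *m invmx x); split=> //; last by rewrite !mulmxA.
    by rewrite /conj_set /= !mulmxA mulVmx // mul1mx mulmxKV.
  case=> a [c [Ba Pc AE]]; exists a => //.
  have {}AE : A = a *m x *m (invmx x *m c *m x).
    by rewrite !mulmxA mulmxK // -AE mulmxKV.
  have uc := uP _ Pc.
  apply/seteqP; split=> [_ [_ [g Pg <-] <-]|_ [g Pg <-]].
    exists (invmx (invmx x *m c *m x) *m g); first by apply: (PM) => //; apply: PV.
    by rewrite {1}AE -!(mulmxA (a *m x)) mulKVmx // mulmxA.
  exists (x *m (invmx x *m c *m x *m g)); last by rewrite AE !mulmxA.
  by exists (invmx x *m c *m x *m g) => //; apply: PM.
apply/seteqP; split=> A /=.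
  move=> [GA /(mem A GA) AO]; split=> // ZA.
  have : (G `\` Z) (A *m invmx x) by rewrite -ZE.
  by case=> _; apply; move: ZA; rewrite /conj_set /= invmx1 mul1mx mulmx1.
move=> [GA nZ]; split=> //; apply/(mem A GA).
have : (G `\` Z) (A *m invmx x).
  split; first by apply: GM => //; apply: GV.
  by move=> ZA; apply: nZ; rewrite /conj_set /= invmx1 mul1mx mulmx1.
by rewrite -ZE.
Qed.

Lemma F4_mod_B4_spherical G T B H (alpha : 'I_4 -> 'M[F]_n -> F)
    (alphav : 'I_4 -> F -> 'M[F]_n) (i : 'I_4) P :
  connected_algebraic_group G -> is_torus T -> T `<=` G ->
  borel_subgroup G B -> T `<=` B -> has_cartan_matrix cartan_F4 G T B alpha ->
  simple_coroots cartan_F4 T alpha alphav ->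
  subsystem_subgroup G T H (B4_simple_roots alpha) ->
  fundamental_parabolic G T B alphav i P -> spherical G H P.
Proof.
move=> conG torT sTG [conB solB sBG _] sTB [[baseG _] [e0 [f0 [h0 chev]]]] avP
  [conH sTH sHG baseH] parP.
have gG := conG.1.1; have gH := conH.1.1.
have rel := chevalley_relations_of chev.
set e := fun j => e0 (inord j) in rel; set f := fun j => f0 (inord j) in rel.
set h := fun j => h0 (inord j) in rel.
set b := F4_basis e f h.
have [aP sPG sBP lPh [lPb lPn]] := parabolic_lie conG torT sTG sBG sTB baseG chev avP conB.1.1 parP.
have lB k : (k < 24)%N -> lie B (b k).
  move=> lk; apply: (F4_basis_ind (I := xpredT)) => // [j _ _|j k' lj _ _ Pk'|a X|l _ _].
  - exact: (chev_e chev (inord j)).1.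
  - by apply: lie_bracket Pk'; [exact: conB.1.1 | exact: (chev_e chev (inord j)).1].
  - exact: lieZ.
  - by case: (nth _ _ _) => [[]].
have lH k : k \in B4_positive -> lie H (b k).
  exact: (B4_basis_lie torT baseG chev gH sHG baseH).
pose L X := exists2 k, k \in B4_positive & X = b k.
have pos24 k : k \in B4_positive -> (k < 24)%N.
  exact: (allP (isT : all (fun k => k < 24)%N B4_positive)).
have [|BH borBH [lBHt lBHr]] := borel_containing (L := L) conH.1 conB.1 solB torT.1 sTH sTB.
  move=> _ [k kH ->]; have lk := pos24 k kH; split; [exact: lH | exact: lB |].
  exact: (F4_root_nilpotent rel lk).
have lfG j : (j < 4)%N -> lie G (f j) by move=> lj; have [] := lie_G_generators sTG sBG chev lj.
have w4 : all (fun j => j < 4)%N (base_word i) by case: i {parP lPn lPh} => [[|[|[|[|]]]]].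
have [x Gx xE] := base_point rel conG.1 lfG w4.
apply: (spherical_of_lie_sum gG sHG borBH aP sPG Gx) => Y lY.
have [uG _ _ _] := gG.
(* [M] is the subspace b_H + Ad(x) p_i, to which the certificate of [spherical_span] is applied. *)
pose M Y := exists Y1 Y2, [/\ lie BH Y1, lie (conj_set x P) Y2 & Y = Y1 + Y2].
have MD Y1 Y2 : M Y1 -> M Y2 -> M (Y1 + Y2).
  move=> [A1 [A2 [l1 l2 ->]]] [C1 [C2 [l1' l2' ->]]].
  by exists (A1 + C1), (A2 + C2); split; [exact: lieD | exact: lieD | rewrite addrACA].
have MZ a Y1 : M Y1 -> M (a *: Y1).
  move=> [A1 [A2 [l1 l2 ->]]].
  by exists (a *: A1), (a *: A2); split; [exact: lieZ | exact: lieZ | rewrite scalerDr].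
have MB k : (k < 52)%N -> borel_index k -> M (b k).
  move=> lk bk; exists (b k), 0; rewrite addr0; split=> //; last exact: lie0.
  case/orP: bk => [kH|le48]; first by apply: lBHr; exists k.
  have lk4 : (k - 48 < 4)%N by rewrite ltn_subLR.
  by apply: lBHt; rewrite -(subnKC le48) /b F4_basis_coroot; exact: (chev_h chev).
have MP k : (k < 52)%N -> parabolic_index i k -> M (dvec b (word_image (base_word i) (dunit k))).
  move=> lk pk; exists 0, (dvec b (word_image (base_word i) (dunit k))).
  rewrite add0r; split=> //; first exact: lie0.
  rewrite -xE; apply: lie_conj; first exact: uG.
  rewrite dvec_dunit //; case/or3P: pk => [lk24|/andP[l48 /Z.eqb_spec r0]|/andP[le48 _]].
  - exact: lPb.
  - case: (ltnP k 24) => [|le24]; first exact: lPb.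
    by rewrite -(subnKC le24); apply: lPn => //; rewrite ltn_subLR.
  - by rewrite -(subnKC le48) /b F4_basis_coroot; apply: lPh; rewrite ltn_subLR.
have MY : forall Y', Y' \in F4_space e f h -> M Y'.
  move=> _ /F4_spaceP[c ->]; elim/big_ind: _ => // [|k _].
    by exists 0, 0; rewrite addr0; split=> //; exact: lie0.
  by apply: (MZ); apply: (spherical_span MD MZ (ltn_ord i) MB MP).
exact/MY/(lie_F4_space chev).
Qed.

End Spherical.

Theorem theorem10 (R : realType) (n : nat) (G T B H : set 'M[R[i]]_n)
    (alpha : 'I_4 -> 'M[R[i]]_n -> R[i])
    (alphav : 'I_4 -> R[i] -> 'M[R[i]]_n)
    (P : 'I_4 -> set 'M[R[i]]_n)
    (G_simple : simple_algebraic_group G)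
    (T_max : maximal_torus G T)
    (B_borel : borel_subgroup G B)
    (sTB : T `<=` B)
    (G_F4 : has_cartan_matrix cartan_F4 G T B alpha)
    (alphavP : simple_coroots cartan_F4 T alpha alphav)
    (G_sc : simply_connected T alphav)
    (H_B4 : subsystem_subgroup G T H (B4_simple_roots alpha))
    (PP : forall i, fundamental_parabolic G T B alphav i (P i)) :
  forall i, spherical G H (P i).
Proof.
move=> i; have [conG _ _] := G_simple; have [torT sTG _] := T_max.
exact: (@F4_mod_B4_spherical _ n G T B H alpha alphav i (P i)).
Qed.
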